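(* Consider the EC-Quartz algorithm described in the context, where $Q$ is a contraction compressor with parameter $\delta$, each $\phi_{i\tau}$ is $\frac1\gamma$-smooth, $g$ is $1$-strongly convex, and $\frac{R^2}\gamma\ge\lambda>0$. Assume $\delta<1$. Define $$\Psi_1^k:=P(x^k)-D(\alpha^k)+\frac{2(\rho+\theta\lambda)}{\delta n}\sum_{\tau=1}^n\|e_\tau^k\|^2 ,$$ where $\rho=\frac{\delta\lambda R}{2\sqrt{a_1}}$ and $a_1=(1-\delta)(2\bar R^2+\delta R_m^2)$. Let $$\theta=\min\left\{\frac{2\delta\lambda\gamma}{\delta\lambda\gamma m+\sqrt{\delta^2\lambda^2\gamma^2m^2+48\lambda\gamma a_1}},\ \frac{N\lambda\gamma p_{i\tau}}{3v_{i\tau}+N\lambda\gamma},\ \frac{\delta\lambda\gamma}{\delta\lambda\gamma m+12R\sqrt{a_1}}\right\},$$ where $p_{i\tau}=\frac1m$ and $v_{i\tau}=R_m^2+nR^2$ for all $i,\tau$. Then $$\mathbb{E}[\Psi_1^k]\le\left(1-\min\left\{\theta,\frac\delta4\right\}\right)^k\Psi_1^0 ,$$ and $\mathbb{E}[\Psi_1^k]\le\epsilon$ as long as $$k\ge O\left(\left(\frac1\delta+m+\frac{R_m^2}{n\lambda\gamma}+\frac{R^2}{\lambda\gamma}+\frac{\sqrt{1-\delta}\,R\bar R}{\delta\lambda\gamma}+\frac{\sqrt{1-\delta}\,RR_m}{\lambda\gamma\sqrt\delta}\right)\ln\frac1\epsilon\right).$$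
   Context: Problem: $N=mn$, $A_{i\tau}\in\mathbb{R}^{d\times t}$ for $1\le i\le m$, $1\le\tau\le n$; $\phi_{i\tau}:\mathbb{R}^t\to\mathbb{R}$ convex; $g:\mathbb{R}^d\to\mathbb{R}\cup\{+\infty\}$ proper closed convex; $\gamma>0$. Primal: $\min_{x\in\mathbb{R}^d}P(x)=\frac1N\sum_{\tau=1}^n\sum_{i=1}^m\phi_{i\tau}(A_{i\tau}^\top x)+\lambda g(x)$. Dual: $\max_{\alpha\in\mathbb{R}^{tN}}D(\alpha)=-\lambda g^*\big(\frac1{\lambda N}\sum_{\tau}\sum_iA_{i\tau}\alpha_{i\tau}\big)-\frac1N\sum_\tau\sum_i\phi_{i\tau}^*(-\alpha_{i\tau})$, where $\alpha$ consists of blocks $\alpha_{i\tau}\in\mathbb{R}^t$ and $\phi_{i\tau}^*,g^*$ are convex conjugates. ''$\frac1\gamma$-smooth'' means differentiable with $\frac1\gamma$-Lipschitz gradient; ''$1$-strongly convex'' means $g-\frac12\|\cdot\|^2$ is convex. $\|\cdot\|$ is the Euclidean norm for vectors and the spectral norm for matrices. $R_m=\max_{i,\tau}\|A_{i\tau}\|$; $\bar R^2=\max_\tau\frac1m\lambda_{\max}(\sum_iA_{i\tau}A_{i\tau}^\top)$; $R^2=\frac1N\lambda_{\max}(\sum_\tau\sum_iA_{i\tau}A_{i\tau}^\top)$, with $R,\bar R\ge0$. A possibly randomized map $Q:\mathbb{R}^d\to\mathbb{R}^d$ is a contraction compressor with parameter $\delta\in(0,1]$ if $\mathbb{E}\|x-Q(x)\|^2\le(1-\delta)\|x\|^2$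 for all $x\in\mathbb{R}^d$. EC-Quartz algorithm. Parameter $\theta>0$; $p_{i\tau}=\frac1m$. Initialization: $\alpha^0\in\mathbb{R}^{tN}$, $x^0\in\mathbb{R}^d$, $u^0=\frac1{\lambda N}\sum_\tau\sum_iA_{i\tau}\alpha_{i\tau}^0$, $e_\tau^0=0$. For $k=0,1,2,\dots$: $x^{k+1}=(1-\theta)x^k+\theta\nabla g^*(u^k)$; for each $\tau$ sample $i_k^\tau$ uniformly and independently from $\{1,\dots,m\}$, set $\Delta\alpha^{k+1}_{i_k^\tau\tau}=-\theta p_{i_k^\tau\tau}^{-1}\alpha^k_{i_k^\tau\tau}-\theta p_{i_k^\tau\tau}^{-1}\nabla\phi_{i_k^\tau\tau}(A_{i_k^\tau\tau}^\top x^{k+1})$, $\alpha^{k+1}_{i_k^\tau\tau}=\alpha^k_{i_k^\tau\tau}+\Delta\alpha^{k+1}_{i_k^\tau\tau}$ and $\alpha^{k+1}_{i\tau}=\alpha^k_{i\tau}$ for $i\ne i_k^\tau$; $y_\tau^k=Q\big(\frac1{\lambda m}A_{i_k^\tau\tau}\Delta\alpha^{k+1}_{i_k^\tau\tau}+e_\tau^k\big)$; $e_\tau^{k+1}=e_\tau^k+\frac1{\lambda m}A_{i_k^\tau\tau}\Delta\alpha^{k+1}_{i_k^\tau\tau}-y_\tau^k$; finally $u^{k+1}=u^k+\frac1n\sum_\tau y_\tau^k$. Here $\alpha^k\in\mathbb{R}^{tN}$ is the vector with blocks $\alpha^k_{i\tau}$. *)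

(* Defs.v *)
From HB Require Import structures.
From mathcomp Require Import all_boot all_order all_algebra.
From mathcomp Require Import all_classical all_reals all_analysis.

Set Implicit Arguments.
Unset Strict Implicit.
Unset Printing Implicit Defensive.

Import Order.TTheory GRing.Theory Num.Theory.
Import numFieldNormedType.Exports.

Local Open Scope classical_set_scope.
Local Open Scope ring_scope.

Definition dotcv (R : realType) (k : nat) (x y : 'cV[R]_k) : R :=
  \sum_(i < k) x i 0 * y i 0.

(* The norm `|x| that the library puts on matrices is the sup norm. *)
Definition enorm (R : realType) (k : nat) (x : 'cV[R]_k) : R :=
  Num.sqrt (dotcv x x).

Definition spectral_norm (R : realType) (k l : nat) (M : 'M[R]_(k, l)) : R :=
  sup [set enorm (M *m x) | x in [set x : 'cV[R]_l | enorm x <= 1]].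

(* Only applied to symmetric matrices: there the set of (real) eigenvalues is
   finite and, when 0 < k, nonempty, so this supremum is a maximum. *)
Definition lambda_max (R : realType) (k : nat) (M : 'M[R]_k) : R :=
  sup [set a : R | eigenvalue M a].

Definition grad (R : realType) (k : nat) (f : 'cV[R]_k -> R) (x : 'cV[R]_k) :
    'cV[R]_k :=
  \col_(i < k) 'D_(delta_mx i 0) (f : 'cV[R]_k -> R^o) x.

Definition smooth (R : realType) (k : nat) (L : R) (f : 'cV[R]_k -> R) : Prop :=
  (forall x, differentiable (f : 'cV[R]_k -> R^o) x) /\
  (forall x y, enorm (grad f x - grad f y) <= L * enorm (x - y)).

(* 0 * +oo = 0 in \bar R, so the cases a = 0 and a = 1 are harmless. *)
Definition econvex (R : realType) (k : nat) (f : 'cV[R]_k -> \bar R) : Prop :=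
  forall (x y : 'cV[R]_k) (a : R), 0 <= a <= 1 ->
    (f (a *: x + (1 - a) *: y)%R <= a%:E * f x + (1 - a)%:E * f y)%E.

Definition proper (R : realType) (k : nat) (f : 'cV[R]_k -> \bar R) : Prop :=
  (forall x, f x != -oo%E) /\ (exists x, f x != +oo%E).

Definition proper_closed_convex (R : realType) (k : nat)
    (f : 'cV[R]_k -> \bar R) : Prop :=
  [/\ proper f, lower_semicontinuous f & econvex f].

Definition strongly_convex1 (R : realType) (k : nat) (f : 'cV[R]_k -> \bar R) :
    Prop :=
  econvex (fun x => (f x - (2^-1 * enorm x ^+ 2)%:E)%E).

Definition conjugate (R : realType) (k : nat) (f : 'cV[R]_k -> \bar R)
    (y : 'cV[R]_k) : \bar R :=
  ereal_sup (range (fun x : 'cV[R]_k => ((dotcv y x)%:E - f x)%E)).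

Record problem (R : realType) (m n d t : nat) := Problem {
  matA : 'I_m -> 'I_n -> 'M[R]_(d, t);
  phi : 'I_m -> 'I_n -> 'cV[R]_t -> R;
  reg : 'cV[R]_d -> \bar R;
  lam : R
}.

Definition primal (R : realType) (m n d t : nat) (pb : problem R m n d t)
    (x : 'cV[R]_d) : \bar R :=
  (((m * n)%:R^-1 *
     \sum_(tau < n) \sum_(i < m) phi pb i tau ((matA pb i tau)^T *m x))%:E
   + (lam pb)%:E * reg pb x)%E.

Definition dual_point (R : realType) (m n d t : nat) (pb : problem R m n d t)
    (alpha : 'I_m -> 'I_n -> 'cV[R]_t) : 'cV[R]_d :=
  (lam pb * (m * n)%:R)^-1 *:
    \sum_(tau < n) \sum_(i < m) matA pb i tau *m alpha i tau.

Definition dual (R : realType) (m n d t : nat) (pb : problem R m n d t)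
    (alpha : 'I_m -> 'I_n -> 'cV[R]_t) : \bar R :=
  (- ((lam pb)%:E * conjugate (reg pb) (dual_point pb alpha))
   - ((m * n)%:R^-1)%:E *
       \sum_(tau < n) \sum_(i < m)
          conjugate (EFin \o phi pb i tau) (- alpha i tau)%R)%E.

(* The quantities below that are maxima of finite families are maxima of
   nonnegative numbers, so starting the iteration at 0 changes nothing. *)
Definition Rm (R : realType) (m n d t : nat) (pb : problem R m n d t) : R :=
  \big[Num.max/0]_(i < m) \big[Num.max/0]_(tau < n)
    spectral_norm (matA pb i tau).

Definition Rbar2 (R : realType) (m n d t : nat) (pb : problem R m n d t) : R :=
  \big[Num.max/0]_(tau < n)
    (m%:R^-1 *
     lambda_max (\sum_(i < m) matA pb i tau *m (matA pb i tau)^T)).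

Definition Rbar (R : realType) (m n d t : nat) (pb : problem R m n d t) : R :=
  Num.sqrt (Rbar2 pb).

Definition Rtot2 (R : realType) (m n d t : nat) (pb : problem R m n d t) : R :=
  (m * n)%:R^-1 *
  lambda_max (\sum_(tau < n) \sum_(i < m) matA pb i tau *m (matA pb i tau)^T).

Definition Rtot (R : realType) (m n d t : nat) (pb : problem R m n d t) : R :=
  Num.sqrt (Rtot2 pb).

Definition borel_cV (R : realType) (d : nat) :=
  g_sigma_algebraType (@open 'cV[R]_d).

(* A randomized map of R^d is a map Q : Z -> R^d -> R^d together with the law
   mu of its random seed z : Z; a deterministic map is the case Z = unit. *)
Definition randomized_map (R : realType) (d : nat) (dZ : measure_display)
    (Z : measurableType dZ) (Q : Z -> 'cV[R]_d -> 'cV[R]_d) : Prop :=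
  measurable_fun [set: Z * borel_cV R d]
    (fun p : Z * borel_cV R d => Q p.1 p.2 : borel_cV R d).

Definition contraction_compressor (R : realType) (d : nat)
    (dZ : measure_display) (Z : measurableType dZ) (mu : probability Z R)
    (delta : R) (Q : Z -> 'cV[R]_d -> 'cV[R]_d) : Prop :=
  0 < delta <= 1 /\
  forall x : 'cV[R]_d,
    (\int[mu]_z (enorm (x - Q z x)%R ^+ 2)%:E
       <= ((1 - delta) * enorm x ^+ 2)%:E)%E.

Definition mutually_independent (R : realType) (dO : measure_display)
    (Omega : measurableType dO) (Pr : probability Omega R) (J : eqType)
    (F : J -> set (set Omega)) : Prop :=
  forall (s : seq J) (E : J -> set Omega), uniq s ->
    (forall j, j \in s -> F j (E j)) ->
    Pr (\bigcap_(j in [set` s]) E j) = (\prod_(j <- s) Pr (E j))%E.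

(* idx k tau is the index drawn by node tau at iteration k, and xi k tau the
   seed of the call to the compressor made by node tau at iteration k: each
   call uses fresh randomness. *)
Record ec_sampling (R : realType) (m n : nat) (dZ dO : measure_display)
    (Z : measurableType dZ) (mu : probability Z R)
    (Omega : measurableType dO) (Pr : probability Omega R)
    (idx : nat -> 'I_n -> Omega -> 'I_m) (xi : nat -> 'I_n -> Omega -> Z) :
    Prop := {
  idx_measurable : forall k tau i, measurable (idx k tau @^-1` [set i]);
  xi_measurable : forall k tau, measurable_fun [set: Omega] (xi k tau);
  idx_uniform : forall k tau i,
    Pr (idx k tau @^-1` [set i]) = (m%:R^-1)%:E;
  xi_law : forall k tau (B : set Z), measurable B ->
    Pr (xi k tau @^-1` B) = mu B;
  sampling_independent :
    mutually_independent Pr (fun j : (nat * 'I_n) + (nat * 'I_n) =>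
      match j with
      | inl (k, tau) => preimage_set_system setT (idx k tau) setT
      | inr (k, tau) => preimage_set_system setT (xi k tau) measurable
      end)
}.

Record ec_state (R : realType) (m n d t : nat) := EcState {
  st_x : 'cV[R]_d;
  st_alpha : 'I_m -> 'I_n -> 'cV[R]_t;
  st_u : 'cV[R]_d;
  st_e : 'I_n -> 'cV[R]_d
}.

Definition ec_init (R : realType) (m n d t : nat) (pb : problem R m n d t)
    (x0 : 'cV[R]_d) (alpha0 : 'I_m -> 'I_n -> 'cV[R]_t) : ec_state R m n d t :=
  EcState x0 alpha0 (dual_point pb alpha0) (fun=> 0).

(* `fine` is harmless here: the conjugate of a proper closed strongly convex
   function is finite everywhere. *)
Definition grad_conjugate (R : realType) (d : nat) (g : 'cV[R]_d -> \bar R) :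
    'cV[R]_d -> 'cV[R]_d :=
  grad (fun u => fine (conjugate g u)).

Definition ec_step (R : realType) (m n d t : nat) (pb : problem R m n d t)
    (Z : Type) (Q : Z -> 'cV[R]_d -> 'cV[R]_d) (theta : R)
    (i_ : 'I_n -> 'I_m) (z_ : 'I_n -> Z) (s : ec_state R m n d t) :
    ec_state R m n d t :=
  let p : R := m%:R^-1 in
  let x := (1 - theta) *: st_x s + theta *: grad_conjugate (reg pb) (st_u s) in
  let Dalpha tau :=
    - (theta / p) *: st_alpha s (i_ tau) tau
    - (theta / p) *:
        grad (phi pb (i_ tau) tau) ((matA pb (i_ tau) tau)^T *m x) in
  let q tau := (lam pb * m%:R)^-1 *: (matA pb (i_ tau) tau *m Dalpha tau) in
  let y tau := Q (z_ tau) (q tau + st_e s tau) in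
  EcState x
    (fun i tau => if i == i_ tau then st_alpha s i tau + Dalpha tau
                  else st_alpha s i tau)
    (st_u s + n%:R^-1 *: \sum_(tau < n) y tau)
    (fun tau => st_e s tau + q tau - y tau).

Fixpoint ec_quartz (R : realType) (m n d t : nat) (pb : problem R m n d t)
    (Z : Type) (Q : Z -> 'cV[R]_d -> 'cV[R]_d) (theta : R)
    (x0 : 'cV[R]_d) (alpha0 : 'I_m -> 'I_n -> 'cV[R]_t)
    (Omega : Type) (idx : nat -> 'I_n -> Omega -> 'I_m)
    (xi : nat -> 'I_n -> Omega -> Z) (k : nat) (w : Omega) :
    ec_state R m n d t :=
  if k is k'.+1 then
    ec_step pb Q theta (fun tau => idx k' tau w) (fun tau => xi k' tau w)
      (ec_quartz pb Q theta x0 alpha0 idx xi k' w)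
  else ec_init pb x0 alpha0.

Definition a1 (R : realType) (m n d t : nat) (pb : problem R m n d t)
    (delta : R) : R :=
  (1 - delta) * (2 * Rbar pb ^+ 2 + delta * Rm pb ^+ 2).

Definition rho (R : realType) (m n d t : nat) (pb : problem R m n d t)
    (delta : R) : R :=
  delta * lam pb * Rtot pb / (2 * Num.sqrt (a1 pb delta)).

Definition Psi1 (R : realType) (m n d t : nat) (pb : problem R m n d t)
    (delta theta : R) (s : ec_state R m n d t) : \bar R :=
  (primal pb (st_x s) - dual pb (st_alpha s)
   + (2 * (rho pb delta + theta * lam pb) / (delta * n%:R) *
        \sum_(tau < n) enorm (st_e s tau) ^+ 2)%:E)%E.

Definition theta_choice (R : realType) (m n d t : nat)
    (pb : problem R m n d t) (gamma delta : R) : R :=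
  let l := lam pb in
  let a := a1 pb delta in
  let N : R := (m * n)%:R in
  let p : R := m%:R^-1 in
  let v := Rm pb ^+ 2 + n%:R * Rtot pb ^+ 2 in
  Num.min
    (2 * delta * l * gamma /
      (delta * l * gamma * m%:R +
       Num.sqrt (delta ^+ 2 * l ^+ 2 * gamma ^+ 2 * m%:R ^+ 2
                 + 48 * l * gamma * a)))
    (Num.min
      (N * l * gamma * p / (3 * v + N * l * gamma))
      (delta * l * gamma /
        (delta * l * gamma * m%:R + 12 * Rtot pb * Num.sqrt a))).

Definition complexity (R : realType) (m n d t : nat)
    (pb : problem R m n d t) (gamma delta : R) : R :=
  let lg := lam pb * gamma in
  delta^-1 + m%:R + Rm pb ^+ 2 / (n%:R * lg) + Rtot pb ^+ 2 / lg
  + Num.sqrt (1 - delta) * Rtot pb * Rbar pb / (delta * lg)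
  + Num.sqrt (1 - delta) * Rtot pb * Rm pb / (lg * Num.sqrt delta).

(* Main.v *)
(* The vector u^k + (1/n) sum_tau e_tau^k always equals the dual point of alpha^k,
   so EC-Quartz is Quartz run at a perturbed u. Conditionally on the past, the
   duality gap after one step contracts by 1 - theta, up to the error
   ||(1/n) sum_tau e_tau||^2 and terms quadratic in the dual increments; these
   quadratic terms are absorbed by the gamma-strong convexity of the phi^*, which
   is what the three bounds defining theta guarantee. The compressor contracts the
   errors by 1 - delta, whence the weight of the error term in Psi1 and the rate
   1 - min(theta, delta/4). Unconditionally: the drawn indices are uniform over the
   finite set of functions I : 'I_n -> 'I_m and the seeds are independent of the
   past, so the expectation splits over the cells {idx k = I}, and Fubini handles
   the seed on each cell. *)

Require Import Defs.
From HB Require Import structures.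
From mathcomp Require Import all_boot all_order all_algebra.
From mathcomp Require Import all_classical all_reals all_analysis.
From mathcomp Require Import measurable_realfun.
From mathcomp Require Import ring lra.

Set Implicit Arguments.
Unset Strict Implicit.
Unset Printing Implicit Defensive.

Import Order.TTheory GRing.Theory Num.Theory.
Import numFieldNormedType.Exports.

Local Open Scope classical_set_scope.
Local Open Scope ring_scope.

(** * Euclidean geometry and Rayleigh quotients *)

(** Values may be infinite: [g] and the conjugates of the [phi] can be +oo, though never -oo. If the
    gap before a step is +oo, the one-step bound is trivial because the factor 1 - min(theta,
    delta/4) is positive; otherwise every term is real, and the estimate is carried out in R through
    [gap_val], which accepts upper bounds for the values after the step. Nothing is assumed about
    the conjugate of [g]: its finiteness, its gradient and the smoothness inequalities are derived
    from quadratic growth at a minimiser whose existence rests on completeness. Each argument of the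
    minimum defining theta makes one error term at most a third of the slack gamma (1 - theta m).
    The two parts of a1 come from the mean and the second moment of a node's increment, bounded by
    Rbar and R_m. After a step the error is a sum over nodes of terms with one seed each. Hence the
    joint law of the past, the current indices and a single current seed is enough, and it follows
    from mutual independence by uniqueness of measures on a pi-system. *)

Section Euclidean.
Context {R : realType}.

Section Dot.
Context {k : nat}.
Implicit Types (x y z : 'cV[R]_k) (a : R).

Lemma dotcvC x y : dotcv x y = dotcv y x.
Proof. by apply: eq_bigr => i _; rewrite mulrC. Qed.

Lemma dotcvDl x y z : dotcv (x + y) z = dotcv x z + dotcv y z.
Proof. by rewrite -big_split; apply: eq_bigr => i _; rewrite !mxE mulrDl. Qed.

Lemma dotcvDr x y z : dotcv z (x + y) = dotcv z x + dotcv z y.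
Proof. by rewrite dotcvC dotcvDl !(dotcvC z). Qed.

Lemma dotcvZl a x y : dotcv (a *: x) y = a * dotcv x y.
Proof. by rewrite mulr_sumr; apply: eq_bigr => i _; rewrite !mxE mulrA. Qed.

Lemma dotcvZr a x y : dotcv x (a *: y) = a * dotcv x y.
Proof. by rewrite dotcvC dotcvZl dotcvC. Qed.

Lemma dotcvNl x y : dotcv (- x) y = - dotcv x y.
Proof. by rewrite -scaleN1r dotcvZl mulN1r. Qed.

Lemma dotcvNr x y : dotcv x (- y) = - dotcv x y.
Proof. by rewrite dotcvC dotcvNl dotcvC. Qed.

Lemma dotcvBl x y z : dotcv (x - y) z = dotcv x z - dotcv y z.
Proof. by rewrite dotcvDl dotcvNl. Qed.

Lemma dotcvBr x y z : dotcv z (x - y) = dotcv z x - dotcv z y.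
Proof. by rewrite dotcvDr dotcvNr. Qed.

Lemma dotcv0l x : dotcv 0 x = 0.
Proof. by apply: big1 => i _; rewrite mxE mul0r. Qed.

Lemma dotcv0r x : dotcv x 0 = 0.
Proof. by rewrite dotcvC dotcv0l. Qed.

Definition dotcvE := (dotcvDl, dotcvDr, dotcvBl, dotcvBr, dotcvZl, dotcvZr,
  dotcvNl, dotcvNr, dotcv0l, dotcv0r).

Lemma dotcv_suml (I : Type) (r : seq I) (P : pred I) (F : I -> 'cV[R]_k) y :
  dotcv (\sum_(i <- r | P i) F i) y = \sum_(i <- r | P i) dotcv (F i) y.
Proof. by elim/big_rec2: _ => [|i a b _ <-]; rewrite !dotcvE. Qed.

Lemma dotcv_sumr (I : Type) (r : seq I) (P : pred I) (F : I -> 'cV[R]_k) y :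
  dotcv y (\sum_(i <- r | P i) F i) = \sum_(i <- r | P i) dotcv y (F i).
Proof. by rewrite dotcvC dotcv_suml; apply: eq_bigr => i _; rewrite dotcvC. Qed.

Lemma dotcv_ge0 x : 0 <= dotcv x x.
Proof. by apply: sumr_ge0 => i _; rewrite -expr2 sqr_ge0. Qed.

Lemma dotcv_eq0 x : (dotcv x x == 0) = (x == 0).
Proof.
apply/eqP/eqP => [/psumr_eq0P x0|->]; last exact: dotcv0l.
apply/matrixP => i j; rewrite ord1 mxE; apply/eqP.
by rewrite -sqrf_eq0 expr2 x0// => l _; rewrite -expr2 sqr_ge0.
Qed.

Lemma enorm_ge0 x : 0 <= enorm x. Proof. exact: sqrtr_ge0. Qed.

Lemma enorm_sqr x : enorm x ^+ 2 = dotcv x x.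
Proof. by rewrite sqr_sqrtr// dotcv_ge0. Qed.

Lemma enorm0 : enorm (0 : 'cV[R]_k) = 0.
Proof. by rewrite /enorm dotcv0l sqrtr0. Qed.

Lemma enorm_eq0 x : (enorm x == 0) = (x == 0).
Proof. by rewrite -sqrf_eq0 enorm_sqr dotcv_eq0. Qed.

Lemma enormZ a x : enorm (a *: x) = `|a| * enorm x.
Proof.
by rewrite /enorm !dotcvE mulrA -expr2 sqrtrM ?sqr_ge0// sqrtr_sqr.
Qed.

Lemma enormN x : enorm (- x) = enorm x.
Proof. by rewrite -scaleN1r enormZ normrN1 mul1r. Qed.

Lemma enorm_delta (i : 'I_k) : enorm (delta_mx i 0 : 'cV[R]_k) = 1.
Proof.
rewrite /enorm /dotcv (bigD1 i)//= big1 => [|j /negPf ji]; rewrite ?mxE ?ji.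
  by rewrite !eqxx mulr1 addr0 sqrtr1.
by rewrite mul0r.
Qed.

Lemma dotcv_delta x (i : 'I_k) : dotcv x (delta_mx i 0) = x i 0.
Proof.
rewrite /dotcv (bigD1 i)//= big1 => [|j /negPf ji]; rewrite !mxE ?ji ?mulr0//.
by rewrite !eqxx mulr1 addr0.
Qed.

Lemma dotcv_young x y a : 0 < a ->
  dotcv x y <= a / 2 * dotcv x x + (2 * a)^-1 * dotcv y y.
Proof.
move=> a0; have := dotcv_ge0 (a *: x - y); rewrite !dotcvE (dotcvC y x) => h.
rewrite -subr_ge0 (_ : _ - _ = (2 * a)^-1 * (a * (a * dotcv x x) -
  a * dotcv x y - (a * dotcv x y - dotcv y y))); last by field; exact: lt0r_neq0.
rewrite mulr_ge0//; first by rewrite invr_ge0 mulr_ge0// ltW.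
by move: h; lra.
Qed.

Lemma dotcv_cs x y : dotcv x y <= enorm x * enorm y.
Proof.
have [->|x0] := eqVneq x 0; first by rewrite dotcv0l enorm0 mul0r.
have [->|y0] := eqVneq y 0; first by rewrite dotcv0r enorm0 mulr0.
have px : 0 < enorm x by rewrite lt0r enorm_eq0 x0 enorm_ge0.
have py : 0 < enorm y by rewrite lt0r enorm_eq0 y0 enorm_ge0.
(* This weight minimises the right-hand side of Young's inequality. *)
have := @dotcv_young x y (enorm y / enorm x) (divr_gt0 py px).
rewrite -!enorm_sqr => /le_trans; apply.
by rewrite le_eqVlt; apply/orP; left; apply/eqP; field; rewrite !lt0r_neq0.
Qed.

Lemma enormD x y : enorm (x + y) <= enorm x + enorm y.
Proof.
rewrite -(@ler_pXn2r _ 2) ?nnegrE ?addr_ge0 ?enorm_ge0// enorm_sqr !dotcvE.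
have := dotcv_cs x y; rewrite (dotcvC y) -!enorm_sqr; nra.
Qed.

Lemma coord_le_enorm x (i : 'I_k) : `|x i 0| <= enorm x.
Proof.
rewrite -(@ler_pXn2r _ 2) ?nnegrE ?enorm_ge0// enorm_sqr real_normK ?num_real// /dotcv.
by rewrite (bigD1 i)//= expr2 lerDl sumr_ge0// => j _; rewrite -expr2 sqr_ge0.
Qed.

Lemma norm_le_enorm x : `|x| <= enorm x.
Proof.
rewrite /Num.norm/= mx_normrE; apply/bigmax_leP; split; first exact: enorm_ge0.
by move=> [i j] _ /=; rewrite ord1 coord_le_enorm.
Qed.

Lemma enorm_le_norm x : enorm x <= k%:R * `|x|.
Proof.
have h (i : 'I_k) : `|x i 0| <= `|x|.
  by rewrite /Num.norm/= mx_normrE (le_bigmax _ _ (i, 0)).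
rewrite -(@ler_pXn2r _ 2) ?nnegrE ?enorm_ge0 ?mulr_ge0// enorm_sqr exprMn.
apply: (@le_trans _ _ (\sum_(i < k) `|x| ^+ 2)).
  by apply: ler_sum => i _; rewrite -expr2 -[x i 0 ^+ 2]real_normK ?num_real// ler_pXn2r ?nnegrE.
rewrite sumr_const card_ord -[leLHS]mulr_natl; apply: ler_wpM2r.
  exact: sqr_ge0.
by rewrite expr2 -natrM ler_nat; case: (k) => // l; rewrite leq_pmulr.
Qed.

End Dot.

Lemma dotcv_mulmxl k l (A : 'M[R]_(k, l)) x y :
  dotcv (A *m x) y = dotcv x (A^T *m y).
Proof.
rewrite /dotcv; under eq_bigr do rewrite mxE mulr_suml.
rewrite exchange_big; apply: eq_bigr => i _ /=; rewrite mxE mulr_sumr.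
by apply: eq_bigr => j _; rewrite mxE mulrAC mulrC.
Qed.

Lemma dist_lipschitz_continuous (U V : normedModType R) (f : U -> V) (L : R) :
  (forall x y, `|f x - f y| <= L * `|x - y|) -> continuous f.
Proof.
move=> fL x; apply/cvgrPdist_lt => e e0.
have M0 : 0 < `|L| + 1 by rewrite ltr_wpDl.
near=> y.
have xy : `|x - y| < e / (`|L| + 1).
  by near: y; apply: cvgr_dist_lt; [exact: cvg_id|exact: divr_gt0].
apply: le_lt_trans (fL x y) _; apply: (@le_lt_trans _ _ ((`|L| + 1) * `|x - y|)).
  by rewrite ler_wpM2r// (le_trans (ler_norm L))// lerDl.
by rewrite mulrC -ltr_pdivlMr.
Unshelve. all: by end_near. Qed.

Lemma continuous_sum (T : topologicalType) (I : Type) (r : seq I)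
    (F : I -> T -> R) : (forall i, continuous (F i)) ->
  continuous (fun x => \sum_(i <- r) F i x).
Proof.
move=> cF; elim: r => [|i r IHr] x.
  by under eq_fun do rewrite big_nil; exact: cvg_cst.
under eq_fun do rewrite big_cons.
exact: (cvgD (cF i x) (IHr x)).
Qed.

Section Continuity.
Context {k : nat}.
Implicit Types (f : 'cV[R]_k -> R).

(** The topology comes from the sup norm while all estimates are Euclidean; equivalence of the two
    norms lets the latter prove continuity. *)
Lemma continuous_enorm_lipschitz (V : normedModType R) (f : 'cV[R]_k -> V)
    (L : R) : (forall x y, `|f x - f y| <= L * enorm (x - y)) -> continuous f.
Proof.
move=> fL; apply: (@dist_lipschitz_continuous _ _ _ (`|L| * k%:R)) => x y.
apply: le_trans (fL x y) _; apply: (@le_trans _ _ (`|L| * enorm (x - y))).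
  by rewrite ler_wpM2r ?enorm_ge0// ler_norm.
by rewrite -mulrA ler_wpM2l// enorm_le_norm.
Qed.

Lemma continuous_enorm : continuous (@enorm R k).
Proof.
apply: (@continuous_enorm_lipschitz _ _ 1) => x y; rewrite mul1r.
rewrite ler_norml; apply/andP; split.
  by have := enormD (y - x) x; rewrite subrK -(enormN (y - x)) opprB; lra.
by have := enormD (x - y) y; rewrite subrK; lra.
Qed.

Lemma continuous_dotcvr (x : 'cV[R]_k) : continuous (dotcv x).
Proof.
apply: (@continuous_enorm_lipschitz _ _ (enorm x)) => y z.
rewrite -dotcvBr ler_norml dotcv_cs andbT.
by rewrite lerNl -dotcvNr -[leRHS]/(_ * _) -(enormN (y - z)) dotcv_cs.
Qed.

End Continuity.

Section Rayleigh.
Context {k : nat}.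
Variable M : 'M[R]_k.
Hypothesis Msym : M^T = M.

Let ray (x : 'cV[R]_k) := dotcv x (M *m x).

Let raysym x y : dotcv x (M *m y) = dotcv y (M *m x).
Proof. by rewrite -{1}Msym -dotcv_mulmxl dotcvC. Qed.

Lemma continuous_rayleigh : continuous ray.
Proof.
apply: continuous_sum => i x.
apply: (cvgM (@coord_continuous R k 1 i 0 x)).
have -> : (fun y : 'cV[R]_k => (M *m y) i 0) =
    (fun y => \sum_(j <- index_enum 'I_k) M i j * y j 0).
  by apply/funext => y; rewrite mxE.
rewrite mxE; apply: continuous_sum => j y.
by apply: (cvgM _ (@coord_continuous R k 1 j 0 y)); exact: cvg_cst.
Qed.

(** Moving c along the residual v = M c - (ray c) c, maximality forces 2 e |v|^2 <= e^2 K for every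
    real e. The left side is of first order in e, so v = 0. *)
Lemma rayleigh_max_eigen (c : 'cV[R]_k) : dotcv c c = 1 ->
  (forall x, ray x <= ray c * dotcv x x) -> M *m c = ray c *: c.
Proof.
move=> c1 cmax; apply/eqP; rewrite -subr_eq0 -dotcv_eq0.
set v := M *m c - ray c *: c.
have vv : dotcv v v = dotcv v (M *m c) - ray c * dotcv v c.
  by rewrite {2}/v dotcvBr dotcvZr.
clearbody v; have [//|v0] := eqVneq (dotcv v v) 0.
have pv : 0 < dotcv v v by rewrite lt0r v0 dotcv_ge0.
pose K := ray c * dotcv v v - ray v.
have key e : 2 * e * dotcv v v <= e ^+ 2 * K.
  have := cmax (c + e *: v).
  rewrite /ray mulmxDr -scalemxAr !dotcvE (raysym c v) (dotcvC c v) c1.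
  rewrite /K vv -/(ray c) -/(ray v); nra.
have K0 : 0 < K by have := key 1; nra.
have := key (dotcv v v / K).
rewrite (_ : (dotcv v v / K) ^+ 2 * K = dotcv v v / K * dotcv v v);
  last by field; exact: lt0r_neq0.
have : 0 < dotcv v v / K * dotcv v v by rewrite mulr_gt0// divr_gt0.
nra.
Qed.

(** The quotient attains its maximum on the compact unit sphere, at an eigenvector. The sphere is
    taken in row vectors to match [EVT_max_rV]. *)
Lemma rayleigh_le_lambda_max x : ray x <= lambda_max M * dotcv x x.
Proof.
have [->|x0] := eqVneq x 0; first by rewrite /ray !dotcvE mulr0.
pose S := [set v : 'rV[R]_k | enorm v^T = 1].
have trc : continuous (fun v : 'rV[R]_k => v^T : 'cV[R]_k).
  apply: (@dist_lipschitz_continuous _ _ _ 1) => v w; rewrite mul1r -linearB/=.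
  rewrite [leLHS]/Num.norm/= mx_normrE; apply/bigmax_leP; split => //.
  move=> [i j] _ /=; rewrite mxE.
  by rewrite /Num.norm/= mx_normrE (le_bigmax _ _ (j, i)).
have S0 : S !=set0.
  exists (((enorm x)^-1 *: x)^T); rewrite /S/= trmxK enormZ.
  by rewrite ger0_norm ?invr_ge0 ?enorm_ge0// mulVf// enorm_eq0.
have Sc : compact S.
  apply: bounded_closed_compact.
    exists 1; split; first exact: num_real.
    move=> B B1 v Sv; apply: le_trans (ltW B1).
    rewrite -[1]Sv; apply: le_trans (norm_le_enorm _).
    rewrite [leLHS]/Num.norm/= mx_normrE.
    apply/bigmax_leP; split => // -[i j] _ /=.
    by rewrite /Num.norm/= mx_normrE (le_trans _ (le_bigmax _ _ (j, i)))//= mxE.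
  rewrite (_ : S = (fun v : 'rV[R]_k => enorm v^T) @^-1` [set 1])//.
  apply: closed_comp; last exact: closed_eq.
  by move=> v _; apply: continuous_comp; [exact: trc|exact: continuous_enorm].
have [|c Sc' cmax] := @EVT_max_rV R _ (fun v : 'rV[R]_k => ray v^T) S S0 Sc.
  apply: continuous_subspaceT => v.
  by apply: continuous_comp; [exact: trc|exact: continuous_rayleigh].
pose u := c^T; move: Sc'; rewrite inE /S/= -/u => u1.
have uu : dotcv u u = 1 by rewrite -enorm_sqr u1 expr1n.
have umax y : ray y <= ray u * dotcv y y.
  have [->|y0] := eqVneq y 0; first by rewrite /ray !dotcvE mulr0.
  have ny : enorm y != 0 by rewrite enorm_eq0.
  have := cmax ((enorm y)^-1 *: y)^T.
  rewrite inE /S/= trmxK enormZ ger0_norm ?invr_ge0 ?enorm_ge0//.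
  rewrite mulVf// => /(_ erefl); rewrite -/u {1}/ray -scalemxAr !dotcvE mulrA.
  rewrite -invfM -expr2 enorm_sqr mulrC ler_pdivrMr//.
  by rewrite lt0r dotcv_eq0 y0 dotcv_ge0.
have eu := rayleigh_max_eigen uu umax.
have eig : eigenvalue M (ray u).
  apply/eigenvalueP; exists u^T.
    by rewrite -{1}Msym -trmx_mul eu linearZ.
  rewrite -trmx_eq0 trmxK; apply/eqP => u0.
  by move: uu; rewrite u0 dotcv0l => /eqP; rewrite eq_sym oner_eq0.
apply: le_trans (umax x) _; rewrite ler_wpM2r ?dotcv_ge0//.
(* The supremum defining [lambda_max] needs a bounded set: [ray u] also bounds every eigenvalue. *)
apply: ub_le_sup => //; exists (ray u) => a /= /eigenvalueP[v va v0].
have mv : M *m v^T = a *: v^T by rewrite -{1}Msym -trmx_mul va linearZ.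
have := umax v^T; rewrite {1}/ray mv !dotcvE ler_pM2r//.
by rewrite lt0r dotcv_ge0 dotcv_eq0 trmx_eq0 v0.
Qed.

End Rayleigh.

(** * Gram matrices and the spectral norm *)

Section Gram.
Context (I : finType) (d t : nat) (A : I -> 'M[R]_(d, t)).
Let M := \sum_i A i *m (A i)^T.

Let Msym : M^T = M.
Proof.
by rewrite /M raddf_sum/=; apply: eq_bigr => i _; rewrite trmx_mul trmxK.
Qed.

Let dotM y : dotcv y (M *m y) = \sum_i dotcv ((A i)^T *m y) ((A i)^T *m y).
Proof.
rewrite /M mulmx_suml dotcv_sumr; apply: eq_bigr => i _.
by rewrite -mulmxA dotcvC dotcv_mulmxl.
Qed.

Lemma lambda_max_gram_ge0 : (0 < d)%N -> 0 <= lambda_max M.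
Proof.
move=> d0; pose x : 'cV[R]_d := delta_mx (Ordinal d0) 0.
have x1 : dotcv x x = 1 by rewrite -enorm_sqr enorm_delta expr1n.
rewrite -[lambda_max M]mulr1 -x1; apply: le_trans (rayleigh_le_lambda_max Msym x).
by rewrite dotM sumr_ge0// => i _; exact: dotcv_ge0.
Qed.

(** With y the sum, |y|^2 is the sum of the <A_i^T y, h_i>. Young's inequality with weight a bounds
    it through the Rayleigh quotient of y, and a = 1 / [lambda_max] gives the claim. *)
Lemma dotcv_gram_le (h : I -> 'cV[R]_t) : (0 < d)%N ->
  dotcv (\sum_i A i *m h i) (\sum_i A i *m h i) <=
  lambda_max M * \sum_i dotcv (h i) (h i).
Proof.
move=> d0; set y := \sum_i _; set S := \sum_i dotcv _ _.
have l0 := lambda_max_gram_ge0 d0; set l := lambda_max M in l0 *.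
have S0 : 0 <= S by apply: sumr_ge0 => i _; exact: dotcv_ge0.
have My := rayleigh_le_lambda_max Msym y; rewrite dotM -/l in My.
have yy a : 0 < a -> dotcv y y <= a / 2 * (l * dotcv y y) + (2 * a)^-1 * S.
  move=> a0; have yE : dotcv y y = \sum_i dotcv ((A i)^T *m y) (h i).
    rewrite {2}/y dotcv_sumr; apply: eq_bigr => i _.
    by rewrite dotcvC dotcv_mulmxl dotcvC.
  rewrite {1}yE; apply: (@le_trans _ _ (a / 2 * \sum_i dotcv ((A i)^T *m y) ((A i)^T *m y) +
      (2 * a)^-1 * S)).
    rewrite !mulr_sumr -big_split/=; apply: ler_sum => i _.
    exact: dotcv_young.
  by rewrite lerD2r ler_wpM2l// divr_ge0// ltW.
move: l0; rewrite le_eqVlt => /predU1P[l0|l0]; last first.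
  have := yy l^-1; rewrite invr_gt0 => /(_ l0).
  have -> : l^-1 / 2 * (l * dotcv y y) + (2 / l)^-1 * S =
      dotcv y y / 2 + l * S / 2 by field; rewrite gt_eqF.
  by lra.
(* When the largest eigenvalue is 0 no weight is optimal; the weight tends to infinity instead, (S +
   1) / e leaving an error below e. *)
rewrite -l0 mul0r; apply/ler_addgt0Pl => e e0; rewrite addr0.
have := yy ((S + 1) / e); rewrite divr_gt0 ?ltr_wpDl// => /(_ isT).
rewrite -l0 mul0r mulr0 add0r => /le_trans; apply.
rewrite invfM invf_div mulrA mulrAC ler_pdivrMr ?ltr_wpDl//.
by rewrite -mulrA mulrC; nra.
Qed.

End Gram.

Lemma spectral_norm_has_ubound d t (A : 'M[R]_(d, t)) :
  has_ubound [set enorm (A *m x) | x in [set x : 'cV[R]_t | enorm x <= 1]].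
Proof.
pose C := \sum_(i < d) enorm (row i A)^T.
exists C => _ [x /= x1 <-].
have coord (i : 'I_d) : (A *m x) i 0 = dotcv (row i A)^T x.
  by rewrite /dotcv mxE; apply: eq_bigr => j _; rewrite !mxE.
have coordle (i : 'I_d) : `|(A *m x) i 0| <= enorm (row i A)^T.
  rewrite coord; apply: (@le_trans _ _ (enorm (row i A)^T * enorm x)).
    rewrite ler_norml dotcv_cs andbT lerNl -dotcvNl -(enormN (row i A)^T).
    exact: dotcv_cs.
  by rewrite ler_piMr ?enorm_ge0.
have C0 : 0 <= C by apply: sumr_ge0 => i _; exact: enorm_ge0.
rewrite -(@ler_pXn2r _ 2) ?nnegrE ?enorm_ge0// enorm_sqr /dotcv expr2.
rewrite {1}/C mulr_suml; apply: ler_sum => i _.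
rewrite -expr2 -[_ ^+ 2]real_normK ?num_real// expr2 ler_pM//.
apply: le_trans (coordle i) _; rewrite /C (bigD1 i)//= lerDl.
by apply: sumr_ge0 => j _; exact: enorm_ge0.
Qed.

Lemma spectral_norm_ge0 d t (A : 'M[R]_(d, t)) : 0 <= spectral_norm A.
Proof.
apply: ub_le_sup; first exact: spectral_norm_has_ubound.
by exists 0; rewrite /= ?mulmx0 enorm0.
Qed.

Lemma dotcv_mulmx_le d t (A : 'M[R]_(d, t)) h :
  dotcv (A *m h) (A *m h) <= spectral_norm A ^+ 2 * dotcv h h.
Proof.
have [->|h0] := eqVneq h 0; first by rewrite mulmx0 !dotcv0l mulr0.
have ph : 0 < enorm h by rewrite lt0r enorm_eq0 h0 enorm_ge0.
rewrite -!enorm_sqr -exprMn ler_pXn2r ?nnegrE ?enorm_ge0//; last first.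
  by rewrite mulr_ge0 ?enorm_ge0 ?spectral_norm_ge0.
rewrite -ler_pdivrMr// -[leLHS]mulrC -[(enorm h)^-1]ger0_norm ?invr_ge0 ?enorm_ge0//.
rewrite -enormZ; apply: ub_le_sup; first exact: spectral_norm_has_ubound.
  exists ((enorm h)^-1 *: h); last by rewrite -scalemxAr.
  by rewrite /= enormZ ger0_norm ?invr_ge0 ?enorm_ge0// mulVf// gt_eqF.
Qed.

End Euclidean.

(** * Conjugates of strongly convex and of smooth functions *)

Section StronglyConvexMinimum.
Context {R : realType} {k : nat}.
Variable f : 'cV[R]_k -> \bar R.

(** Stated only for points of finite value, so that the quadratic term is subtracted in R. *)
Definition strong_convexity_ineq :=
  forall x y a b t, f x = a%:E -> f y = b%:E -> 0 <= t <= 1 ->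
    (f (t *: x + (1 - t) *: y)
       <= (t * a + (1 - t) * b - t * (1 - t) / 2 * dotcv (x - y) (x - y))%:E)%E.

Hypothesis fproper : Defs.proper f.
Hypothesis flsc : lower_semicontinuous f.
Hypothesis fsc : strong_convexity_ineq.

Let fNy x : f x != -oo%E. Proof. by have [+ _] := fproper; exact. Qed.

Let fin x : (exists a, f x = a%:E) \/ f x = +oo%E.
Proof. by move: (fNy x); case: (f x) => [a _|_|//]; [left; exists a|right]. Qed.

(** Lower semicontinuity bounds f below on a ball around x0. A far point x is compared with the
    point of the segment from x0 to x at distance r/2 from x0: strong convexity then makes f x grow
    quadratically in the distance. *)
Lemma strongly_convex_bounded_below : exists M : R, forall x, (M%:E <= f x)%E.
Proof.
have [_ [x0 fx0]] := fproper.
have [[a fx0a]|] := fin x0; last by move=> e; rewrite e eqxx in fx0.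
have [|V /nbhs_ballP[r /= r0 rV] aV] := @flsc x0 (a - 1).
  by rewrite fx0a lte_fin ltrBlDr ltrDl.
have near x : enorm (x - x0) < r -> ((a - 1)%:E < f x)%E.
  move=> xr; apply/aV/rV; rewrite -ball_normE/= -normrN opprB.
  exact: le_lt_trans (norm_le_enorm _) xr.
(* The term 4 / r^2 comes from completing the square: D^2/4 - 2 D/r = (D/2 - 2/r)^2 - 4/r^2. *)
exists (a - 1 - 4 / r ^+ 2) => x.
have r2 : 0 < 4 / r ^+ 2 by rewrite divr_gt0// exprn_gt0.
have [xr|rx] := ltP (enorm (x - x0)) r.
  by apply: le_trans (ltW (near _ xr)); rewrite lee_fin; lra.
have [[b fxb]|->] := fin x; last exact: leey.
set D := enorm (x - x0) in rx *; have D0 : 0 < D by apply: lt_le_trans rx.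
pose s := r / (2 * D).
have s0 : 0 < s by rewrite divr_gt0// mulr_gt0.
have sD : s * D = r / 2 by rewrite /s; field; rewrite gt_eqF.
have s2 : s <= 2^-1.
  by rewrite ler_pdivrMr ?mulr_gt0// mulrA mulVf// mul1r.
have s01 : 0 <= s <= 1 by apply/andP; split; lra.
have := fsc fxb fx0a s01; rewrite -enorm_sqr -/D => h.
have : ((a - 1)%:E < f (s *: x + (1 - s) *: x0))%E.
  apply: near; rewrite (_ : _ - x0 = s *: (x - x0)); last first.
    by apply/matrixP => i j; rewrite !mxE; ring.
  by rewrite enormZ ger0_norm ?ltW// -/D sD; lra.
move=> /lt_le_trans/(_ h); rewrite lte_fin fxb lee_fin => {}h.
have q : 0 <= (D / 2 - 2 / r) ^+ 2 by exact: sqr_ge0.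
have qE : (D / 2 - 2 / r) ^+ 2 = D ^+ 2 / 4 - 2 * D / r + 4 / r ^+ 2.
  by field; rewrite gt_eqF.
have si : s^-1 = 2 * D / r by rewrite /s invf_div.
have : s^-1 * (a - 1 - a) < s^-1 * (s * (b - a - (1 - s) / 2 * D ^+ 2)).
  by rewrite ltr_pM2l ?invr_gt0//; lra.
rewrite mulrA mulVf ?gt_eqF// mul1r si => h2.
have : 4^-1 * D ^+ 2 <= (1 - s) / 2 * D ^+ 2.
  by rewrite ler_wpM2r ?sqr_ge0//; lra.
by move: q h2; rewrite qE; lra.
Qed.

(* A minimising sequence is Cauchy by strong convexity at midpoints. *)
Lemma strongly_convex_min : exists w b, f w = b%:E /\
  forall x, ((b + 2^-1 * dotcv (x - w) (x - w))%:E <= f x)%E.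
Proof.
have [M fM] := strongly_convex_bounded_below.
pose E := [set b : R | exists x, f x = b%:E].
have hE : has_inf E.
  split; last by exists M => b [x fx]; have := fM x; rewrite fx lee_fin.
  have [_ [x fx]] := fproper.
  by have [[b fb]|e] := fin x; [exists b, x|rewrite e eqxx in fx].
pose I := inf E.
have IE x b : f x = b%:E -> I <= b by move=> fx; apply: ge_inf; [exact: hE.2|exists x].
have [u ux] : {u : nat -> 'cV[R]_k * R & forall n, f (u n).1 = (u n).2%:E /\
    (u n).2 < I + n.+1%:R^-1}.
  apply: (@choice _ _ (fun n (p : 'cV[R]_k * R) =>
    f p.1 = p.2%:E /\ p.2 < I + n.+1%:R^-1)) => n.
  have [|b [x fx] bI] := @inf_adherent _ E n.+1%:R^-1 _ hE.
    by rewrite invr_gt0.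
  by exists (x, b).
have dist n m : dotcv ((u n).1 - (u m).1) ((u n).1 - (u m).1) <=
    4 * (n.+1%:R^-1 + m.+1%:R^-1).
  have [fn bn] := ux n; have [fm bm] := ux m.
  have h01 : (0 <= 2^-1 :> R) && (2^-1 <= 1 :> R).
    by apply/andP; split; lra.
  have := fsc fn fm h01; set z := (_ + _).
  have [[c fz]|-> //] := fin z.
  rewrite fz lee_fin; have := IE _ _ fz.
  by move: (n.+1%:R^-1) (m.+1%:R^-1) (dotcv _ _) bn bm => p q D; lra.
have cu : cvg ((fun n => (u n).1) @ \oo).
  apply/cauchy_cvgP/cauchy_exP => e e0 /=.
  have [N _ NE] : \forall n \near \oo, n.+1%:R^-1 < e ^+ 2 / 8.
    have p0 : 0 < e ^+ 2 / 8 by rewrite divr_gt0// exprn_gt0.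
    exact: (near_infty_natSinv_lt (PosNum p0)).
  exists (u N).1; exists N => // n /= Nn.
  rewrite -ball_normE/=; apply: le_lt_trans (norm_le_enorm _) _.
  rewrite -(@ltr_pXn2r _ 2) ?nnegrE ?enorm_ge0 ?(ltW e0)// enorm_sqr.
  apply: le_lt_trans (dist N n) _.
  have h1 : n.+1%:R^-1 < e ^+ 2 / 8 := NE _ Nn.
  have h2 : N.+1%:R^-1 < e ^+ 2 / 8 := NE _ (leqnn N).
  by move: (n.+1%:R^-1) (N.+1%:R^-1) (e ^+ 2) h1 h2 => p q r; lra.
pose w := lim ((fun n => (u n).1) @ \oo).
have fwI : (f w <= I%:E)%E.
  rewrite leNgt; apply/negP => fw.
  have [c Ic cw] : exists2 c, I < c & (c%:E < f w)%E.
    have [[b fb]|e] := fin w.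
      exists ((I + b) / 2); move: fw; rewrite fb !lte_fin; lra.
    by exists (I + 1); rewrite ?e ?ltry// ltrDl.
  have [V Vw Vc] := flsc cw.
  have [N1 _ N1V] : \forall n \near \oo, V (u n).1 by exact: cu _ Vw.
  have [N2 _ N2c] : \forall n \near \oo, n.+1%:R^-1 < c - I.
    have p0 : 0 < c - I by rewrite subr_gt0.
    exact: (near_infty_natSinv_lt (PosNum p0)).
  have := Vc _ (N1V (maxn N1 N2) (leq_maxl _ _)).
  have [-> h] := ux (maxn N1 N2).
  have h2 : (maxn N1 N2).+1%:R^-1 < c - I := N2c _ (leq_maxr _ _).
  by move: (_^-1) h h2; rewrite lte_fin => p; lra.
have [[b fwb]|e] := fin w; last by rewrite e in fwI.
have bI : b = I.
  by apply/eqP; rewrite eq_le (IE _ _ fwb) andbT -lee_fin -fwb.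
exists w, b; split => // x; have [[c fx]|->] := fin x; last exact: leey.
rewrite fx lee_fin leNgt; apply/negP.
set D := dotcv _ _ => cD.
have bc : b <= c by rewrite bI; exact: IE fx.
have D0 : 0 < D by lra.
(* Minimality against t x + (1 - t) w gives c >= b + (1 - t) D/2. With t D equal to the supposed
   deficit b + D/2 - c, this fails by half the deficit. *)
pose t := (b + 2^-1 * D - c) / D.
have tD : t * D = b + 2^-1 * D - c by rewrite /t divfK// gt_eqF.
have t0 : 0 < t by rewrite /t divr_gt0//; lra.
have t2 : t <= 2^-1 by rewrite /t ler_pdivrMr//; lra.
have t01 : 0 <= t <= 1 by apply/andP; split; lra.
have := fsc fx fwb t01; set z := (_ + _); rewrite -/D.
have [[e fz]|-> //] := fin z.
rewrite fz lee_fin; have := IE _ _ fz; rewrite -bI => be h.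
have : 0 <= t * (c - b - (1 - t) / 2 * D) by lra.
rewrite pmulr_rge0//; nra.
Qed.

End StronglyConvexMinimum.

Section ConjugateStronglyConvex.
Context {R : realType} {k : nat}.
Variable g : 'cV[R]_k -> \bar R.
Hypothesis gpcc : proper_closed_convex g.
Hypothesis gsc : strongly_convex1 g.

Lemma strongly_convex1_ineq : strong_convexity_ineq g.
Proof.
move=> x y a b t gx gy t01; have := gsc x y t01; rewrite gx gy.
rewrite -!EFinB -!EFinM -EFinD leeBlDr// -EFinD => /le_trans; apply.
rewrite lee_fin !enorm_sqr !dotcvE (dotcvC y x); lra.
Qed.

(** Subtracting a linear form preserves properness, lower semicontinuity and strong convexity, so
    [strongly_convex_min] applies to g - <u, .>. The growth inequality at w is the form in which
    strong convexity enters the estimates on the conjugate. *)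
Lemma conjugate_maximiser u : exists w b, g w = b%:E /\ forall x,
  ((b + dotcv u (x - w) + 2^-1 * dotcv (x - w) (x - w))%:E <= g x)%E.
Proof.
have [gprop glsc _] := gpcc; have [gNy [x0 gx0]] := gprop.
have fE x a : g x = a%:E -> (g x - (dotcv u x)%:E)%E = (a - dotcv u x)%:E.
  by move=> ->.
have [||x y a b t|w [b [fw fmin]]] :=
    @strongly_convex_min R k (fun x => g x - (dotcv u x)%:E)%E.
- split; first by move=> x; move: (gNy x); case: (g x).
  by exists x0; move: gx0; case: (g x0).
- move=> x a ax.
  have [e e0 aex] : exists2 e, 0 < e & ((a + e + dotcv u x)%:E < g x)%E.
    move: ax (gNy x); case: (g x) => [b|_ _|//].
      rewrite -EFinB lte_fin => ab _; exists ((b - dotcv u x - a) / 2).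
        by rewrite divr_gt0// subr_gt0.
      rewrite lte_fin; lra.
    by exists 1 => //; rewrite ltry.
  have [V Vx Va] := glsc _ _ aex.
  exists (V `&` [set y | dotcv u y < dotcv u x + e]); last first.
    move=> y [/Va + /= yx]; move: (gNy y).
    case: (g y) => [b _|_ _|//]; last by rewrite ltry.
    by rewrite -EFinB !lte_fin; lra.
  apply: filterI => //.
  apply: (@continuous_dotcvr R k u x [set z | z < dotcv u x + e]).
  by apply: lt_nbhsl; rewrite ltrDl.
- have gf z c : (g z - (dotcv u z)%:E)%E = c%:E -> g z = (c + dotcv u z)%:E.
    by case: (g z) => [r||]//=; rewrite -EFinB => -[<-]; rewrite subrK.
  move=> /gf gx /gf gy t01; have := strongly_convex1_ineq gx gy t01.
  move: (gNy (t *: x + (1 - t) *: y)); case: (g _) => [r _||]//.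
  rewrite -EFinB !lee_fin !dotcvE; lra.
have [c gw] : exists c, g w = c%:E.
  by move: fw; case: (g w) => [c _||]//; exists c.
exists w, c; split => // x; have := fmin x; move: (gNy x) (fw).
rewrite gw -EFinB => + [<-].
case: (g x) => [r _||]//; rewrite ?leey//.
rewrite -EFinB !lee_fin !dotcvE; lra.
Qed.

Lemma conjugateE u w b : g w = b%:E -> (forall x,
    ((b + dotcv u (x - w) + 2^-1 * dotcv (x - w) (x - w))%:E <= g x)%E) ->
  conjugate g u = (dotcv u w - b)%:E.
Proof.
move=> gw gmin; apply/eqP; rewrite eq_le; apply/andP; split.
  apply: ge_ereal_sup => _ [x _ <-]; have := gmin x.
  case: (g x) => [r||]//; rewrite ?leNye// -EFinB !lee_fin dotcvBr.
  by have := dotcv_ge0 (x - w); lra.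
by apply: ereal_sup_ubound; exists w => //; rewrite gw -EFinB.
Qed.

(** [grad] consists of partial derivatives, so it suffices to differentiate the conjugate along each
    axis. *)
Lemma grad_conjugate_maximiser u : exists b, g (grad_conjugate g u) = b%:E /\
  forall x, let w := grad_conjugate g u in
  ((b + dotcv u (x - w) + 2^-1 * dotcv (x - w) (x - w))%:E <= g x)%E.
Proof.
have [w [b [gw gmin]]] := conjugate_maximiser u.
suff -> : grad_conjugate g u = w by exists b.
apply/matrixP => i j; rewrite ord1 mxE; apply: cvg_lim => //.
pose q (h : R) := fine (conjugate g (h *: delta_mx i 0 + u)).
(* Growth of g at the maximisers for u and for u + h e_i puts the remainder between 0 and h^2/2. *)
have qE (h : R) : `|q h - q 0 - h * w i 0| <= h ^+ 2 / 2.
  rewrite /q scale0r add0r.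
  have [v [c [gv vmin]]] := conjugate_maximiser (h *: delta_mx i 0 + u).
  rewrite (conjugateE gw gmin) (conjugateE gv vmin) /=.
  have := gmin v; rewrite gv lee_fin; have := vmin w; rewrite gw lee_fin.
  rewrite !dotcvE !(dotcvC (delta_mx i 0)) !dotcv_delta (dotcvC w v).
  set vv := dotcv v v; set vw := dotcv v w; set ww := dotcv w w => h1 h2.
  have cs : (v i 0 - w i 0) ^+ 2 <= vv - vw - (vw - ww).
    have := coord_le_enorm (v - w) i.
    rewrite -(@ler_pXn2r _ 2) ?nnegrE ?enorm_ge0// enorm_sqr.
    rewrite real_normK ?num_real// !mxE !dotcvE (dotcvC w v).
    by rewrite /vv /vw /ww; lra.
  have := sqr_ge0 (h - (v i 0 - w i 0)); have := sqr_ge0 (v i 0 - w i 0).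
  have := sqr_ge0 h; rewrite ler_norml => q1 q2 q3; apply/andP; split; lra.
apply/cvgrPdist_le => e e0; near=> h.
have h0 : h != 0 by near: h; exact: nbhs_dnbhs_neq.
have he : `|h| <= e.
  by near: h; apply: dnbhs0_le.
rewrite /= -[fine (conjugate g u)](_ : q 0 = _); last by rewrite /q scale0r add0r.
rewrite -/(q h) -[_ *: _]/(h^-1 * (q h - q 0)).
rewrite (_ : _ - _ = - (h^-1 * (q h - q 0 - h * w i 0))); last by field.
rewrite normrN normrM normfV ler_pdivrMl ?normr_gt0//.
apply: le_trans (qE h) _; rewrite -real_normK ?num_real// expr2.
have := normr_ge0 h; nra.
Unshelve. all: by end_near. Qed.

Lemma conjugate_fin u : conjugate g u = (fine (conjugate g u))%:E.
Proof.
have [b [gw gmin]] := grad_conjugate_maximiser u.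
by rewrite (conjugateE gw gmin).
Qed.

(** Equality case of Fenchel-Young. In particular the gradient lies where g is finite, so the update
    of x keeps g finite. *)
Lemma reg_grad_conjugate u : g (grad_conjugate g u) =
  (dotcv u (grad_conjugate g u) - fine (conjugate g u))%:E.
Proof.
have [b [gw gmin]] := grad_conjugate_maximiser u.
by rewrite (conjugateE gw gmin)/= opprB addrC subrK.
Qed.

(** Descent inequality obtained without integrating a gradient: growth of g at the maximiser for u,
    tested at the maximiser for v, and Young's inequality with weight 1. *)
Lemma conjugate_smooth_le u v :
  fine (conjugate g v) <= fine (conjugate g u) +
    dotcv (v - u) (grad_conjugate g u) + 2^-1 * dotcv (v - u) (v - u).
Proof.
have [b [gw gmin]] := grad_conjugate_maximiser u.
have [c [gv vmin]] := grad_conjugate_maximiser v.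
rewrite (conjugateE gw gmin) (conjugateE gv vmin)/=.
have /= := gmin (grad_conjugate g v); rewrite gv lee_fin /=.
move: (grad_conjugate g u) (grad_conjugate g v) => w z.
have := dotcv_young (v - u) (z - w) ltr01.
rewrite !dotcvE; lra.
Qed.

(** Adding the two growth inequalities gives |w - z|^2 <= <u - v, w - z>. *)
Lemma grad_conjugate_lipschitz u v :
  enorm (grad_conjugate g u - grad_conjugate g v) <= enorm (u - v).
Proof.
have [b [gw gmin]] := grad_conjugate_maximiser u.
have [c [gv vmin]] := grad_conjugate_maximiser v.
rewrite -(@ler_pXn2r _ 2) ?nnegrE ?enorm_ge0// !enorm_sqr.
have /= := gmin (grad_conjugate g v); rewrite gv lee_fin /=.
have /= := vmin (grad_conjugate g u); rewrite gw lee_fin /=.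
move: (grad_conjugate g u) (grad_conjugate g v) => w z.
have := dotcv_young (u - v) (w - z) ltr01.
rewrite !dotcvE (dotcvC w z); lra.
Qed.

End ConjugateStronglyConvex.

Lemma is_derive_quadratic (R : realType) (h : R -> R^o) (dh s c0 c1 : R) :
  is_derive s 1 h dh ->
  is_derive s 1 (fun s : R => h s - (c0 * s + c1 * s ^+ 2) : R^o)
    (dh - (c0 + c1 * (2 * s))).
Proof.
move=> dhs; have d1 := @is_derive_id R R^o s 1.
have d2 := @is_deriveX R R^o _ 2 s 1 _ d1.
have d3 := is_deriveB dhs (is_deriveD (is_deriveZ c0 d1) (is_deriveZ c1 d2)).
set F := (X in is_derive _ _ X _) in d3; set G := (X in is_derive _ _ X _).
have <- : F = G by apply/funext => x; rewrite /F /G !fctE expr2.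
by apply: is_derive_eq; rewrite /= -![_ *: _]/(_ * _); ring.
Qed.

(** * Smooth convex functions and their conjugates *)

Section SmoothConvex.
Context {R : realType} {k : nat}.
Variables (f : 'cV[R]_k -> R).

Lemma conjugate_ge (y x : 'cV[R]_k) :
  ((dotcv y x - f x)%:E <= conjugate (EFin \o f) y)%E.
Proof. by apply: ereal_sup_ubound; exists x => //=; rewrite -EFinB. Qed.

Lemma cvg_dir_grad x v : differentiable (f : 'cV[R]_k -> R^o) x ->
  (h^-1 * (f (x + h *: v) - f x)) @[h --> 0^'] --> dotcv (grad f x) v.
Proof.
move=> df; have := @diff_derivable R _ R^o f x v df.
rewrite /derivable => /cvg_ex[/= l fl].
have := cvg_lim (@Rhausdorff R) fl.
rewrite -[lim _]/('D_v (f : _ -> R^o) x) deriveE// => ld.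
have <- : l = dotcv (grad f x) v.
  rewrite -ld {1}[v]matrix_sum_delta linear_sum/=; apply: eq_bigr => i _.
  by rewrite big_ord1 linearZ/= mxE deriveE// mulrC.
by move: fl; under eq_fun do rewrite [_ + x]addrC.
Qed.

Hypothesis fdiff : forall x, differentiable (f : 'cV[R]_k -> R^o) x.

Lemma convex_gradient_le x y : convex_function [set: 'cV[R]_k] f ->
  f x + dotcv (grad f x) (y - x) <= f y.
Proof.
move=> fcvx; rewrite -lerBrDl.
have sub : (0 : R)^'+ `=>` (0 : R)^'.
  rewrite /dnbhs /at_right => A; rewrite /within/=; apply: filterS => z + z0.
  by apply; rewrite gt_eqF.
have fl := cvg_trans (cvg_app (fun h : R => h^-1 * (f (x + h *: (y - x)) - f x)) sub)
  (@cvg_dir_grad x (y - x) (fdiff x)).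
rewrite -(cvg_lim (@Rhausdorff R) fl); apply: limr_le.
  by apply/cvg_ex; eexists; exact: fl.
near=> h.
have h0 : 0 < h by near: h; exact: nbhs_right_gt.
have h1 : h <= 1 by near: h; exact: nbhs_right_le.
rewrite ler_pdivrMl// lerBlDr.
have := fcvx (Itv01 (ltW h0) h1) y x; rewrite !inE => /(_ I I).
rewrite convRE /= /unstable.onem.
have -> : (conv (Itv01 (ltW h0) h1) (y : convex_lmodType 'cV[R]_k) x : 'cV[R]_k)
    = x + h *: (y - x).
  by rewrite /conv/= /unstable.onem; apply/matrixP => i j; rewrite !mxE; ring.
move/le_trans; apply; rewrite /=; lra.
Unshelve. all: by end_near. Qed.

(** After subtracting the quadratic majorant along the segment, the derivative is nonpositive by
    Cauchy-Schwarz and the Lipschitz bound; the mean value theorem then replaces an integral. *)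
Lemma smooth_descent_le (L : R) x v : 0 <= L ->
  (forall x y, enorm (grad f x - grad f y) <= L * enorm (x - y)) ->
  f (x + v) <= f x + dotcv (grad f x) v + L / 2 * dotcv v v.
Proof.
move=> L0 gL.
pose h (s : R) : R := f (x + s *: v).
have dh (s : R) : is_derive s 1 (h : R -> R^o) (dotcv (grad f (x + s *: v)) v).
  have fl := @cvg_dir_grad (x + s *: v) v (fdiff _).
  have {}fl : (e^-1 *: (((h : R -> R^o) \o shift s) (e *: 1) - h s)) @[e --> 0^']
      --> dotcv (grad f (x + s *: v)) v.
    apply: cvg_trans fl; apply: near_eq_cvg; near=> e.
    rewrite /h/= -[_ *: 1]/(_ * _) mulr1 scalerDl addrCA addrC -addrA//.
  split; first by apply/cvg_ex; eexists; exact: fl.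
  exact: (cvg_lim (@Rhausdorff R) fl).
pose c0 := dotcv (grad f x) v; pose c1 := L / 2 * dotcv v v.
pose q (s : R) : R := h s - (c0 * s + c1 * s ^+ 2).
have dq (s : R) : is_derive s 1 (q : R -> R^o)
    (dotcv (grad f (x + s *: v)) v - (c0 + c1 * (2 * s))).
  exact: (is_derive_quadratic _ _ (dh s)).
have [|c c01 e] := @MVT R q
  (fun s => dotcv (grad f (x + s *: v)) v - (c0 + c1 * (2 * s))) 0 1 ltr01.
  apply: continuous_subspaceT => s.
  apply: (@differentiable_continuous R R^o R^o); apply/derivable1_diffP.
  by have [] := dq s.
move: c01; rewrite in_itv/= => /andP[c_gt0 c_lt1].
move: e; rewrite /q /h scale1r scale0r addr0 expr1n expr0n/=.
rewrite subr0 !mulr1 !mulr0 addr0 subr0 => e.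
have : dotcv (grad f (x + c *: v) - grad f x) v <= L * c * dotcv v v.
  apply: le_trans (dotcv_cs _ _) _.
  apply: le_trans (ler_wpM2r (enorm_ge0 v) (gL _ _)) _.
  rewrite addrAC subrr add0r enormZ gtr0_norm// -enorm_sqr; lra.
rewrite dotcvBl -/c0; move: e; rewrite /c1; lra.
Unshelve. all: by end_near. Qed.

Lemma continuous_grad (L : R) :
  (forall x y, enorm (grad f x - grad f y) <= L * enorm (x - y)) ->
  continuous (grad f).
Proof.
move=> gL; apply: (@continuous_enorm_lipschitz R k _ _ L) => x y.
exact: le_trans (norm_le_enorm _) (gL x y).
Qed.

Lemma conjugate_grad z : convex_function [set: 'cV[R]_k] f ->
  conjugate (EFin \o f) (grad f z) = (dotcv (grad f z) z - f z)%:E.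
Proof.
move=> fcvx; apply/eqP; rewrite eq_le; apply/andP; split.
  apply: ge_ereal_sup => _ [x _ <-]; rewrite /= -EFinB lee_fin.
  have := convex_gradient_le z x fcvx; rewrite dotcvBr; lra.
by apply: ereal_sup_ubound; exists z => //; rewrite /= -EFinB.
Qed.

(* Testing the suprema defining the conjugates at p and q against the points
   x + gamma (p - grad f x) and x + gamma (q - grad f x). *)
Lemma conjugate_strongly_convex (gamma : R) (p q : 'cV[R]_k) (b c a : R) :
  0 < gamma ->
  (forall x y, enorm (grad f x - grad f y) <= gamma^-1 * enorm (x - y)) ->
  conjugate (EFin \o f) p = b%:E -> conjugate (EFin \o f) q = c%:E ->
  0 <= a <= 1 ->
  (conjugate (EFin \o f) ((1 - a) *: p + a *: q) <=
   ((1 - a) * b + a * c - gamma / 2 * (a * (1 - a)) * dotcv (p - q) (p - q))%:E)%E.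
Proof.
move=> g0 gL pb qc /andP[a0 a1]; apply: ge_ereal_sup => _ [x _ <-].
rewrite /= -EFinB lee_fin.
have key r s : conjugate (EFin \o f) r = s%:E ->
    dotcv r x - f x + gamma / 2 * dotcv (r - grad f x) (r - grad f x) <= s.
  move=> rs; set v := r - grad f x.
  have := conjugate_ge r (x + gamma *: v); rewrite rs lee_fin.
  have := smooth_descent_le x (gamma *: v) (ltW (_ : 0 < gamma^-1)) gL.
  rewrite invr_gt0 => /(_ g0).
  have -> : dotcv r (x + gamma *: v) = dotcv r x + gamma * (dotcv v v + dotcv (grad f x) v).
    by rewrite dotcvDr dotcvZr -dotcvDl subrK.
  rewrite !dotcvZr !dotcvZl.
  have -> : gamma^-1 / 2 * (gamma * (gamma * dotcv v v)) = gamma / 2 * dotcv v v.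
    by field; rewrite gt_eqF.
  lra.
have kp := key _ _ pb; have kq := key _ _ qc.
set G := grad f x in kp kq.
have id : (1 - a) * dotcv (p - G) (p - G) + a * dotcv (q - G) (q - G) =
    dotcv ((1 - a) *: (p - G) + a *: (q - G)) ((1 - a) *: (p - G) + a *: (q - G))
    + a * (1 - a) * dotcv (p - q) (p - q).
  rewrite !dotcvE (dotcvC q p) (dotcvC G p) (dotcvC G q); ring.
have := dotcv_ge0 ((1 - a) *: (p - G) + a *: (q - G)); move: id.
set X := dotcv (_ *: _ + _) _; set P := dotcv (p - G) _ in kp *.
set Q := dotcv (q - G) _ in kq *; set D := dotcv (p - q) _ => id X0.
rewrite dotcvDl !dotcvZl.
have g2 : 0 <= gamma / 2 by rewrite divr_ge0// ltW.
have a1' : 0 <= 1 - a by lra.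
have h1 := ler_wpM2l a1' kp; have h2 := ler_wpM2l a0 kq.
have h3 := mulr_ge0 g2 X0.
have : gamma / 2 * ((1 - a) * P + a * Q) = gamma / 2 * (X + a * (1 - a) * D) by rewrite id.
lra.
Qed.

End SmoothConvex.

(** * Averages over the sampled indices *)

Section UniformAverage.
Context {R : realType} {m n : nat}.
Hypothesis m_gt0 : (0 < m)%N.

(** Conditional expectation over the n current indices given the past, as a finite sum: the one-step
    estimate is thereby free of measure theory. *)
Definition uavg (F : {ffun 'I_n -> 'I_m} -> R) : R :=
  \sum_I m%:R^-1 ^+ n * F I.

Let m0 : (m%:R : R) != 0. Proof. by rewrite pnatr_eq0 -lt0n. Qed.

Lemma uavgD F G : uavg (fun I => F I + G I) = uavg F + uavg G.
Proof. by rewrite -big_split; apply: eq_bigr => I _; rewrite mulrDr. Qed.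

Lemma uavgZ a F : uavg (fun I => a * F I) = a * uavg F.
Proof. by rewrite mulr_sumr; apply: eq_bigr => I _; rewrite mulrCA. Qed.

Lemma uavg_sum (J : Type) (r : seq J) (P : pred J) (F : J -> _ -> R) :
  uavg (fun I => \sum_(j <- r | P j) F j I) = \sum_(j <- r | P j) uavg (F j).
Proof. by rewrite exchange_big; apply: eq_bigr => I _; rewrite mulr_sumr. Qed.

Lemma uavg_le F G : (forall I, F I <= G I) -> uavg F <= uavg G.
Proof.
by move=> FG; apply: ler_sum => I _; rewrite ler_wpM2l// exprn_ge0// invr_ge0.
Qed.

(** Independence of the coordinates. The averages of a constant, of one coordinate and of a product
    of two follow by setting the remaining factors to 1. *)
Lemma uavg_prod (F : 'I_n -> 'I_m -> R) :
  uavg (fun I => \prod_s F s (I s)) = \prod_s (m%:R^-1 * \sum_i F s i).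
Proof.
rewrite big_split/= bigA_distr_bigA/= mulr_sumr; apply: eq_bigr => I _.
by rewrite prodr_const card_ord.
Qed.

Lemma uavg_cst a : uavg (fun=> a) = a.
Proof.
have := uavg_prod (fun _ _ => 1); rewrite [RHS]big1; last first.
  by move=> s _; rewrite sumr_const card_ord mulVf.
under [X in uavg X]eq_fun do rewrite big1//.
by move=> u1; rewrite -[RHS]mulr1 -u1 -uavgZ; under [RHS]eq_bigr do rewrite mulr1.
Qed.

Lemma uavg_coord (tau : 'I_n) (f : 'I_m -> R) :
  uavg (fun I => f (I tau)) = m%:R^-1 * \sum_i f i.
Proof.
have := uavg_prod (fun s i => if s == tau then f i else 1).
rewrite (bigD1 tau)//= eqxx [X in _ * X]big1 ?mulr1 => [<-|s /negPf->].
  apply: eq_bigr => I _; rewrite (bigD1 tau)//= eqxx big1 ?mulr1//.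
  by move=> s /negPf->.
by rewrite sumr_const card_ord mulVf.
Qed.

Lemma uavg_coord2 (tau sig : 'I_n) (f g : 'I_m -> R) : tau != sig ->
  uavg (fun I => f (I tau) * g (I sig)) =
  (m%:R^-1 * \sum_i f i) * (m%:R^-1 * \sum_i g i).
Proof.
move=> ts; have st : sig != tau by rewrite eq_sym.
have := uavg_prod (fun s i => if s == tau then f i else
  if s == sig then g i else 1).
rewrite (bigD1 tau)//= eqxx (bigD1 sig)//= (negPf st) eqxx.
rewrite [X in _ * (_ * X)]big1 ?mulr1 => [<-|s /andP[/negPf-> /negPf->]].
  apply: eq_bigr => I _; rewrite (bigD1 tau)//= eqxx (bigD1 sig)//= (negPf st) eqxx.
  by rewrite big1 ?mulr1// => s /andP[/negPf-> /negPf->].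
by rewrite sumr_const card_ord mulVf.
Qed.

Definition vmean d (x : 'I_m -> 'cV[R]_d) : 'cV[R]_d := m%:R^-1 *: \sum_i x i.

Lemma uavg_dotcv d (tau sig : 'I_n) (x y : 'I_m -> 'cV[R]_d) : tau != sig ->
  uavg (fun I => dotcv (x (I tau)) (y (I sig))) = dotcv (vmean x) (vmean y).
Proof.
move=> ts; rewrite /dotcv uavg_sum; apply: eq_bigr => l _.
rewrite (uavg_coord2 (fun i => x i l 0) (fun i => y i l 0) ts).
by rewrite !mxE !summxE.
Qed.

Lemma uavg_dotcv_mean d (x : 'I_n -> 'I_m -> 'cV[R]_d) y :
  uavg (fun I => dotcv y (\sum_s x s (I s))) = dotcv y (\sum_s vmean (x s)).
Proof.
rewrite dotcv_sumr; under [X in uavg X]eq_fun do rewrite dotcv_sumr.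
rewrite uavg_sum; apply: eq_bigr => s _.
by rewrite (uavg_coord s (fun i => dotcv y (x s i))) dotcvZr dotcv_sumr.
Qed.

(* Variance of a sum of independent vectors, with the variances bounded by the
   second moments. *)
Lemma uavg_second_moment_le d (x : 'I_n -> 'I_m -> 'cV[R]_d) :
  uavg (fun I => dotcv (\sum_s x s (I s)) (\sum_s x s (I s))) <=
  \sum_s m%:R^-1 * \sum_i dotcv (x s i) (x s i) +
  dotcv (\sum_s vmean (x s)) (\sum_s vmean (x s)).
Proof.
under [X in uavg X]eq_fun do rewrite dotcv_suml.
rewrite uavg_sum dotcv_suml -big_split/=; apply: ler_sum => s _.
under [X in uavg X]eq_fun do rewrite dotcv_sumr.
rewrite uavg_sum dotcv_sumr (bigD1 s)//= [X in _ <= _ + X](bigD1 s)//=.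
rewrite (uavg_coord s (fun i => dotcv (x s i) (x s i))) lerD2l.
rewrite -[leLHS]add0r lerD ?dotcv_ge0//; apply: ler_sum => r rs.
by rewrite (uavg_dotcv _ (x r))// eq_sym.
Qed.

(** The square is expanded exactly and Young's inequality touches only the cross term with the mean.
    The large factor 1/a thus multiplies the squared mean and spares the second moment. *)
Lemma uavg_shift_sq d (tau : 'I_n) (e : 'cV[R]_d) (q : 'I_m -> 'cV[R]_d) a :
  0 < a ->
  uavg (fun I => dotcv (e + q (I tau)) (e + q (I tau))) <=
  (1 + a) * dotcv e e + a^-1 * dotcv (vmean q) (vmean q) +
  m%:R^-1 * \sum_i dotcv (q i) (q i).
Proof.
move=> a0; rewrite (uavg_coord tau (fun i => dotcv (e + q i) (e + q i))).
have -> : m%:R^-1 * \sum_i dotcv (e + q i) (e + q i) =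
    dotcv e e + 2 * dotcv e (vmean q) + m%:R^-1 * \sum_i dotcv (q i) (q i).
  under eq_bigr do rewrite !dotcvE (dotcvC (q _) e).
  rewrite /vmean dotcvZr dotcv_sumr !big_split/= sumr_const card_ord -mulr_natl.
  by field.
have := dotcv_young e (vmean q) a0; rewrite invfM.
by move: (dotcv e e) (dotcv _ (vmean q)) (dotcv (vmean q) _) (\sum_i _) => A B C D; lra.
Qed.

End UniformAverage.

Section StepAverages.
Context {R : realType} {m n d t : nat}.
Variables (A : 'I_m -> 'I_n -> 'M[R]_(d, t)) (h : 'I_m -> 'I_n -> 'cV[R]_t).
Variables (Rm Rb Rt : R).
Hypotheses (m_gt0 : (0 < m)%N) (n_gt0 : (0 < n)%N).

Let S := \sum_(tau < n) \sum_(i < m) dotcv (h i tau) (h i tau).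

Hypothesis Rm_le : forall i tau,
  dotcv (A i tau *m h i tau) (A i tau *m h i tau) <=
  Rm ^+ 2 * dotcv (h i tau) (h i tau).
Hypothesis Rb_le : forall tau,
  dotcv (\sum_i A i tau *m h i tau) (\sum_i A i tau *m h i tau) <=
  m%:R * Rb ^+ 2 * \sum_i dotcv (h i tau) (h i tau).
Hypothesis Rt_le :
  dotcv (\sum_tau \sum_i A i tau *m h i tau) (\sum_tau \sum_i A i tau *m h i tau)
  <= (m * n)%:R * Rt ^+ 2 * S.

Let m0 : (m%:R : R) != 0. Proof. by rewrite pnatr_eq0 -lt0n. Qed.
Let n0 : (n%:R : R) != 0. Proof. by rewrite pnatr_eq0 -lt0n. Qed.

Variable b : R.

Let x tau i := (b / n%:R) *: (A i tau *m h i tau).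

Let sum_mean : \sum_tau vmean (x tau) =
  (b / (m * n)%:R) *: \sum_tau \sum_i A i tau *m h i tau.
Proof.
rewrite /vmean /x scaler_sumr; apply: eq_bigr => tau _.
by rewrite -scaler_sumr scalerA natrM; congr (_ *: _); field; rewrite m0 n0.
Qed.

Lemma step_mean_sq_le : dotcv (\sum_tau vmean (x tau)) (\sum_tau vmean (x tau))
  <= b ^+ 2 * Rt ^+ 2 / (m * n)%:R * S.
Proof.
rewrite sum_mean dotcvZl dotcvZr mulrA -expr2.
apply: le_trans (ler_wpM2l (sqr_ge0 _) Rt_le) _.
by rewrite le_eqVlt; apply/orP; left; apply/eqP; rewrite natrM; field; rewrite m0 n0.
Qed.

(** Origin of v = R_m^2 + n R^2: the first part bounds the diagonal second moments, the second the
    squared mean. *)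
Lemma step_second_moment_le :
  uavg (fun I : {ffun 'I_n -> 'I_m} =>
    dotcv (\sum_s x s (I s)) (\sum_s x s (I s))) <=
  b ^+ 2 * m%:R * (Rm ^+ 2 + n%:R * Rt ^+ 2) / (m * n)%:R ^+ 2 * S.
Proof.
apply: le_trans (uavg_second_moment_le m_gt0 x) _.
apply: le_trans (lerD (lexx _) step_mean_sq_le) _.
have : \sum_s m%:R^-1 * \sum_i dotcv (x s i) (x s i) <=
    m%:R^-1 * (b / n%:R) ^+ 2 * Rm ^+ 2 * S.
  have -> : m%:R^-1 * (b / n%:R) ^+ 2 * Rm ^+ 2 * S =
      m%:R^-1 * ((b / n%:R) ^+ 2 * (Rm ^+ 2 * S)) by ring.
  rewrite -mulr_sumr ler_wpM2l ?invr_ge0//.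
  rewrite !mulr_sumr; apply: ler_sum => s _; rewrite !mulr_sumr.
  apply: ler_sum => i _; rewrite dotcvZl dotcvZr mulrA -expr2.
  by rewrite ler_wpM2l ?sqr_ge0.
move=> h1; apply: le_trans (lerD h1 (lexx _)) _.
by rewrite le_eqVlt; apply/orP; left; apply/eqP; rewrite natrM; field; rewrite m0 n0.
Qed.

(** Origin of a1: the squared mean, bounded by Rbar^2, carries the factor 2/delta, while the second
    moment, bounded by R_m^2, carries 1. *)
Lemma step_error_le (e : 'I_n -> 'cV[R]_d) (delta : R) : 0 < delta < 1 ->
  (1 - delta) * uavg (fun I : {ffun 'I_n -> 'I_m} => \sum_tau
    dotcv (e tau + b *: (A (I tau) tau *m h (I tau) tau))
          (e tau + b *: (A (I tau) tau *m h (I tau) tau))) <=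
  (1 - delta / 2) * (\sum_tau dotcv (e tau) (e tau)) +
  b ^+ 2 * ((1 - delta) * (2 * Rb ^+ 2 + delta * Rm ^+ 2)) / (delta * m%:R) * S.
Proof.
move=> /andP[d0 d1]; rewrite uavg_sum !mulr_sumr -big_split/=.
apply: ler_sum => tau _; set St := \sum_i dotcv (h i tau) (h i tau).
(* The weight delta/2 is affordable because (1 - delta)(1 + delta/2) <= 1 - delta/2. *)
have a0 : 0 < delta / 2 by rewrite divr_gt0.
pose q i := b *: (A i tau *m h i tau).
have St0 : 0 <= St by apply: sumr_ge0 => i _; exact: dotcv_ge0.
have h1 := uavg_shift_sq m_gt0 tau (e tau) q a0.
have qm : dotcv (vmean q) (vmean q) <= b ^+ 2 / m%:R * Rb ^+ 2 * St.
  rewrite /vmean /q -scaler_sumr scalerA dotcvZl dotcvZr mulrA -expr2.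
  apply: le_trans (ler_wpM2l (sqr_ge0 _) (Rb_le tau)) _.
  by rewrite le_eqVlt; apply/orP; left; apply/eqP; rewrite /St; field.
have qs : m%:R^-1 * \sum_i dotcv (q i) (q i) <= b ^+ 2 / m%:R * Rm ^+ 2 * St.
  have -> : b ^+ 2 / m%:R * Rm ^+ 2 * St =
      m%:R^-1 * (b ^+ 2 * (Rm ^+ 2 * St)) by ring.
  rewrite ler_wpM2l ?invr_ge0// !mulr_sumr.
  apply: ler_sum => i _; rewrite dotcvZl dotcvZr mulrA -expr2.
  by rewrite ler_wpM2l ?sqr_ge0.
have da : (delta / 2)^-1 = 2 / delta by rewrite invf_div.
have d10 : 0 <= 1 - delta by lra.
apply: le_trans (ler_wpM2l d10 h1) _; rewrite da.
have di0 : 0 <= 2 / delta by rewrite divr_ge0// ltW.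
have E0 := dotcv_ge0 (e tau).
apply: le_trans (ler_wpM2l d10 (lerD (lerD (lexx _) (ler_wpM2l di0 qm)) qs)) _.
have -> : b ^+ 2 * ((1 - delta) * (2 * Rb ^+ 2 + delta * Rm ^+ 2)) /
    (delta * m%:R) * St = (1 - delta) * (2 / delta * (b ^+ 2 / m%:R * Rb ^+ 2 * St) +
    b ^+ 2 / m%:R * Rm ^+ 2 * St).
  by field; rewrite m0 gt_eqF.
have : (1 - delta) * (1 + delta / 2) * dotcv (e tau) (e tau) <=
    (1 - delta / 2) * dotcv (e tau) (e tau).
  by rewrite ler_wpM2r//; nra.
lra.
Qed.

End StepAverages.

(** * Norm bounds for the data matrices *)

Section ProblemBounds.
Context {R : realType} {m n d t : nat}.
Variable pb : problem R m n d t.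
Hypotheses (m_gt0 : (0 < m)%N) (n_gt0 : (0 < n)%N) (d_gt0 : (0 < d)%N).

Lemma Rm_ge0 : 0 <= Rm pb.
Proof. by rewrite /Rm; elim/big_rec: _ => // i x _ x0; rewrite le_max x0 orbT. Qed.

Lemma dotcv_matA_le i tau h :
  dotcv (matA pb i tau *m h) (matA pb i tau *m h) <= Rm pb ^+ 2 * dotcv h h.
Proof.
apply: le_trans (dotcv_mulmx_le _ _) _; rewrite ler_wpM2r ?dotcv_ge0//.
rewrite ler_pXn2r ?nnegrE ?spectral_norm_ge0 ?Rm_ge0//.
apply: (@le_trans _ _ (\big[Num.max/0]_(tau < n) spectral_norm (matA pb i tau))).
  exact: (le_bigmax _ (fun tau => spectral_norm (matA pb i tau))).
exact: (le_bigmax _ (fun i => \big[Num.max/0]_(tau < n) spectral_norm (matA pb i tau))).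
Qed.

Lemma dotcv_sum_matA_le tau (h : 'I_m -> 'cV[R]_t) :
  dotcv (\sum_i matA pb i tau *m h i) (\sum_i matA pb i tau *m h i) <=
  m%:R * Rbar pb ^+ 2 * \sum_i dotcv (h i) (h i).
Proof.
have Rb0 : 0 <= Rbar2 pb.
  by rewrite /Rbar2; elim/big_rec: _ => // i x _ x0; rewrite le_max x0 orbT.
apply: le_trans (dotcv_gram_le _ _ d_gt0) _; rewrite ler_wpM2r//.
  by apply: sumr_ge0 => i _; exact: dotcv_ge0.
rewrite sqr_sqrtr// -ler_pdivrMl ?ltr0n//.
exact: (le_bigmax _ (fun tau => m%:R^-1 *
  lambda_max (\sum_(i < m) matA pb i tau *m (matA pb i tau)^T))).
Qed.

Let pairE (V : nmodType) (F : 'I_m -> 'I_n -> V) :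
  \sum_(tau < n) \sum_(i < m) F i tau = \sum_(p : 'I_n * 'I_m) F p.2 p.1.
Proof. by rewrite pair_bigA. Qed.

Lemma Rtot2_ge0 : 0 <= Rtot2 pb.
Proof.
rewrite /Rtot2 pairE mulr_ge0 ?invr_ge0//.
exact: (lambda_max_gram_ge0 (fun p : 'I_n * 'I_m => matA pb p.2 p.1)).
Qed.

Lemma dotcv_sum_sum_matA_le (h : 'I_m -> 'I_n -> 'cV[R]_t) :
  dotcv (\sum_tau \sum_i matA pb i tau *m h i tau)
        (\sum_tau \sum_i matA pb i tau *m h i tau) <=
  (m * n)%:R * Rtot pb ^+ 2 * \sum_tau \sum_i dotcv (h i tau) (h i tau).
Proof.
rewrite !pairE sqr_sqrtr ?Rtot2_ge0// /Rtot2 pairE mulrA divff ?mul1r.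
  exact: (dotcv_gram_le (fun p : 'I_n * 'I_m => matA pb p.2 p.1)
    (fun p => h p.2 p.1)).
by rewrite pnatr_eq0 muln_eq0 negb_or -!lt0n m_gt0.
Qed.

(** If [Rm pb] vanished, all blocks would be 0 and so would [Rtot pb]. Its positivity makes a1
    positive, and with it the denominator of [rho]. *)
Lemma Rm_gt0 : 0 < Rtot pb -> 0 < Rm pb.
Proof.
move=> Rt0; rewrite lt0r Rm_ge0 andbT; apply: contraTneq Rt0 => Rm0.
have A0 i tau : matA pb i tau = 0.
  apply/matrixP => k l; rewrite [RHS]mxE.
  have := dotcv_matA_le i tau (delta_mx l 0).
  rewrite Rm0 expr0n mul0r => h0; have : matA pb i tau *m delta_mx l (0 : 'I_1) == 0.
    by rewrite -dotcv_eq0 eq_le h0 dotcv_ge0.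
  by rewrite -colE => /eqP/matrixP/(_ k 0); rewrite !mxE.
rewrite -leNgt /Rtot; suff -> : Rtot2 pb = 0 by rewrite sqrtr0.
rewrite /Rtot2 big1 => [|tau _]; last first.
  by rewrite big1// => i _; rewrite A0 mul0mx.
apply/eqP; rewrite mulf_eq0; apply/orP; right; apply/eqP.
apply/eqP; rewrite eq_le; apply/andP; split; last first.
  have := lambda_max_gram_ge0 (fun _ : 'I_0 => 0 : 'M[R]_(d, t)) d_gt0.
  by rewrite big_ord0.
(* As d > 0, the zero matrix has an eigenvector, so the supremum is over a nonempty set. *)
rewrite /lambda_max; apply: sup_le_ub.
  exists 0; apply/eigenvalueP; exists (delta_mx 0 (Ordinal d_gt0)).
    by rewrite mulmx0 scale0r.
  by apply/eqP => /matrixP/(_ 0 (Ordinal d_gt0)) /eqP; rewrite !mxE !eqxx oner_eq0.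
move=> a /eigenvalueP[v]; rewrite mulmx0 => /esym/eqP.
by rewrite scaler_eq0 => /orP[/eqP->//|/eqP->]; rewrite eqxx.
Qed.

End ProblemBounds.

(* [b + sqrt (b ^+ 2 + 4 a c)] in the denominator: [2 c / _] is the positive
   root of [a x ^+ 2 + b x = c]. *)
Lemma quadratic_root_le (R : realType) (a b c x : R) : 0 < a -> 0 <= b -> 0 < c -> 0 < x ->
  x <= 2 * c / (b + Num.sqrt (b ^+ 2 + 4 * a * c)) -> a * x ^+ 2 + b * x <= c.
Proof.
move=> a0 b0 c0 x0; set r := Num.sqrt _.
have D0 : 0 < b ^+ 2 + 4 * a * c.
  by rewrite ltr_wpDl ?sqr_ge0// mulr_gt0// mulr_gt0.
have r0 : 0 < r by rewrite sqrtr_gt0.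
have rr : r ^+ 2 = b ^+ 2 + 4 * a * c by rewrite sqr_sqrtr// ltW.
rewrite ler_pdivlMr; last by lra.
move=> h; have h2 : 2 * a * x + b <= r by
  (rewrite leNgt; apply/negP => h3; nra).
have : (2 * a * x + b) ^+ 2 <= r ^+ 2.
  by rewrite ler_pXn2r ?nnegrE//; nra.
rewrite rr; nra.
Qed.

Ltac positivity := repeat first
  [ done | assumption | by apply: ltW; assumption | apply: mulr_gt0 | apply: addr_gt0
  | apply: exprn_gt0 | rewrite invr_gt0 | apply: mulr_ge0 | apply: addr_ge0
  | apply: exprn_ge0 | rewrite invr_ge0 | apply: sqrtr_ge0 | apply: ltW ].

Lemma inv_min_le (R : realType) (x y c : R) :
  x^-1 <= c -> y^-1 <= c -> (Num.min x y)^-1 <= c.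
Proof. by rewrite /Num.min; case: ifP. Qed.

(** * Step size *)

Section StepSizeConditions.
Context {R : realType} {m n d t : nat}.
Variable pb : problem R m n d t.
Variables gamma delta : R.
Hypotheses (m_gt0 : (0 < m)%N) (n_gt0 : (0 < n)%N) (d_gt0 : (0 < d)%N).
Hypotheses (gamma_gt0 : 0 < gamma) (delta_gt0 : 0 < delta) (delta_lt1 : delta < 1).
Hypotheses (lam_gt0 : 0 < lam pb) (lam_le : lam pb <= Rtot pb ^+ 2 / gamma).

Let theta := theta_choice pb gamma delta.
Let l := lam pb.
Let a := a1 pb delta.
Let N : R := (m * n)%:R.
Let v := Rm pb ^+ 2 + n%:R * Rtot pb ^+ 2.

Let mR : 0 < m%:R :> R. Proof. by rewrite ltr0n. Qed.
Let nR : 0 < n%:R :> R. Proof. by rewrite ltr0n. Qed.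
Let NR : 0 < N. Proof. by rewrite ltr0n muln_gt0 m_gt0. Qed.

Lemma Rtot_gt0 : 0 < Rtot pb.
Proof.
rewrite lt0r sqrtr_ge0 andbT; apply/eqP => Rt0.
by move: lam_gt0; rewrite ltNge (le_trans lam_le)// Rt0 expr0n mul0r.
Qed.

Lemma a1_gt0 : 0 < a.
Proof.
have Rm0 : 0 < Rm pb := Rm_gt0 d_gt0 Rtot_gt0.
rewrite mulr_gt0 ?subr_gt0// ltr_wpDl//; first by positivity.
by positivity.
Qed.

Let s0 : 0 < Num.sqrt a. Proof. by rewrite sqrtr_gt0 a1_gt0. Qed.

Lemma rho_gt0 : 0 < rho pb delta.
Proof. by rewrite divr_gt0 ?mulr_gt0// ?Rtot_gt0. Qed.

Let den1 : 0 < delta * l * gamma * m%:R +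
       Num.sqrt (delta ^+ 2 * l ^+ 2 * gamma ^+ 2 * m%:R ^+ 2
                 + 48 * l * gamma * a).
Proof. by rewrite ltr_wpDr ?sqrtr_ge0// !mulr_gt0. Qed.

Let v0 : 0 < v.
Proof. by rewrite ltr_wpDl ?sqr_ge0// mulr_gt0// exprn_gt0// Rtot_gt0. Qed.

Let den2 : 0 < 3 * v + N * l * gamma.
Proof. by rewrite addr_gt0 ?mulr_gt0. Qed.

Let den3 : 0 < delta * l * gamma * m%:R + 12 * Rtot pb * Num.sqrt a.
Proof. by rewrite addr_gt0// !mulr_gt0// Rtot_gt0. Qed.

Lemma theta_gt0 : 0 < theta.
Proof.
rewrite /theta /theta_choice !lt_min; apply/and3P; split.
- by rewrite divr_gt0 ?mulr_gt0.
- by rewrite divr_gt0 ?mulr_gt0 ?invr_gt0.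
- by rewrite divr_gt0 ?mulr_gt0.
Qed.

(** The first argument of the minimum is the positive root of (12 a / delta) x^2 + delta l gamma m x
    = delta l gamma; its 48 is 4 times 12. *)
Let t1 : 12 * a / (delta ^+ 2 * l) * theta ^+ 2 <= gamma * (1 - theta * m%:R).
Proof.
have th : theta <= 2 * (delta * l * gamma) / (delta * l * gamma * m%:R +
    Num.sqrt ((delta * l * gamma * m%:R) ^+ 2 + 4 * (12 * a / delta) * (delta * l * gamma))).
  have := lexx theta; rewrite {2}/theta /theta_choice !le_min => /and3P[+ _ _].
  move/le_trans; apply; rewrite le_eqVlt; apply/orP; left; apply/eqP.
  congr (_ / (_ + Num.sqrt _)); rewrite -/l -/a; first by ring.
  by field; rewrite gt_eqF.
have := quadratic_root_le _ _ _ theta_gt0 th.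
have a0 := a1_gt0; have c1 : 0 < 12 * a / delta by positivity.
have c2 : 0 <= delta * l * gamma * m%:R by positivity.
have c3 : 0 < delta * l * gamma by positivity.
move=> /(_ c1 c2 c3) h; have dl : 0 < delta * l by rewrite mulr_gt0.
rewrite -(ler_pM2l dl) [leLHS](_ : _ = 12 * a / delta * theta ^+ 2); first by lra.
by field; rewrite !gt_eqF.
Qed.

Let t2 : 3 * theta * m%:R * v / (l * N) <= gamma * (1 - theta * m%:R).
Proof.
have := lexx theta; rewrite {2}/theta /theta_choice !le_min => /and3P[_ + _].
rewrite -/v -/l -/N ler_pdivlMr// => h.
rewrite ler_pdivrMr ?mulr_gt0//.
have : m%:R * (theta * (3 * v + N * l * gamma)) <= m%:R * (N * l * gamma / m%:R).
  by rewrite ler_pM2l.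
rewrite [leRHS](_ : _ = N * l * gamma); first by lra.
by field; rewrite gt_eqF.
Qed.

Let t3 : 12 * theta * Rtot pb * Num.sqrt a / (delta * l) <= gamma * (1 - theta * m%:R).
Proof.
have := lexx theta; rewrite {2}/theta /theta_choice !le_min => /and3P[_ _ +].
rewrite -/l -/a ler_pdivlMr// => h.
by rewrite ler_pdivrMr ?mulr_gt0//; lra.
Qed.

(** By [t2], [t3] and [t1], in this order, each term on the left is at most a third of the
    right-hand side; hence the constants 3 and 12 = 3 * 4 in theta. *)
Lemma theta_condition :
  theta * m%:R * v / (l * N) + 4 * theta * Rtot pb * Num.sqrt a / (delta * l) +
  4 * theta ^+ 2 * a / (delta ^+ 2 * l) <= gamma * (1 - theta * m%:R).
Proof. move: t1 t2 t3; lra. Qed.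

(** theta m is the weight with which a drawn dual block moves towards minus the gradient; the
    convexity argument for the conjugates needs it in [0, 1]. *)
Lemma theta_m_le1 : theta * m%:R <= 1.
Proof.
have : 0 <= gamma * (1 - theta * m%:R).
  by apply: le_trans t2; rewrite divr_ge0 ?mulr_ge0 ?ltW ?theta_gt0.
by rewrite pmulr_rge0// subr_ge0.
Qed.

(* Young's inequality splits the inner product with weight rho, chosen so that
   the error terms it creates balance. *)
Lemma lyapunov_combination (PD S E eb D2 Db2 X P' E' : R) :
  0 <= PD -> 0 <= S -> 0 <= E -> eb <= E / n%:R ->
  D2 <= theta ^+ 2 * m%:R * v / (l ^+ 2 * N ^+ 2) * S ->
  Db2 <= theta ^+ 2 * Rtot pb ^+ 2 / (l ^+ 2 * N) * S ->
  l * X <= rho pb delta / 2 * eb + l ^+ 2 / (2 * rho pb delta) * Db2 ->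
  P' <= (1 - theta) * PD + l * theta / 2 * eb + l * X + l / 2 * D2
        - gamma / 2 * theta * (1 - theta * m%:R) / N * S ->
  (1 - delta) * E' <= (1 - delta / 2) * E +
     theta ^+ 2 * a / (delta * l ^+ 2 * m%:R) * S ->
  P' + 2 * (rho pb delta + theta * l) / (delta * n%:R) * ((1 - delta) * E') <=
  (1 - Num.min theta (delta / 4)) *
    (PD + 2 * (rho pb delta + theta * l) / (delta * n%:R) * E).
Proof.
set r := rho pb delta; have r0 : 0 < r := rho_gt0.
have l0 : 0 < l by []; have th0 := theta_gt0.
move=> PD0 S0 E0 hb hD hDb hX hP hE.
pose K := 2 * (r + theta * l) / (delta * n%:R).
have K0 : 0 < K by rewrite /K; positivity.
rewrite -/K.
have hE2 := ler_wpM2l (ltW K0) hE.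
have hD2 : l / 2 * D2 <= l / 2 * (theta ^+ 2 * m%:R * v / (l ^+ 2 * N ^+ 2) * S).
  by rewrite ler_wpM2l//; positivity.
have hDb2 : l ^+ 2 / (2 * r) * Db2 <=
    l ^+ 2 / (2 * r) * (theta ^+ 2 * Rtot pb ^+ 2 / (l ^+ 2 * N) * S).
  by rewrite ler_wpM2l//; positivity.
(* The slack delta/2 in [hE] is shared: by the choice of K one half pays for the terms in [eb], and
   the other half yields the rate delta/4. *)
have heb : (r + theta * l) / 2 * eb <= delta / 4 * (K * E).
  apply: (@le_trans _ _ ((r + theta * l) / 2 * (E / n%:R))).
    by rewrite ler_wpM2l//; positivity.
  rewrite /K le_eqVlt; apply/orP; left; apply/eqP; field.
  by rewrite !gt_eqF.
(* The left side is theta / (2 N) * S times that of [theta_condition]. The value of [rho] makes the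
   Young term and the [rho] part of the K term equal, each contributing 2 theta R sqrt(a) / (delta
   l). *)
have hS : l / 2 * (theta ^+ 2 * m%:R * v / (l ^+ 2 * N ^+ 2) * S) +
    l ^+ 2 / (2 * r) * (theta ^+ 2 * Rtot pb ^+ 2 / (l ^+ 2 * N) * S) +
    K * (theta ^+ 2 * a / (delta * l ^+ 2 * m%:R) * S) <=
    gamma / 2 * theta * (1 - theta * m%:R) / N * S.
  have c0 : 0 <= theta / (2 * N) * S.
    by positivity.
  have := ler_wpM2l c0 theta_condition.
  set q := Num.sqrt a; have q0 : 0 < q := s0.
  have qa : a = q ^+ 2 by rewrite sqr_sqrtr// ltW// a1_gt0.
  have rE : r = delta * l * Rtot pb / (2 * q) by [].
  have NE : N = m%:R * n%:R by rewrite /N natrM.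
  have Rt0 := Rtot_gt0.
  rewrite [leRHS](_ : _ = gamma / 2 * theta * (1 - theta * m%:R) / N * S); last first.
    by rewrite NE; field; rewrite !gt_eqF.
  move/(le_trans _); apply; rewrite le_eqVlt; apply/orP; left; apply/eqP.
  rewrite /K rE qa NE; field.
  by rewrite !gt_eqF.
have hmin1 : (1 - theta) * PD <= (1 - Num.min theta (delta / 4)) * PD.
  by rewrite ler_wpM2r// lerD2l lerN2 ge_min lexx.
have hmin2 : (1 - delta / 4) * (K * E) <= (1 - Num.min theta (delta / 4)) * (K * E).
  apply: ler_wpM2r; first by positivity.
  by rewrite lerD2l lerN2 ge_min lexx orbT.
lra.
Qed.

Lemma contraction_factor_bounds :
  0 < Num.min theta (delta / 4) /\ Num.min theta (delta / 4) < 1.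
Proof.
rewrite lt_min theta_gt0 divr_gt0//=; split => //.
rewrite gt_min; apply/orP; right; move: delta_lt1; lra.
Qed.

(** The largest coefficient is 24 = 12 * 2: 12 from the third bound on theta and 2 from the factor
    of Rbar in [qle]. *)
Lemma inv_contraction_factor_le :
  (Num.min theta (delta / 4))^-1 <= 24 * complexity pb gamma delta.
Proof.
have l0 : 0 < l by []; have Rt0 := Rtot_gt0; have a0 := a1_gt0.
set q := Num.sqrt a; have q0 : 0 < q := s0.
have qa : a = q ^+ 2 by rewrite sqr_sqrtr// ltW.
have Rm0 := Rm_ge0 pb; have Rb0 : 0 <= Rbar pb := sqrtr_ge0 _.
set e := Num.sqrt (1 - delta); have e0 : 0 <= e := sqrtr_ge0 _.
set f := Num.sqrt delta; have f0 : 0 < f by rewrite sqrtr_gt0.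
have ff : delta = f ^+ 2 by rewrite sqr_sqrtr// ltW.
have qle : q <= e * (2 * Rbar pb + f * Rm pb).
  rewrite -(@ler_pXn2r _ 2) ?nnegrE; try by positivity.
  have d1 : 0 <= 1 - delta by rewrite subr_ge0 ltW.
  rewrite -qa exprMn sqr_sqrtr// /a /a1; apply: ler_wpM2l => //.
  rewrite ff; have := mulr_ge0 Rb0 (mulr_ge0 (ltW f0) Rm0).
  have := sqr_ge0 (Rbar pb); nra.
pose T1 := Rm pb ^+ 2 / (n%:R * (l * gamma)); pose T2 := Rtot pb ^+ 2 / (l * gamma).
pose T3 := e * Rtot pb * Rbar pb / (delta * (l * gamma)).
pose T4 := e * Rtot pb * Rm pb / (l * gamma * f).
have T10 : 0 <= T1 by rewrite /T1; positivity.
have T20 : 0 <= T2 by rewrite /T2; positivity.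
have T30 : 0 <= T3 by rewrite /T3; positivity.
have T40 : 0 <= T4 by rewrite /T4; positivity.
have cE : complexity pb gamma delta = delta^-1 + m%:R + T1 + T2 + T3 + T4 by [].
have di0 : 0 < delta^-1 by rewrite invr_gt0.
have Rq : Rtot pb * q / (delta * l * gamma) <= 2 * T3 + T4.
  apply: (@le_trans _ _ (Rtot pb * (e * (2 * Rbar pb + f * Rm pb)) / (delta * l * gamma))).
    rewrite ler_wpM2r//; first by positivity.
    by rewrite ler_wpM2l// ltW.
  rewrite /T3 /T4 ff le_eqVlt; apply/orP; left; apply/eqP; field.
  by rewrite !gt_eqF.
(* The assumption lambda <= R^2/gamma serves to replace sqrt(lambda gamma a) by R sqrt(a) in the
   first bound on theta. *)
have lgR : l * gamma <= Rtot pb ^+ 2 by rewrite -ler_pdivlMr.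
have Rq0 : 0 <= Rtot pb * q / (delta * l * gamma) by positivity.
apply: inv_min_le; last first.
  by rewrite invf_div cE; move: T10 T20 T30 T40 di0 mR; lra.
rewrite /theta /theta_choice -/l -/a -/N -/v -/q.
apply: inv_min_le; last apply: inv_min_le; rewrite invf_div.
- set b := delta * l * gamma * m%:R; have b0 : 0 < b by rewrite /b; positivity.
  (* The factor 7 is chosen because 48 <= 7^2. *)
  have sle : Num.sqrt (delta ^+ 2 * l ^+ 2 * gamma ^+ 2 * m%:R ^+ 2 + 48 * l * gamma * a)
      <= b + 7 * Rtot pb * q.
    rewrite -(@ler_pXn2r _ 2) ?nnegrE; try by positivity.
    rewrite sqr_sqrtr; last by positivity.
    have Rb0' : 0 <= b * (Rtot pb * q) by positivity.
    have q20 : 0 <= q ^+ 2 by positivity.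
    have := ler_wpM2r q20 lgR; rewrite qa /b.
    have : 0 <= (Rtot pb * q) ^+ 2 by positivity.
    by move: Rb0'; rewrite /b; lra.
  apply: (@le_trans _ _ ((2 * b + 7 * Rtot pb * q) / (2 * delta * l * gamma))).
    by rewrite ler_wpM2r//; [positivity|lra].
  have -> : (2 * b + 7 * Rtot pb * q) / (2 * delta * l * gamma) =
      m%:R + 7 / 2 * (Rtot pb * q / (delta * l * gamma)).
    by rewrite /b; field; rewrite !gt_eqF.
  by rewrite cE; move: T10 T20 T30 T40 di0 mR Rq; lra.
- have -> : (3 * v + N * l * gamma) / (N * l * gamma / m%:R) =
      m%:R + 3 * T1 + 3 * T2.
    by rewrite /T1 /T2 /v /N natrM; field; rewrite !gt_eqF.
  by rewrite cE; move: T10 T20 T30 T40 di0 mR; lra.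
- have -> : (delta * l * gamma * m%:R + 12 * Rtot pb * q) / (delta * l * gamma) =
      m%:R + 12 * (Rtot pb * q / (delta * l * gamma)).
    by field; rewrite !gt_eqF.
  by rewrite cE; move: T10 T20 T30 T40 di0 mR Rq; lra.
Qed.

End StepSizeConditions.

(** * Duality gap and one step of the algorithm *)

Section Gap.
Context {R : realType} {m n d t : nat}.
Variable pb : problem R m n d t.
Hypotheses (m_gt0 : (0 < m)%N) (n_gt0 : (0 < n)%N).
Hypotheses (reg_pcc : proper_closed_convex (reg pb)) (reg_sc : strongly_convex1 (reg pb)).
Hypothesis lam_gt0 : 0 < lam pb.

Let N : R := (m * n)%:R.
Let N0 : 0 < N. Proof. by rewrite ltr0n muln_gt0 m_gt0. Qed.
Let l := lam pb.
Let gs u := fine (conjugate (reg pb) u).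

Definition phi_conj (alpha : 'I_m -> 'I_n -> 'cV[R]_t) i tau :=
  conjugate (EFin \o phi pb i tau) (- alpha i tau).

Definition phi_sum (x : 'cV[R]_d) : R :=
  \sum_(tau < n) \sum_(i < m) phi pb i tau ((matA pb i tau)^T *m x).

Lemma reg_neqNy x : reg pb x != -oo%E. Proof. by have [[+ _] _ _] := reg_pcc; exact. Qed.

Lemma phi_conj_neqNy alpha i tau : phi_conj alpha i tau != -oo%E.
Proof.
have := conjugate_ge (phi pb i tau) (- alpha i tau) 0.
by rewrite -/(phi_conj alpha i tau); case: (phi_conj _ _ _).
Qed.

Lemma gapE x alpha : (primal pb x - dual pb alpha =
  (N^-1 * phi_sum x + l * gs (dual_point pb alpha))%:E + l%:E * reg pb x +
  N^-1%:E * \sum_(tau < n) \sum_(i < m) phi_conj alpha i tau)%E.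
Proof.
rewrite /primal /dual (conjugate_fin reg_pcc reg_sc) -EFinM.
have oppE (a : R) (b : \bar R) : (- (- a%:E - b) = a%:E + b)%E.
  by case: b => [r||]//=; rewrite -?EFinN -?EFinB -?EFinN -?EFinD; congr EFin; ring.
rewrite oppE -/(phi_sum x) -/N.
by rewrite EFinD !addeA; congr (_ + _)%E; rewrite addeAC.
Qed.

Lemma sum_phi_conj_neqNy alpha :
  (\sum_(tau < n) \sum_(i < m) phi_conj alpha i tau)%E != -oo%E.
Proof.
rewrite esum_eqNy; apply/existsPn => tau /=; rewrite esum_eqNy.
by apply/existsPn => i /=; exact: phi_conj_neqNy.
Qed.

(** The gap with the possibly infinite values of g and of the conjugates replaced by reals: exact
    values before a step ([gap_finE]), upper bounds after it ([gap_le]). *)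
Definition gap_val (x : 'cV[R]_d) alpha (gx : R) (c : 'I_m -> 'I_n -> R) : R :=
  N^-1 * phi_sum x + l * gs (dual_point pb alpha) + l * gx +
  N^-1 * \sum_(tau < n) \sum_(i < m) c i tau.

Lemma gap_le x alpha gx c : (reg pb x <= gx%:E)%E ->
  (forall i tau, (phi_conj alpha i tau <= (c i tau)%:E)%E) ->
  (primal pb x - dual pb alpha <= (gap_val x alpha gx c)%:E)%E.
Proof.
move=> xg ac; rewrite gapE /gap_val !EFinD; apply: leeD; first apply: leeD => //.
  by rewrite EFinM; apply: lee_wpmul2l => //; rewrite lee_fin ltW.
rewrite EFinM; apply: lee_wpmul2l; first by rewrite lee_fin invr_ge0 ltW.
by rewrite -sumEFin; apply: lee_sum => tau _; rewrite -sumEFin; apply: lee_sum.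
Qed.

Lemma gap_finE x alpha gx c : reg pb x = gx%:E ->
  (forall i tau, phi_conj alpha i tau = (c i tau)%:E) ->
  (primal pb x - dual pb alpha)%E = (gap_val x alpha gx c)%:E.
Proof.
move=> xg ac; rewrite gapE xg /gap_val.
have -> : (\sum_(tau < n) \sum_(i < m) phi_conj alpha i tau)%E =
    (\sum_(tau < n) \sum_(i < m) c i tau)%:E.
  rewrite -sumEFin; apply: eq_bigr => tau _; rewrite -sumEFin.
  by apply: eq_bigr => i _; rewrite ac.
by rewrite -!EFinM -!EFinD.
Qed.

(** Since no term can be -oo, infinities never cancel and a single infinite term makes the gap
    +oo. *)
Lemma gap_dichotomy x alpha : (primal pb x - dual pb alpha)%E = +oo%E \/
  exists gx c, reg pb x = gx%:E /\
    forall i tau, phi_conj alpha i tau = (c i tau)%:E.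
Proof.
have lp : (0 < l%:E)%E by [].
have Np : (0 < N^-1%:E)%E by rewrite lte_fin invr_gt0.
have sNy := sum_phi_conj_neqNy alpha.
rewrite gapE; set s := (\sum_(tau < n) _)%E in sNy *.
have NsNy : (N^-1%:E * s)%E != -oo%E.
  by move: sNy; case: s => [r||]//= _; rewrite gt0_muley.
move: (reg_neqNy x); case E : (reg pb x) => [gx||]// _; last first.
  left; rewrite gt0_muley// addey//; move: NsNy.
  by case: (N^-1%:E * s)%E => //.
have [[c cE]|] := pselect (exists c, forall i tau, phi_conj alpha i tau = (c i tau)%:E).
  by right; exists gx, c.
move=> nc; left; suff -> : s = +oo%E by rewrite gt0_muley// -EFinM -EFinD addey.
apply/eqP/negPn/negP => sny; apply: nc.
exists (fun i tau => fine (phi_conj alpha i tau)) => i tau.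
rewrite fineK// fin_numE phi_conj_neqNy/=; apply: contra sny => /eqP piy.
rewrite /s esum_eqy => [|sg _]; last first.
  rewrite esum_eqNy; apply/existsPn => j /=; exact: phi_conj_neqNy.
apply/existsP; exists tau => /=; rewrite esum_eqy; last by move=> *; exact: phi_conj_neqNy.
by apply/existsP; exists i => /=; rewrite piy.
Qed.

Lemma dual_pointE alpha (w : 'cV[R]_d) : l * dotcv (dual_point pb alpha) w =
  N^-1 * \sum_(tau < n) \sum_(i < m) dotcv (matA pb i tau *m alpha i tau) w.
Proof.
rewrite /dual_point dotcvZl -/l -/N invfM mulrA mulrA divff ?gt_eqF// mul1r.
rewrite dotcv_suml; congr (_ * _); apply: eq_bigr => tau _.
by rewrite dotcv_suml.
Qed.

(** Weak duality: Fenchel-Young for g at the dual point and for each [phi]; the inner products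
    cancel by [dual_pointE]. *)
Lemma gap_ge0 x alpha : (0 <= primal pb x - dual pb alpha)%E.
Proof.
have [->//|[gx [c [xg ac]]]] := gap_dichotomy x alpha.
rewrite (gap_finE xg ac) lee_fin /gap_val.
set ub := dual_point pb alpha.
have h1 : dotcv ub x - gx <= gs ub.
  have := conjugate_fin reg_pcc reg_sc ub; rewrite -lee_fin => <-.
  by apply: ereal_sup_ubound; exists x => //; rewrite xg -EFinB.
have h2 : - \sum_(tau < n) \sum_(i < m) dotcv (matA pb i tau *m alpha i tau) x <=
    phi_sum x + \sum_(tau < n) \sum_(i < m) c i tau.
  rewrite -sumrN -big_split/=; apply: ler_sum => tau _.
  rewrite -sumrN -big_split/=; apply: ler_sum => i _.
  have := conjugate_ge (phi pb i tau) (- alpha i tau) ((matA pb i tau)^T *m x).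
  rewrite -/(phi_conj alpha i tau) ac lee_fin dotcvNl dotcv_mulmxl; lra.
have Ni : 0 <= N^-1 by rewrite invr_ge0 ltW.
have := ler_wpM2l (ltW lam_gt0) h1; have := ler_wpM2l Ni h2.
rewrite mulrBr -/l dual_pointE; lra.
Qed.

End Gap.

Section Step.
Context {R : realType} {m n d t : nat}.
Variables (pb : problem R m n d t) (theta : R).
Implicit Type s : ec_state R m n d t.

Definition step_x s : 'cV[R]_d :=
  (1 - theta) *: st_x s + theta *: grad_conjugate (reg pb) (st_u s).

(** Defined for every i, drawn or not, so that averages over the draw make sense. *)
Definition step_dir s i tau : 'cV[R]_t :=
  - (theta / m%:R^-1) *: st_alpha s i tau
  - (theta / m%:R^-1) *: grad (phi pb i tau) ((matA pb i tau)^T *m step_x s).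

Definition step_alpha (I : 'I_n -> 'I_m) s i tau : 'cV[R]_t :=
  if i == I tau then st_alpha s i tau + step_dir s (I tau) tau
  else st_alpha s i tau.

Definition step_q s i tau : 'cV[R]_d :=
  (lam pb * m%:R)^-1 *: (matA pb i tau *m step_dir s i tau).

Lemma ec_stepE (Z : Type) (Q : Z -> 'cV[R]_d -> 'cV[R]_d) I z s :
  ec_step pb Q theta I z s = EcState (step_x s) (step_alpha I s)
    (st_u s + n%:R^-1 *: \sum_tau Q (z tau) (step_q s (I tau) tau + st_e s tau))
    (fun tau => st_e s tau + step_q s (I tau) tau -
       Q (z tau) (step_q s (I tau) tau + st_e s tau)).
Proof. by []. Qed.

Hypotheses (m_gt0 : (0 < m)%N) (n_gt0 : (0 < n)%N) (lam_gt0 : 0 < lam pb).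

Lemma dual_point_step I s : dual_point pb (step_alpha I s) =
  dual_point pb (st_alpha s) + n%:R^-1 *: \sum_tau step_q s (I tau) tau.
Proof.
have -> : \sum_tau step_q s (I tau) tau = (lam pb * m%:R)^-1 *:
    \sum_tau matA pb (I tau) tau *m step_dir s (I tau) tau.
  by rewrite scaler_sumr.
rewrite /dual_point scalerA -invfM [n%:R * _]mulrC -mulrA -natrM -scalerDr.
congr (_ *: _); rewrite -big_split/=; apply: eq_bigr => tau _.
rewrite (bigD1 (I tau))//= [X in _ = X + _](bigD1 (I tau))//= /step_alpha eqxx.
rewrite mulmxDr -!addrA; congr (_ + _); rewrite addrC; congr (_ + _).
by apply: eq_bigr => i /negPf->.
Qed.

Definition ec_inv s :=
  st_u s = dual_point pb (st_alpha s) - n%:R^-1 *: \sum_tau st_e s tau.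

Lemma ec_inv_init x0 alpha0 : ec_inv (ec_init pb x0 alpha0).
Proof. by rewrite /ec_inv /= big1// scaler0 subr0. Qed.

Lemma ec_inv_step (Z : Type) (Q : Z -> 'cV[R]_d -> 'cV[R]_d) I z s :
  ec_inv s -> ec_inv (ec_step pb Q theta I z s).
Proof.
rewrite /ec_inv ec_stepE /= dual_point_step => ->.
rewrite sumrB big_split/= !scalerBr !scalerDr.
by apply/matrixP => i j; rewrite !mxE; ring.
Qed.

End Step.

(** * Average decrease in one step, finite case *)

Section OneStep.
Context {R : realType} {m n d t : nat}.
Variables (pb : problem R m n d t) (gamma delta : R).
Hypotheses (m_gt0 : (0 < m)%N) (n_gt0 : (0 < n)%N) (d_gt0 : (0 < d)%N).
Hypothesis gamma_gt0 : 0 < gamma.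
Hypothesis phi_cvx : forall i tau, convex_function [set: 'cV[R]_t] (phi pb i tau).
Hypothesis phi_smooth : forall i tau, smooth gamma^-1 (phi pb i tau).
Hypotheses (reg_pcc : proper_closed_convex (reg pb)) (reg_sc : strongly_convex1 (reg pb)).
Hypotheses (delta_gt0 : 0 < delta) (delta_lt1 : delta < 1).
Hypotheses (lam_gt0 : 0 < lam pb) (lam_le : lam pb <= Rtot pb ^+ 2 / gamma).

Let theta := theta_choice pb gamma delta.
Let theta_gt0 : 0 < theta. Proof. exact: theta_gt0. Qed.
Let theta_m : theta * m%:R <= 1. Proof. exact: theta_m_le1. Qed.

Let N : R := (m * n)%:R.
Let N0 : 0 < N. Proof. by rewrite ltr0n muln_gt0 m_gt0. Qed.
Let m0 : (m%:R : R) != 0. Proof. by rewrite pnatr_eq0 -lt0n. Qed.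
Let n0 : (n%:R : R) != 0. Proof. by rewrite pnatr_eq0 -lt0n. Qed.
Let l := lam pb.
Let gs u := fine (conjugate (reg pb) u).

Variable s : ec_state R m n d t.
Variables (gx : R) (c : 'I_m -> 'I_n -> R).
Hypothesis xg : reg pb (st_x s) = gx%:E.
Hypothesis ac : forall i tau, phi_conj pb (st_alpha s) i tau = (c i tau)%:E.
Hypothesis s_inv : ec_inv pb s.

Let u := st_u s.
Let ub := dual_point pb (st_alpha s).
Let eb := n%:R^-1 *: \sum_tau st_e s tau.
Let w := grad_conjugate (reg pb) u.
Let wb := grad_conjugate (reg pb) ub.
Let x' := step_x pb theta s.
Let z' i tau := (matA pb i tau)^T *m x'.
Let G i tau := grad (phi pb i tau) (z' i tau).
Let h i tau := st_alpha s i tau + G i tau.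
Let S := \sum_(tau < n) \sum_(i < m) dotcv (h i tau) (h i tau).
Let b := - (theta / l).
Let gx' := (1 - theta) * gx + theta * (dotcv u w - gs u).
Let cn i tau := (1 - theta * m%:R) * c i tau +
  theta * m%:R * (dotcv (G i tau) (z' i tau) - phi pb i tau (z' i tau)) -
  gamma / 2 * (theta * m%:R * (1 - theta * m%:R)) * dotcv (h i tau) (h i tau).
Let c' (I : 'I_n -> 'I_m) i tau := if i == I tau then cn i tau else c i tau.

Let m_ge1 : 1 <= m%:R :> R. Proof. by rewrite ler1n. Qed.
Let theta01 : 0 <= theta <= 1.
Proof.
rewrite (ltW theta_gt0)/=; apply: le_trans theta_m.
by rewrite ler_peMr// ltW.
Qed.

Lemma step_reg_le : (reg pb x' <= gx'%:E)%E.
Proof.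
have [_ _ gcvx] := reg_pcc.
have := gcvx w (st_x s) theta theta01.
rewrite addrC -/x' (reg_grad_conjugate reg_pcc reg_sc) xg => /le_trans; apply.
by rewrite -!EFinM -EFinD lee_fin /gx' /gs addrC.
Qed.

Let dirE i tau : step_dir pb theta s i tau = - (theta * m%:R) *: h i tau.
Proof. by rewrite /step_dir invrK /h scalerDr !scaleNr. Qed.

Let qE i tau : step_q pb theta s i tau = b *: (matA pb i tau *m h i tau).
Proof.
rewrite /step_q dirE -scalemxAr scalerA; congr (_ *: _).
by rewrite /b -/l; field; rewrite m0 gt_eqF.
Qed.

(** At a drawn block the new - alpha is the convex combination, with weight theta m, of the old one
    and the gradient [G]. The conjugate is known at [G] by Fenchel equality, and its strong
    convexity yields the negative term in [cn]. *)
Lemma step_phi_conj_le I i tau :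
  (phi_conj pb (step_alpha pb theta I s) i tau <= (c' I i tau)%:E)%E.
Proof.
rewrite /phi_conj /step_alpha /c'; case: eqP => [->|_]; last by rewrite -ac.
set i0 := I tau.
have tm : 0 <= theta * m%:R <= 1 by rewrite theta_m andbT mulr_ge0// ltW.
have [_ gL] := phi_smooth i0 tau.
have [pdiff _] := phi_smooth i0 tau.
have := conjugate_strongly_convex pdiff gamma_gt0 gL (ac i0 tau)
  (conjugate_grad pdiff (z' i0 tau) (@phi_cvx i0 tau)) tm.
have -> : (1 - theta * m%:R) *: - st_alpha s i0 tau + theta * m%:R *: G i0 tau =
    - (st_alpha s i0 tau + step_dir pb theta s i0 tau).
  rewrite dirE /h; apply/matrixP => k j; rewrite !mxE; ring.
rewrite -/(G i0 tau).
have -> : - st_alpha s i0 tau - G i0 tau = - h i0 tau by rewrite /h opprD.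
by rewrite dotcvNl dotcvNr opprK.
Qed.

Let Delta (I : {ffun 'I_n -> 'I_m}) : 'cV[R]_d :=
  \sum_tau (b / n%:R) *: (matA pb (I tau) tau *m h (I tau) tau).
Let Dbar : 'cV[R]_d :=
  \sum_tau vmean (fun i => (b / n%:R) *: (matA pb i tau *m h i tau)).

Let dual_step (I : {ffun 'I_n -> 'I_m}) :
  dual_point pb (step_alpha pb theta I s) = ub + Delta I.
Proof.
rewrite dual_point_step// -/ub; congr (_ + _); rewrite scaler_sumr.
by apply: eq_bigr => tau _; rewrite qE scalerA [_ * b]mulrC.
Qed.

(** The expansion is at [ub] rather than [u]: the dual point moves by the uncompressed [Delta I], so
    only its mean and second moment enter. The passage from [ub] to [u] costs [gs_ub_le] and
    [wb_w]. *)
Let uavg_gs_le : uavg (fun I => gs (dual_point pb (step_alpha pb theta I s))) <=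
  gs ub + dotcv Dbar wb + 2^-1 * uavg (fun I => dotcv (Delta I) (Delta I)).
Proof.
rewrite -{1}(@uavg_cst R m n m_gt0 (gs ub)) [dotcv Dbar wb]dotcvC.
rewrite -(uavg_dotcv_mean m_gt0 (fun tau i => (b / n%:R) *: (matA pb i tau *m h i tau))).
rewrite -uavgZ -!uavgD; apply: uavg_le => // I.
rewrite dual_step; apply: le_trans (conjugate_smooth_le reg_pcc reg_sc ub _) _.
have -> : ub + Delta I - ub = Delta I by rewrite addrAC subrr add0r.
by rewrite (dotcvC _ wb).
Qed.

Let gs_ub_le : gs ub <= gs u + dotcv eb w + 2^-1 * dotcv eb eb.
Proof.
apply: le_trans (conjugate_smooth_le reg_pcc reg_sc u _) _.
have -> : ub - u = eb by rewrite /u s_inv -/ub -/eb opprB addrC subrK.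
by [].
Qed.

Let wb_w : dotcv (wb - w) (wb - w) <= dotcv eb eb.
Proof.
rewrite -!enorm_sqr ler_pXn2r ?nnegrE ?enorm_ge0//.
apply: le_trans (grad_conjugate_lipschitz reg_pcc reg_sc _ _) _.
by have -> : ub - u = eb by rewrite /u s_inv -/ub -/eb opprB addrC subrK.
Qed.

Let eb_le : dotcv eb eb <= (\sum_tau dotcv (st_e s tau) (st_e s tau)) / n%:R.
Proof.
rewrite /eb dotcvZl dotcvZr [leRHS]mulrC ler_wpM2l ?invr_ge0//.
rewrite ler_pdivrMl ?ltr0n//.
set y := \sum_tau st_e s tau; set E := \sum_tau dotcv _ _.
(* Jensen's inequality, read off from the squared deviations from the mean. *)
have : 0 <= \sum_tau dotcv (st_e s tau - n%:R^-1 *: y) (st_e s tau - n%:R^-1 *: y).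
  by apply: sumr_ge0 => tau _; exact: dotcv_ge0.
have termE tau : dotcv (st_e s tau - n%:R^-1 *: y) (st_e s tau - n%:R^-1 *: y) =
    dotcv (st_e s tau) (st_e s tau) + - (2 / n%:R) * dotcv (st_e s tau) y +
    n%:R^-1 ^+ 2 * dotcv y y.
  by rewrite !dotcvBl !dotcvBr !dotcvZl !dotcvZr (dotcvC y); ring.
under eq_bigr do rewrite termE.
rewrite !big_split/= -mulr_sumr -dotcv_suml -/y -/E sumr_const card_ord.
rewrite -[(_ * dotcv y y) *+ n]mulr_natl.
have -> : E + - (2 / n%:R) * dotcv y y + n%:R * (n%:R^-1 ^+ 2 * dotcv y y) =
    E - n%:R^-1 * dotcv y y by field.
by rewrite subr_ge0 ler_pdivrMl ?ltr0n.
Qed.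

Let uavg_c' i tau : uavg (fun I : {ffun 'I_n -> 'I_m} => c' I i tau) =
  c i tau + m%:R^-1 * (cn i tau - c i tau).
Proof.
have -> : c i tau + m%:R^-1 * (cn i tau - c i tau) =
    m%:R^-1 * \sum_j (if i == j then cn i tau else c i tau).
  rewrite (bigD1 i)//= eqxx (eq_bigr (fun=> c i tau)); last first.
    by move=> j; rewrite eq_sym => /negPf->.
  rewrite sumr_const -[c i tau *+ _]mulr_natl cardC1 card_ord.
  rewrite -subn1 natrB//; by field.
exact: (uavg_coord m_gt0 tau (fun j => if i == j then cn i tau else c i tau)).
Qed.

(** The probability 1/m of drawing a block cancels the m in the weight theta m, so the dual part
    moves at the same rate theta as the primal one. The gradient inequality at z' and z' = (1 -
    theta) A^T x + theta A^T w reduce all inner products with G to theta <A G, w>. *)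
Let sum_key : phi_sum pb x' +
    \sum_(tau < n) \sum_(i < m) (c i tau + m%:R^-1 * (cn i tau - c i tau)) <=
  (1 - theta) * phi_sum pb (st_x s) +
  (1 - theta) * (\sum_(tau < n) \sum_(i < m) c i tau) +
  theta * (\sum_(tau < n) \sum_(i < m) dotcv (matA pb i tau *m G i tau) w) +
  (- (gamma / 2 * theta * (1 - theta * m%:R))) * S.
Proof.
rewrite /phi_sum /S !mulr_sumr -!big_split/=; apply: ler_sum => tau _.
rewrite !mulr_sumr -!big_split/=; apply: ler_sum => i _.
have [pdiff _] := phi_smooth i tau.
have := convex_gradient_le pdiff (z' i tau) ((matA pb i tau)^T *m st_x s) (@phi_cvx i tau).
have zE : z' i tau = (1 - theta) *: ((matA pb i tau)^T *m st_x s) +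
    theta *: ((matA pb i tau)^T *m w).
  by rewrite /z' /x' /step_x mulmxDr -!scalemxAr.
rewrite -/(G i tau) dotcv_mulmxl [dotcv (G i tau) (_ - _)]dotcvBr.
have Gz : dotcv (G i tau) (z' i tau) = (1 - theta) * dotcv (G i tau) ((matA pb i tau)^T *m st_x s)
    + theta * dotcv (G i tau) ((matA pb i tau)^T *m w).
  by rewrite zE dotcvDr !dotcvZr.
have -> : c i tau + m%:R^-1 * (cn i tau - c i tau) = (1 - theta) * c i tau +
  theta * (dotcv (G i tau) (z' i tau) - phi pb i tau (z' i tau)) -
  gamma / 2 * theta * (1 - theta * m%:R) * dotcv (h i tau) (h i tau).
  by rewrite /cn; field.
rewrite -/(z' i tau) => hc.
have t1 : 0 <= 1 - theta by rewrite subr_ge0; case/andP: theta01.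
have := ler_wpM2l t1 hc; move: Gz.
move: (dotcv (G i tau) (z' i tau)) (dotcv (G i tau) (_ *m st_x s))
  (dotcv (G i tau) (_ *m w)) => g1 g2 g3.
move: (phi pb i tau (z' i tau)) (phi pb i tau _) (dotcv (h i tau) _) (c i tau)
  => p1 p2 hh cc ->; lra.
Qed.

(** The inner products with w cancel: those with [u], [Dbar] and [G] add up to - theta l <eb, w>,
    which [gs_ub_le] compensates. Evaluating the gradient at [u] instead of [ub] leaves only |eb|^2
    and <wb - w, Dbar>. *)
Lemma step_gap_average :
  uavg (fun I => gap_val pb x' (step_alpha pb theta I s) gx' (c' I)) <=
  (1 - theta) * gap_val pb (st_x s) (st_alpha s) gx c +
  l * theta / 2 * dotcv eb eb + l * dotcv (wb - w) Dbar +
  l / 2 * uavg (fun I => dotcv (Delta I) (Delta I)) -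
  gamma / 2 * theta * (1 - theta * m%:R) / N * S.
Proof.
have Ni : 0 <= N^-1 by rewrite invr_ge0 ltW.
have Eavg : uavg (fun I => gap_val pb x' (step_alpha pb theta I s) gx' (c' I)) =
    N^-1 * phi_sum pb x' + l * uavg (fun I => gs (dual_point pb (step_alpha pb theta I s)))
    + l * gx' + N^-1 * \sum_(tau < n) \sum_(i < m) (c i tau + m%:R^-1 * (cn i tau - c i tau)).
  rewrite /gap_val !uavgD !uavg_cst// !uavgZ; congr (_ + _ * _).
  rewrite uavg_sum; apply: eq_bigr => tau _; rewrite uavg_sum.
  by apply: eq_bigr => i _; rewrite uavg_c'.
rewrite Eavg /gap_val -/ub -/l -/N -/(gs ub).
have h1 := ler_wpM2l Ni sum_key.
have h2 := ler_wpM2l (ltW lam_gt0) uavg_gs_le.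
have lt0 : 0 <= l * theta by rewrite mulr_ge0 ?ltW.
have h3 := ler_wpM2l lt0 gs_ub_le.
set GG := \sum_(tau < n) \sum_(i < m) dotcv (matA pb i tau *m G i tau) w in h1 *.
have uw : l * dotcv u w = N^-1 * (\sum_(tau < n) \sum_(i < m)
    dotcv (matA pb i tau *m st_alpha s i tau) w) - l * dotcv eb w.
  by rewrite /u s_inv -/ub -/eb dotcvBl mulrBr /ub (dual_pointE lam_gt0).
have Dw : l * dotcv Dbar w = - theta * (N^-1 * (\sum_(tau < n) \sum_(i < m)
    dotcv (matA pb i tau *m st_alpha s i tau) w + GG)).
  rewrite /Dbar dotcv_suml /GG -big_split/= !mulr_sumr; apply: eq_bigr => tau _.
  rewrite /vmean dotcvZl dotcv_suml -big_split/= !mulr_sumr; apply: eq_bigr => i _.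
  rewrite dotcvZl /h mulmxDr dotcvDl /b /N natrM; field.
  by rewrite m0 n0 gt_eqF.
have Dwb : l * dotcv Dbar wb = l * dotcv Dbar w + l * dotcv (wb - w) Dbar.
  by rewrite -mulrDr dotcvBl !(dotcvC _ Dbar) addrC subrK.
move: h1 h2 h3; rewrite /gx' -/l.
have := congr1 ( *%R theta) uw.
move: Dw Dwb; set AA := \sum_(tau < n) \sum_(i < m) dotcv (_ *m st_alpha s i tau) w.
set CC := \sum_(tau < n) \sum_(i < m) (_ + _); set cc := \sum_(tau < n) \sum_(i < m) c i tau.
move: (phi_sum _ _) (phi_sum _ _) (dotcv Dbar wb) (dotcv Dbar w) (dotcv (wb - w) _)
  => p1 p2 d1 d2 d3.
move: (dotcv u w) (dotcv eb w) (dotcv eb eb) (gs ub) (gs u) => uw1 ew ee g1 g2.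
move: (uavg _) (uavg _) AA GG CC cc => U1 U2 AA GG CC cc; lra.
Qed.

Let kappa := 2 * (rho pb delta + theta * l) / (delta * n%:R).

Lemma one_step_fin :
  uavg (fun I => gap_val pb x' (step_alpha pb theta I s) gx' (c' I)) +
  kappa * ((1 - delta) * uavg (fun I : {ffun 'I_n -> 'I_m} => \sum_tau
    dotcv (st_e s tau + step_q pb theta s (I tau) tau)
          (st_e s tau + step_q pb theta s (I tau) tau))) <=
  (1 - Num.min theta (delta / 4)) *
    (gap_val pb (st_x s) (st_alpha s) gx c +
     kappa * \sum_tau dotcv (st_e s tau) (st_e s tau)).
Proof.
have l0 : 0 < l by [].
have gap0 : 0 <= gap_val pb (st_x s) (st_alpha s) gx c.
  by rewrite -lee_fin -(gap_finE reg_pcc reg_sc xg ac); exact: gap_ge0.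
have S0 : 0 <= S.
  by apply: sumr_ge0 => tau _; apply: sumr_ge0 => i _; exact: dotcv_ge0.
have E0 : 0 <= \sum_tau dotcv (st_e s tau) (st_e s tau).
  by apply: sumr_ge0 => tau _; exact: dotcv_ge0.
have hm := fun i tau => dotcv_matA_le pb i tau (h i tau).
have hb := fun tau => dotcv_sum_matA_le pb m_gt0 d_gt0 tau (h ^~ tau).
have ht := dotcv_sum_sum_matA_le pb m_gt0 n_gt0 d_gt0 h.
have r0 : 0 < rho pb delta by apply: rho_gt0 => //; exact: lam_le.
apply: (@lyapunov_combination _ _ _ _ _ pb gamma delta m_gt0 n_gt0 d_gt0 gamma_gt0
  delta_gt0 delta_lt1 lam_gt0 lam_le _ S _ (dotcv eb eb)
  (uavg (fun I => dotcv (Delta I) (Delta I))) (dotcv Dbar Dbar)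
  (dotcv (wb - w) Dbar)) => //; rewrite -/theta -/l.
- apply: le_trans (step_second_moment_le m_gt0 n_gt0 hm ht b) _.
  rewrite -/S le_eqVlt; apply/orP; left; apply/eqP; rewrite /b natrM; field.
  by rewrite m0 n0 gt_eqF.
- apply: le_trans (step_mean_sq_le m_gt0 n_gt0 ht b) _.
  rewrite -/S le_eqVlt; apply/orP; left; apply/eqP; rewrite /b natrM; field.
  by rewrite m0 n0 gt_eqF.
- have rl : 0 < rho pb delta / l by rewrite divr_gt0.
  have := ler_wpM2l (ltW l0) (dotcv_young (wb - w) Dbar rl).
  have r2 : 0 <= rho pb delta / 2 by rewrite divr_ge0// ltW.
  have := ler_wpM2l r2 wb_w.
  have -> : (2 * (rho pb delta / l))^-1 = l / (2 * rho pb delta).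
    by field; rewrite !gt_eqF.
  move=> h1 h2; apply: le_trans h2 _; rewrite mulrDr lerD//.
    rewrite (_ : l * _ = rho pb delta / 2 * dotcv (wb - w) (wb - w))//.
    by field; rewrite gt_eqF.
  by rewrite le_eqVlt; apply/orP; left; apply/eqP; field; rewrite gt_eqF.
- exact: step_gap_average.
- under [X in uavg X]eq_fun do under eq_bigr do rewrite qE.
  have d01 : 0 < delta < 1 by rewrite delta_gt0.
  apply: le_trans (step_error_le m_gt0 hm hb b (st_e s) d01) _.
  rewrite le_eqVlt; apply/orP; left; apply/eqP; rewrite /a1 /b -/S; field.
  by rewrite m0 !gt_eqF.
Qed.

End OneStep.

Section OneStepEreal.
Context {R : realType} {m n d t : nat}.
Variables (pb : problem R m n d t) (gamma delta : R).
Hypotheses (m_gt0 : (0 < m)%N) (n_gt0 : (0 < n)%N) (d_gt0 : (0 < d)%N).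
Hypothesis gamma_gt0 : 0 < gamma.
Hypothesis phi_cvx : forall i tau, convex_function [set: 'cV[R]_t] (phi pb i tau).
Hypothesis phi_smooth : forall i tau, smooth gamma^-1 (phi pb i tau).
Hypotheses (reg_pcc : proper_closed_convex (reg pb)) (reg_sc : strongly_convex1 (reg pb)).
Hypotheses (delta_gt0 : 0 < delta) (delta_lt1 : delta < 1).
Hypotheses (lam_gt0 : 0 < lam pb) (lam_le : lam pb <= Rtot pb ^+ 2 / gamma).

Let theta := theta_choice pb gamma delta.
Let kappa := 2 * (rho pb delta + theta * lam pb) / (delta * n%:R).

Lemma kappa_ge0 : 0 <= kappa.
Proof.
have th0 : 0 < theta by exact: theta_gt0.
have r0 : 0 < rho pb delta by apply: rho_gt0 => //; exact: lam_le.
have nR : 0 < n%:R :> R by rewrite ltr0n.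
by rewrite /kappa; positivity.
Qed.

Lemma Psi1E s : Psi1 pb delta theta s = (primal pb (st_x s) - dual pb (st_alpha s) +
  (kappa * \sum_(tau < n) enorm (st_e s tau) ^+ 2)%:E)%E.
Proof. by []. Qed.

Lemma Psi1_ge0 s : (0 <= Psi1 pb delta theta s)%E.
Proof.
rewrite Psi1E adde_ge0 ?gap_ge0// lee_fin mulr_ge0 ?kappa_ge0//.
by apply: sumr_ge0 => tau _; exact: sqr_ge0.
Qed.

(** On the left the seeds are already integrated out: each compression error is replaced by its
    bound with factor 1 - delta. *)
Lemma one_step_le s : ec_inv pb s ->
  (\sum_(I : {ffun 'I_n -> 'I_m}) (m%:R^-1 ^+ n)%:E *
     (primal pb (step_x pb theta s) - dual pb (step_alpha pb theta I s) +
      (kappa * ((1 - delta) * \sum_(tau < n)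
         enorm (step_q pb theta s (I tau) tau + st_e s tau) ^+ 2))%:E)
   <= (1 - Num.min theta (delta / 4))%:E * Psi1 pb delta theta s)%E.
Proof.
move=> sinv; have [c0 c1] := contraction_factor_bounds m_gt0 n_gt0 d_gt0 gamma_gt0
  delta_gt0 delta_lt1 lam_gt0 lam_le.
have [pd|[gx [c [xg ac]]]] := gap_dichotomy m_gt0 n_gt0 reg_pcc reg_sc lam_gt0
  (st_x s) (st_alpha s).
  by rewrite Psi1E pd addye// gt0_muley ?leey// lte_fin subr_gt0.
have fin := one_step_fin m_gt0 n_gt0 d_gt0 gamma_gt0 phi_cvx phi_smooth reg_pcc reg_sc
  delta_gt0 delta_lt1 lam_gt0 lam_le xg ac sinv.
rewrite Psi1E (gap_finE reg_pcc reg_sc xg ac).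
under [X in (_ <= _ * (_ + (_ * X)%:E))%E]eq_bigr do rewrite enorm_sqr.
rewrite -[X in (_ <= _ * X)%E]EFinD -[X in (_ <= X)%E]EFinM.
move: fin; rewrite -lee_fin => fin; apply: le_trans fin.
rewrite -uavgZ -uavgZ -uavgD /uavg -sumEFin; apply: lee_sum => I _.
rewrite [X in (_ <= X)%E]EFinM; apply: lee_wpmul2l; first by rewrite lee_fin exprn_ge0// invr_ge0.
rewrite [X in (_ <= X)%E]EFinD; apply: leeD.
  apply: gap_le => //; first exact: (step_reg_le m_gt0 n_gt0 d_gt0).
  move=> i tau; exact: (step_phi_conj_le m_gt0 n_gt0 d_gt0).
rewrite lee_fin le_eqVlt; apply/orP; left; apply/eqP; congr (_ * (_ * _)).
by apply: eq_bigr => tau _; rewrite enorm_sqr [_ + st_e _ _]addrC.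
Qed.

End OneStepEreal.

(** * Measurability and independence of the past *)

Section VectorMeasurability.
Context {R : realType} {d : measure_display} {T : measurableType d}.

(* Coordinatewise measurability; equivalent to Borel measurability because
   R^k is second countable. *)
Definition vmeasurable k (F : T -> 'cV[R]_k) :=
  forall i, measurable_fun setT (fun w => F w i 0).

(** An open set is the union of the countably many rational balls it contains. Sup-norm balls are
    boxes, whose preimages are finite intersections of coordinate preimages. *)
Lemma vmeasurable_open k (F : T -> 'cV[R]_k) (U : set 'cV[R]_k) :
  vmeasurable F -> open U -> measurable (F @^-1` U).
Proof.
move=> mF oU.
pose c (q : 'cV[rat]_k) : 'cV[R]_k := map_mx ratr q.
pose B (p : 'cV[rat]_k * nat) := ball (c p.1) (p.2.+1%:R^-1 : R).
pose G p := if `[< B p `<=` U >] then F @^-1` B p else set0.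
have -> : F @^-1` U = \bigcup_p G p.
  apply/seteqP; split => [w Uw|w [p _]]; last first.
    by rewrite /G; case: asboolP => // pU Bw; exact: pU.
  have [e /= e0 eU] := (nbhs_ballP _ _).1 (open_nbhs_nbhs (conj oU Uw)).
  have e2 : 0 < e / 2 by rewrite divr_gt0.
  have [r _ re] := near_infty_natSinv_lt (PosNum e2).
  have {re} re : r.+1%:R^-1 < e / 2 := re r (leqnn r).
  have r0 : 0 < r.+1%:R^-1 :> R by rewrite invr_gt0.
  have rq (i : 'I_k) : exists q : rat, `|ratr q - F w i 0| < r.+1%:R^-1.
    have [|q] := @rat_in_itvoo R (F w i 0 - r.+1%:R^-1) (F w i 0 + r.+1%:R^-1).
      by rewrite ltrBlDr -addrA ltrDl addr_gt0.
    by rewrite in_itv/= => /andP[q1 q2]; exists q; rewrite ltr_distl q1.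
  have [q qE] := choice rq.
  exists (\col_i q i, r) => //; rewrite /G.
  have near (v : 'cV[R]_k) : (forall i, `|ratr (q i) - v i 0| < r.+1%:R^-1) ->
      B (\col_i q i, r) v.
    by move=> vq; split=> // i j; rewrite ord1 !mxE; exact: vq.
  case: asboolP => [_|[]]; first exact: near.
  move=> v /= [_ Bv]; apply: eU; split=> // i j; rewrite ord1.
  have := Bv i 0; rewrite !mxE -ball_normE/= => h1.
  have h2 := qE i.
  rewrite -(subrK (ratr (q i)) (F w i 0)) -addrA.
  apply: le_lt_trans (ler_normD _ _) _; rewrite (distrC (F w i 0)).
  by move: (r.+1%:R^-1) re h1 h2 => s re h1 h2; lra.
apply: countable_bigcupT_measurable; first exact: countableP.
move=> p; rewrite /G; case: asboolP => // _.
have -> : F @^-1` B p = \bigcap_(i in [set: 'I_k])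
    (fun w => F w i 0) @^-1` ball (c p.1 i 0) (p.2.+1%:R^-1 : R).
  apply/seteqP; split => [w [_ Bw] i _|w Bw]; first exact: Bw.
  by split=> // i j; rewrite ord1; exact: Bw.
apply: fin_bigcap_measurable; first exact: finite_finset.
by move=> i _; rewrite -[X in measurable X]setTI; apply: mF => //; exact: measurable_ball.
Qed.

Lemma vmeasurable_borel k (F : T -> 'cV[R]_k) :
  vmeasurable F -> measurable_fun setT (F : T -> borel_cV R k).
Proof.
move=> mF; apply: (@measurability _ _ T (borel_cV R k) setT F (@open 'cV[R]_k)) => //.
by move=> _ [U oU <-]; rewrite setTI; exact: vmeasurable_open.
Qed.

Lemma open_measurable_fun k (F : T -> 'cV[R]_k) (f : 'cV[R]_k -> R) :
  (forall U : set 'cV[R]_k, open U -> measurable (F @^-1` U)) ->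
  continuous f -> measurable_fun setT (f \o F).
Proof.
move=> oF cf; apply: (measurability _ (RGenOInfty.measurableE R)).
move=> _ [_ [a ->] <-]; rewrite setTI comp_preimage; apply: oF.
by move/continuousP : cf; apply; exact: interval_open.
Qed.

Lemma borel_vmeasurable k (F : T -> 'cV[R]_k) :
  measurable_fun setT (F : T -> borel_cV R k) -> vmeasurable F.
Proof.
move=> mF i; apply: (@open_measurable_fun k F (fun v => v i 0)).
  move=> U oU; rewrite -[X in measurable X]setTI; apply: mF => //.
  exact: sub_sigma_algebra.
exact: coord_continuous.
Qed.

Lemma vmeasurable_continuous k (F : T -> 'cV[R]_k) (f : 'cV[R]_k -> R) :
  vmeasurable F -> continuous f -> measurable_fun setT (fun w => f (F w)).
Proof.
by move=> mF; apply: open_measurable_fun => U; exact: vmeasurable_open.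
Qed.

Lemma vmeasurable_comp k l (F : T -> 'cV[R]_k) (f : 'cV[R]_k -> 'cV[R]_l) :
  vmeasurable F -> continuous f -> vmeasurable (fun w => f (F w)).
Proof.
move=> mF cf i; apply: (vmeasurable_continuous mF (f := fun v => f v i 0)) => v.
exact: (continuous_comp (cf v) (@coord_continuous R l 1 i 0 (f v))).
Qed.

Lemma vmeasurable_lsc k (F : T -> 'cV[R]_k) (f : 'cV[R]_k -> \bar R) :
  vmeasurable F -> lower_semicontinuous f -> measurable_fun setT (fun w => f (F w)).
Proof.
move=> mF lf; apply: (measurability _ (ErealGenOInfty.measurableE R)).
move=> _ [_ [a ->] <-]; rewrite setTI -[X in measurable X]/(F @^-1` (f @^-1` _)).
apply: vmeasurable_open => //; rewrite preimage_itvoy.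
by move/lower_semicontinuousP : lf; exact.
Qed.

Lemma vmeasurable_cst k (v : 'cV[R]_k) : vmeasurable (fun=> v).
Proof. by move=> i; exact: measurable_cst. Qed.

Lemma vmeasurableD k (F G : T -> 'cV[R]_k) :
  vmeasurable F -> vmeasurable G -> vmeasurable (fun w => F w + G w).
Proof. by move=> mF mG i; under eq_fun do rewrite mxE; exact: measurable_funD. Qed.

Lemma vmeasurableZ k a (F : T -> 'cV[R]_k) :
  vmeasurable F -> vmeasurable (fun w => a *: F w).
Proof.
move=> mF i; under eq_fun do rewrite mxE.
by apply: measurable_funM => //; exact: measurable_cst.
Qed.

Lemma vmeasurableN k (F : T -> 'cV[R]_k) :
  vmeasurable F -> vmeasurable (fun w => - F w).
Proof.
by move=> mF; under eq_fun do rewrite -scaleN1r; exact: vmeasurableZ.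
Qed.

Lemma vmeasurable_sum k (I : Type) (r : seq I) (F : I -> T -> 'cV[R]_k) :
  (forall i, vmeasurable (F i)) -> vmeasurable (fun w => \sum_(i <- r) F i w).
Proof.
move=> mF j; under eq_fun do rewrite summxE.
by apply: measurable_sum => i; exact: mF.
Qed.

Lemma vmeasurable_mulmx k l (A : 'M[R]_(l, k)) (F : T -> 'cV[R]_k) :
  vmeasurable F -> vmeasurable (fun w => A *m F w).
Proof.
move=> mF i; under eq_fun do rewrite mxE.
apply: measurable_sum => j; apply: measurable_funM; last exact: mF.
exact: measurable_cst.
Qed.

Lemma vmeasurable_enorm_sqr k (F : T -> 'cV[R]_k) :
  vmeasurable F -> measurable_fun setT (fun w => enorm (F w) ^+ 2).
Proof.
move=> mF; apply: measurable_funX.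
exact: (vmeasurable_continuous mF (@continuous_enorm R k)).
Qed.

Lemma vmeasurable_if k (b : T -> bool) (F G : T -> 'cV[R]_k) :
  measurable_fun setT b -> vmeasurable F -> vmeasurable G ->
  vmeasurable (fun w => if b w then F w else G w).
Proof.
move=> mb mF mG i.
rewrite (_ : (fun w => _) = (fun w => if b w then F w i 0 else G w i 0)).
  by apply: measurable_fun_ifT.
by apply/funext => w; case: (b w).
Qed.

End VectorMeasurability.

(** A conjugate is a supremum of continuous affine functions. This gives measurability even where it
    is infinite. *)
Lemma lower_semicontinuous_conjugate (R : realType) k (f : 'cV[R]_k -> \bar R) :
  lower_semicontinuous (conjugate f).
Proof.
move=> y a /ereal_sup_gt[_ [x _ <-]] ayx.
exists [set z | (a%:E < (dotcv z x)%:E - f x)%E]; last first.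
  by move=> z /lt_le_trans; apply; apply: ereal_sup_ubound; exists x.
move: ayx; case: (f x) => [r||]//=; last first.
  by move=> _; apply: filterE => z; rewrite /= ltry.
rewrite -EFinB lte_fin => ayx.
have /= := @continuous_dotcvr R k x y [set s | a + r < s].
move=> /(_ _); have : nbhs (dotcv x y) [set s | a + r < s].
  by apply: lt_nbhsr; rewrite dotcvC; lra.
move=> /[swap] /[apply] h; apply: (@filterS _ _ (nbhs_filter y) _ _ _ h) => z /=.
by rewrite lte_fin dotcvC; lra.
Qed.

Lemma integral_mrestr d (T : measurableType d) (R : realType)
    (mu : {measure set T -> \bar R}) (D : set T) (mD : measurable D)
    (f : T -> \bar R) : measurable_fun setT f -> (forall w, 0 <= f w)%E ->
  (\int[mrestr mu mD]_w f w = \int[mu]_(w in D) f w)%E.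
Proof.
move=> mf f0; rewrite -(setUv D) ge0_integral_setU//=; last 3 first.
- exact: measurableC.
- by rewrite setUv.
- by apply/disj_setPCl.
rewrite [X in (_ + X)%E](null_set_integral); last 3 first.
- exact: measurableC.
- exact: measurable_funTS.
- by rewrite /= /mrestr setICl measure0.
rewrite adde0; apply: eq_measure_integral => A mA AD.
by rewrite /= /mrestr (setIidl AD).
Qed.

(** * Measurability of the iterates and of the Lyapunov function *)

Section StateMeasurability.
Context {R : realType} {m n dd t : nat}.
Variables (pb : problem R m n dd t) (gamma theta : R).
Hypothesis phi_smooth : forall i tau, smooth gamma^-1 (phi pb i tau).
Hypotheses (reg_pcc : proper_closed_convex (reg pb)) (reg_sc : strongly_convex1 (reg pb)).

Section OneState.
Context {d : measure_display} {T : measurableType d}.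

Definition smeasurable (S : T -> ec_state R m n dd t) :=
  [/\ vmeasurable (fun w => st_x (S w)),
      forall i tau, vmeasurable (fun w => st_alpha (S w) i tau),
      vmeasurable (fun w => st_u (S w)) &
      forall tau, vmeasurable (fun w => st_e (S w) tau)].

Variable S : T -> ec_state R m n dd t.
Hypothesis mS : smeasurable S.

Lemma vmeasurable_step_x : vmeasurable (fun w => step_x pb theta (S w)).
Proof.
have [mx _ mu _] := mS.
apply: vmeasurableD; apply: vmeasurableZ => //.
apply: (vmeasurable_comp mu); apply: (@continuous_enorm_lipschitz _ _ _ _ 1) => x y.
by rewrite mul1r; apply: le_trans (norm_le_enorm _) _; exact: grad_conjugate_lipschitz.
Qed.

Lemma vmeasurable_step_dir i tau : vmeasurable (fun w => step_dir pb theta (S w) i tau).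
Proof.
have [_ ma _ _] := mS.
apply: vmeasurableD; first exact: vmeasurableZ.
apply/vmeasurableN/vmeasurableZ; have [_ gL] := phi_smooth i tau.
apply: (@vmeasurable_comp _ _ _ _ _
  (fun w => (matA pb i tau)^T *m step_x pb theta (S w))); last exact: continuous_grad gL.
exact/vmeasurable_mulmx/vmeasurable_step_x.
Qed.

Lemma vmeasurable_step_alpha (I : T -> 'I_n -> 'I_m) i tau :
  (forall tau, measurable_fun setT (fun w => i == I w tau)) ->
  vmeasurable (fun w => step_alpha pb theta (I w) (S w) i tau).
Proof.
move=> mI; have [_ ma _ _] := mS.
rewrite (_ : (fun w => _) = (fun w => if i == I w tau then
    st_alpha (S w) i tau + step_dir pb theta (S w) i tau else st_alpha (S w) i tau)).
  by apply: vmeasurable_if => //; apply: vmeasurableD => //; exact: vmeasurable_step_dir.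
by apply/funext => w; rewrite /step_alpha; case: eqP => [->|].
Qed.

Lemma vmeasurable_step_q (I : T -> 'I_n -> 'I_m) tau :
  (forall i tau, measurable_fun setT (fun w => i == I w tau)) ->
  vmeasurable (fun w => step_q pb theta (S w) (I w tau) tau).
Proof.
(* The selection by a random index becomes a finite sum of branches, each with a fixed index. *)
move=> mI; rewrite (_ : (fun w => _) = (fun w => \sum_(j <- index_enum 'I_m)
    if j == I w tau then step_q pb theta (S w) j tau else 0)).
  apply: vmeasurable_sum => j; apply: vmeasurable_if => //.
  by apply/vmeasurableZ/vmeasurable_mulmx/vmeasurable_step_dir.
apply/funext => w; rewrite (bigD1 (I w tau))//= eqxx big1 ?addr0// => j.
by move/negPf => ->.
Qed.

Lemma measurable_gap x alpha : vmeasurable x -> (forall i tau, vmeasurable (alpha i tau)) ->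
  measurable_fun setT (fun w : T => (primal pb (x w) - dual pb (fun i tau => alpha i tau w))%E).
Proof.
move=> mx ma; under eq_fun do rewrite gapE//.
have [_ glsc _] := reg_pcc.
apply: emeasurable_funD; first apply: emeasurable_funD.
- apply/measurable_EFinP; apply: measurable_funD.
    apply: measurable_funM; first exact: measurable_cst.
    apply: measurable_sum => tau; apply: measurable_sum => i.
    apply: (@vmeasurable_continuous _ _ _ _ (fun w => (matA pb i tau)^T *m x w)).
      exact: vmeasurable_mulmx.
    have [dphi _] := phi_smooth i tau.
    by move=> z; apply: differentiable_continuous; exact: dphi.
  apply: measurable_funM; first exact: measurable_cst.
  apply: (@measurableT_comp _ _ _ _ _ _ (@fine R)); first exact: fine_measurable.
  apply: vmeasurable_lsc; last exact: lower_semicontinuous_conjugate.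
  rewrite /dual_point; apply: vmeasurableZ; apply: vmeasurable_sum => tau.
  by apply: vmeasurable_sum => i; exact: vmeasurable_mulmx.
- by apply: measurable_funeM; exact: vmeasurable_lsc.
- apply: measurable_funeM; apply: emeasurable_sum => tau.
  apply: emeasurable_sum => i.
  apply: (@vmeasurable_lsc _ _ _ _ (fun w => - alpha i tau w)).
    exact: vmeasurableN.
  exact: lower_semicontinuous_conjugate.
Qed.

Lemma measurable_Psi1 delta :
  measurable_fun setT (fun w => Psi1 pb delta theta (S w)).
Proof.
have [mx ma _ me] := mS.
apply: emeasurable_funD.
  exact: (@measurable_gap (fun w => st_x (S w)) (fun i tau w => st_alpha (S w) i tau)).
apply/measurable_EFinP; apply: measurable_funM; first exact: measurable_cst.
by apply: measurable_sum => tau; exact: vmeasurable_enorm_sqr.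
Qed.

End OneState.

Context {dZ : measure_display} {Z : measurableType dZ}.
Variable Q : Z -> 'cV[R]_dd -> 'cV[R]_dd.
Hypothesis mQ : randomized_map Q.

Lemma vmeasurable_randomized_map d (T : measurableType d) (z : T -> Z)
    (F : T -> 'cV[R]_dd) : measurable_fun setT z -> vmeasurable F ->
  vmeasurable (fun w => Q (z w) (F w)).
Proof.
move=> mz mF; apply: borel_vmeasurable.
apply: (@measurableT_comp _ _ _ _ _ _ (fun p : Z * borel_cV R dd => Q p.1 p.2 : borel_cV R dd)
  setT (fun w => (z w, F w : borel_cV R dd))); first exact: mQ.
by apply: measurable_fun_pair => //; exact: vmeasurable_borel.
Qed.

Lemma smeasurable_ec_step d (T : measurableType d) (S : T -> ec_state R m n dd t)
    (I : T -> 'I_n -> 'I_m) (z : 'I_n -> T -> Z) :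
  smeasurable S -> (forall i tau, measurable_fun setT (fun w => i == I w tau)) ->
  (forall tau, measurable_fun setT (z tau)) ->
  smeasurable (fun w => ec_step pb Q theta (I w) (z ^~ w) (S w)).
Proof.
move=> mS mI mz; have [mx ma mu me] := mS.
have mq tau : vmeasurable (fun w => step_q pb theta (S w) (I w tau) tau).
  exact: vmeasurable_step_q.
have mQq tau : vmeasurable (fun w => Q (z tau w)
    (step_q pb theta (S w) (I w tau) tau + st_e (S w) tau)).
  by apply: vmeasurable_randomized_map => //; exact: vmeasurableD.
split.
- exact: vmeasurable_step_x.
- by move=> i tau; apply: vmeasurable_step_alpha.
- apply: vmeasurableD => //; apply: vmeasurableZ.
  by apply: vmeasurable_sum => tau; exact: mQq.
- move=> tau; apply: vmeasurableD; first exact: (vmeasurableD (me tau) (mq tau)).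
  exact: (vmeasurableN (mQq tau)).
Qed.

(** Only draws before k are required to be measurable, so the lemma applies both to Omega and to
    Omega with the smaller sigma-algebra of the past. *)
Lemma smeasurable_ec_quartz d (T : measurableType d) x0 alpha0
    (idx : nat -> 'I_n -> T -> 'I_m) (xi : nat -> 'I_n -> T -> Z) (k : nat) :
  (forall j i tau, (j < k)%N -> measurable (idx j tau @^-1` [set i])) ->
  (forall j tau, (j < k)%N -> measurable_fun setT (xi j tau)) ->
  smeasurable (ec_quartz pb Q theta x0 alpha0 idx xi k).
Proof.
elim: k => [|k IHk] midx mxi.
  by split=> [|i tau||tau]; exact: vmeasurable_cst.
apply: (@smeasurable_ec_step _ _ (ec_quartz pb Q theta x0 alpha0 idx xi k)
  (fun w tau => idx k tau w) (fun tau w => xi k tau w)).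
- by apply: IHk => [j i tau jk|j tau jk]; [apply: midx|apply: mxi]; exact: ltnW.
- move=> i tau; apply: (measurable_fun_bool true); rewrite setTI.
  rewrite (_ : _ @^-1` _ = idx k tau @^-1` [set i]); first exact: midx.
  by apply/seteqP; split => w /=; [move/eqP|move=> ->; rewrite eqxx].
- by move=> tau; exact: mxi.
Qed.

End StateMeasurability.

(** * Independence of the current draw from the past *)

Section Sampling.
Context {R : realType} {m n : nat}.
Context {dZ dO : measure_display} {Z : measurableType dZ} {mu : probability Z R}.
Context {Omega : measurableType dO} {Pr : probability Omega R}.
Context {idx : nat -> 'I_n -> Omega -> 'I_m} {xi : nat -> 'I_n -> Omega -> Z}.
Hypothesis m_gt0 : (0 < m)%N.
Hypothesis Hs : ec_sampling mu Pr idx xi.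

Local Notation J := ((nat * 'I_n) + (nat * 'I_n))%type.

Let Fam (j : J) : set (set Omega) :=
  match j with
  | inl (k, tau) => preimage_set_system setT (idx k tau) setT
  | inr (k, tau) => preimage_set_system setT (xi k tau) measurable
  end.

Let Fam_indep : mutually_independent Pr Fam := sampling_independent Hs.

Let Fam_idx k tau (B : set 'I_m) : Fam (inl (k, tau)) (idx k tau @^-1` B).
Proof. by exists B => //; rewrite setTI. Qed.

Let Fam_xi k tau (B : set Z) : measurable B -> Fam (inr (k, tau)) (xi k tau @^-1` B).
Proof. by exists B => //; rewrite setTI. Qed.

Let FamI j A B : Fam j A -> Fam j B -> Fam j (A `&` B).
Proof.
case: j => -[k tau] /= [A' mA <-] [B' mB <-]; exists (A' `&` B') => //;
  rewrite ?preimage_setI ?setTI//.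
exact: measurableI.
Qed.

Let FamT j : Fam j setT.
Proof.
by case: j => -[k tau] /=; exists setT => //; rewrite ?preimage_setT ?setTI.
Qed.

Lemma idx_preimage_measurable k tau (B : set 'I_m) : measurable (idx k tau @^-1` B).
Proof.
have -> : idx k tau @^-1` B = \bigcup_(i in B) idx k tau @^-1` [set i].
  by apply/seteqP; split => [w Bw|w [i Bi /= ->//]]; exists (idx k tau w).
apply: fin_bigcup_measurable; first exact: finite_finset.
by move=> i _; exact: (idx_measurable Hs).
Qed.

Let Fam_measurable j A : Fam j A -> measurable A.
Proof.
case: j => -[k tau] /= [A' mA <-]; rewrite setTI; first exact: idx_preimage_measurable.
by rewrite -[X in measurable X]setTI; exact: (xi_measurable Hs).
Qed.

Definition is_past k (j : J) : bool :=
  match j with inl (a, _) => (a < k)%N | inr (a, _) => (a < k)%N end.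

(* The pi-system generating the sigma-algebra of the first k iterations. *)
Definition past_events k : set (set Omega) :=
  [set X | exists (s : seq J) (E : J -> set Omega),
    [/\ uniq s, (forall j, j \in s -> is_past k j /\ Fam j (E j)) &
        X = \bigcap_(j in [set` s]) E j]].

Lemma past_events_setT k : past_events k setT.
Proof.
exists [::], (fun=> setT); split => //.
by rewrite (_ : [set` [::]] = set0) ?bigcap_set0//; apply/seteqP; split.
Qed.

(** Two index lists may overlap, whereas independence wants distinct indices: events at a common
    index are intersected, with [setT] where one list is silent. *)
Lemma past_events_setI k : setI_closed (past_events k).
Proof.
move=> _ _ [s1 [E1 [u1 h1 ->]]] [s2 [E2 [u2 h2 ->]]].
exists (undup (s1 ++ s2)), (fun j => (if j \in s1 then E1 j else setT) `&`
  (if j \in s2 then E2 j else setT)); split; first exact: undup_uniq.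
  move=> j; rewrite mem_undup mem_cat => j12; split.
    by case/orP: j12 => [/h1|/h2] [].
  by apply: FamI; case: ifP => //; [move=> /h1[]|move=> /h2[]].
apply/seteqP; split => w.
  move=> [w1 w2] j /= _; split; case: ifP => // js; [exact: w1|exact: w2].
move=> w12; split => j /= js.
  have /= := w12 j; rewrite mem_undup mem_cat js => /(_ isT)[].
  by [].
have /= := w12 j; rewrite mem_undup mem_cat js orbT => /(_ isT)[_].
by [].
Qed.

Lemma past_events_measurable k : past_events k `<=` measurable.
Proof.
move=> _ [s [E [us h ->]]]; apply: fin_bigcap_measurable; first exact: finite_seq.
by move=> j /= /h[_]; exact: Fam_measurable.
Qed.

Lemma past_events_idx k j tau i : (j < k)%N -> past_events k (idx j tau @^-1` [set i]).
Proof.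
move=> jk; exists [:: inl (j, tau)], (fun=> idx j tau @^-1` [set i]); split => //.
  by move=> l; rewrite inE => /eqP->; split => //; exact: Fam_idx.
by rewrite set_cons1 bigcap_set1.
Qed.

Lemma past_events_xi k j tau B : (j < k)%N -> measurable B ->
  past_events k (xi j tau @^-1` B).
Proof.
move=> jk mB; exists [:: inr (j, tau)], (fun=> xi j tau @^-1` B); split => //.
  by move=> l; rewrite inE => /eqP->; split => //; exact: Fam_xi.
by rewrite set_cons1 bigcap_set1.
Qed.

Definition cell k (I : 'I_n -> 'I_m) : set Omega :=
  \bigcap_(tau in [set: 'I_n]) idx k tau @^-1` [set I tau].

Lemma cell_measurable k I : measurable (cell k I).
Proof.
apply: fin_bigcap_measurable; first exact: finite_finset.
by move=> tau _; exact: (idx_measurable Hs).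
Qed.

Let c : R := m%:R^-1 ^+ n.

Lemma past_events_indep k A I tau B : past_events k A -> measurable B ->
  (Pr (A `&` (cell k I `&` xi k tau @^-1` B)) = Pr A * (c%:E * mu B))%E.
Proof.
move=> [s [E [us h AE]]] mB.
pose s1 : seq J := [seq inl (k, sg) | sg <- enum 'I_n].
pose s' := s ++ s1 ++ [:: inr (k, tau)].
(* Past indices lie strictly below k, so overwriting the events of iteration k does not alter those
   of [s]. *)
pose E' (j : J) : set Omega := match j with
  | inl (a, sg) => if a == k then idx k sg @^-1` [set I sg] else E j
  | inr (a, sg) => if a == k then xi k sg @^-1` B else E j end.
have EE' j : j \in s -> E' j = E j.
  by move=> /h[]; case: j => -[a sg] /= ak _; rewrite ltn_eqF.
have s1P j : j \in s1 -> exists sg, j = inl (k, sg).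
  by move=> /mapP[sg _ ->]; exists sg.
have us' : uniq s'.
  rewrite !cat_uniq us /= andbT orbF; apply/and3P; split.
  - rewrite has_cat negb_or /= orbF; apply/andP; split.
      apply/hasPn => j /s1P[sg ->]; apply/negP => /h[] /=.
      by rewrite ltnn.
    by apply/negP => /h[] /=; rewrite ltnn.
  - by rewrite map_inj_uniq ?enum_uniq// => x y [].
  - by apply/negP => /s1P[].
have AE' : A = \bigcap_(j in [set` s]) E' j.
  by rewrite AE; apply: eq_bigcapr => j /= /EE'.
have -> : A `&` (cell k I `&` xi k tau @^-1` B) = \bigcap_(j in [set` s']) E' j.
  apply/seteqP; split => w.
    move=> [wA [wD wB]] j /=; rewrite !mem_cat inE => /or3P[js|/s1P[sg ->]|/eqP->].
    - by move: wA; rewrite AE'; apply.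
    - by rewrite /E' eqxx; exact: wD.
    - by rewrite /E' eqxx.
  move=> ws'; split; [|split].
  - by rewrite AE' => j /= js; apply: ws'; rewrite /= mem_cat js.
  - move=> sg _; have /= := ws' (inl (k, sg)); rewrite eqxx; apply.
    by rewrite !mem_cat map_f ?mem_enum// orbT.
  - by have /= := ws' (inr (k, tau)); rewrite eqxx; apply; rewrite !mem_cat inE eqxx !orbT.
rewrite Fam_indep//; last first.
  move=> j; rewrite !mem_cat inE => /or3P[js|/s1P[sg ->]|/eqP->].
  - by rewrite EE'//; have [] := h _ js.
  - by rewrite /E' eqxx; exact: Fam_idx.
  - by rewrite /E' eqxx; exact: Fam_xi.
rewrite /s' big_cat /= big_cat/= big_seq1 {3}/E' eqxx (xi_law Hs)//.
congr (_ * (_ * _))%E.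
  rewrite AE' Fam_indep// => j js; rewrite EE'//; by have [] := h _ js.
rewrite big_map big_enum /= (eq_bigr (fun=> (m%:R^-1)%:E)); last first.
  by move=> sg _; rewrite eqxx (idx_uniform Hs).
by rewrite prodEFin prodr_const card_ord.
Qed.

(** Both sides are finite measures in A that agree on a pi-system containing [setT], hence on the
    sigma-algebra it generates. *)
Lemma past_sigma_indep k A I tau B : <<s past_events k >> A -> measurable B ->
  (Pr (A `&` (cell k I `&` xi k tau @^-1` B)) = Pr A * (c%:E * mu B))%E.
Proof.
move=> sA mB.
have mC : measurable (cell k I `&` xi k tau @^-1` B).
  apply: measurableI; first exact: cell_measurable.
  by rewrite -[X in measurable X]setTI; exact: (xi_measurable Hs).
have c0 : 0 <= c by rewrite exprn_ge0// invr_ge0.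
have muB : mu B \is a fin_num by rewrite fin_num_measure.
have cB0 : 0 <= c * fine (mu B) by rewrite mulr_ge0// fine_ge0// measure_ge0.
have cBE : (c%:E * mu B = (NngNum cB0)%:num%:E)%E by rewrite EFinM fineK.
have := @g_sigma_algebra_measure_unique _ _ _ (past_events k)
  (@past_events_measurable k) (fun=> setT) (fun=> past_events_setT k) _
  (mrestr Pr mC) (mscale (NngNum cB0) Pr) (@past_events_setI k).
rewrite bigcup_const// => /(_ erefl) u; rewrite cBE muleC.
apply: u => //.
- move=> X pX; rewrite /= /mrestr /mscale/=.
  by rewrite past_events_indep// cBE muleC.
- by move=> _; rewrite /= /mrestr (le_lt_trans (probability_le1 _ _)) ?ltry ?setTI.
Qed.

(** Omega with the sigma-algebra of the past: measurability on this type means depending only on the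
    first k iterations, and product measures with the seed space become available. *)
Definition past_type k := g_sigma_algebraType (past_events k).

Lemma measurable_past_id k :
  measurable_fun [set: Omega] (fun w : Omega => w : past_type k).
Proof.
move=> _ A sA; rewrite setTI preimage_id.
apply: (smallest_sub (@sigma_algebra_measurable _ Omega)); last exact: sA.
exact: past_events_measurable.
Qed.

Section PastFubini.
Variables (k : nat) (I : 'I_n -> 'I_m) (tau : 'I_n).

Let pair_xi (w : Omega) : past_type k * Z := (w, xi k tau w).

Let mpair_xi : measurable_fun setT pair_xi.
Proof.
by apply: measurable_fun_pair; [exact: measurable_past_id|exact: (xi_measurable Hs)].
Qed.

Let id_mfun : {mfun Omega >-> past_type k} :=
  HB.pack (fun w : Omega => w : past_type k)
    (isMeasurableFun.Build _ _ _ _ _ (@measurable_past_id k)).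

Let law_past : probability (past_type k) R := distribution Pr id_mfun.

Let law_pair : {measure set (past_type k * Z) -> \bar R} :=
  mscale (NngNum (exprn_ge0 n (ler0n R m)))
    (measure_function_pushforward__canonical__measure_function_Measure
      (mrestr Pr (cell_measurable k I)) mpair_xi).

(** Two measures on a product agree once they agree on rectangles, where [past_sigma_indep]
    applies. *)
Let law_pairE A : measurable A -> (law_past \x mu)%E A = law_pair A.
Proof.
apply: product_measure_unique => {}A B mA mB.
rewrite /law_pair /= /mscale/= /pushforward /mrestr.
have -> : pair_xi @^-1` (A `*` B) `&` cell k I =
    A `&` (cell k I `&` xi k tau @^-1` B).
  by apply/seteqP; split => w /=; [move=> [[]]|move=> [? []]].
rewrite past_sigma_indep// muleCA (muleA (m%:R ^+ n)%:E) -EFinM.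
have -> : m%:R ^+ n * c = 1.
  by rewrite /c exprVn mulfV// expf_neq0// pnatr_eq0 -lt0n.
by rewrite mul1e.
Qed.

(* The pushforward under (past, xi k tau) of Pr restricted to the cell
   {idx k = I} is m^-n times the product of the law of the past with mu. *)
Lemma past_fubini (F : Omega -> Z -> \bar R) :
  measurable_fun setT (fun p : past_type k * Z => F p.1 p.2) ->
  (forall w z, 0 <= F w z)%E ->
  (\int[Pr]_(w in cell k I) F w (xi k tau w) =
   c%:E * \int[Pr]_w \int[mu]_z F w z)%E.
Proof.
move=> mF F0; pose G (p : past_type k * Z) := F p.1 p.2.
have G0 p : (0 <= G p)%E by exact: F0.
have mn0 : m%:R ^+ n != 0 :> R by rewrite expf_neq0// pnatr_eq0 -lt0n.
have e1 : (\int[law_past \x mu]_p G p = \int[Pr]_w \int[mu]_z F w z)%E.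
  rewrite (fubini_tonelli1 G mF G0) ge0_integral_distribution//.
    exact: measurable_fun_fubini_tonelli_F.
  by move=> w; exact: integral_ge0.
have e2 : (\int[law_past \x mu]_p G p = \int[law_pair]_p G p)%E.
  by apply: eq_measure_integral => A mA _; exact: law_pairE.
have e3 : (\int[law_pair]_p G p =
    (m%:R ^+ n)%:E * \int[Pr]_(w in cell k I) F w (xi k tau w))%E.
  rewrite ge0_integral_mscale//= ge0_integral_pushforward// preimage_setT.
  rewrite integral_mrestr//; last by move=> w; exact: G0.
  exact: (@measurableT_comp _ _ _ _ _ _ G setT pair_xi mF mpair_xi).
by rewrite -e1 e2 e3 muleA -EFinM /c exprVn mulVf// mul1e.
Qed.

End PastFubini.

End Sampling.

(** * Expected decrease *)

Section Expectation.
Context {R : realType} {m n d t : nat}.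
Variables (pb : problem R m n d t) (gamma delta : R).
Context {dZ dO : measure_display} {Z : measurableType dZ} {mu : probability Z R}.
Context {Omega : measurableType dO} {Pr : probability Omega R}.
Context {idx : nat -> 'I_n -> Omega -> 'I_m} {xi : nat -> 'I_n -> Omega -> Z}.
Variables (Q : Z -> 'cV[R]_d -> 'cV[R]_d).
Variables (x0 : 'cV[R]_d) (alpha0 : 'I_m -> 'I_n -> 'cV[R]_t).
Hypotheses (m_gt0 : (0 < m)%N) (n_gt0 : (0 < n)%N) (d_gt0 : (0 < d)%N).
Hypothesis gamma_gt0 : 0 < gamma.
Hypothesis phi_cvx : forall i tau, convex_function [set: 'cV[R]_t] (phi pb i tau).
Hypothesis phi_smooth : forall i tau, smooth gamma^-1 (phi pb i tau).
Hypotheses (reg_pcc : proper_closed_convex (reg pb)) (reg_sc : strongly_convex1 (reg pb)).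
Hypotheses (lam_gt0 : 0 < lam pb) (lam_le : lam pb <= Rtot pb ^+ 2 / gamma).
Hypotheses (mQ : randomized_map Q) (Qc : contraction_compressor mu delta Q).
Hypothesis delta_lt1 : delta < 1.
Hypothesis Hs : ec_sampling mu Pr idx xi.

Let delta_gt0 : 0 < delta. Proof. by have [/andP[]] := Qc. Qed.
Let theta := theta_choice pb gamma delta.
Let kappa := 2 * (rho pb delta + theta * lam pb) / (delta * n%:R).
Let S k w := ec_quartz pb Q theta x0 alpha0 idx xi k w.
Let Psi k w := Psi1 pb delta theta (S k w).
Let c : R := m%:R^-1 ^+ n.
Let V I k tau w := step_q pb theta (S k w) (I tau) tau + st_e (S k w) tau.
Let gap I k w :=
  (primal pb (step_x pb theta (S k w)) - dual pb (step_alpha pb theta I (S k w)))%E.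

Local Notation past k := (past_type (idx := idx) (xi := xi) k).

Let kappa0 : 0 <= kappa. Proof. exact: (kappa_ge0 m_gt0 n_gt0 d_gt0 gamma_gt0). Qed.

Let gap0 I k w : (0 <= gap I k w)%E. Proof. exact: gap_ge0. Qed.

Let smeasurable_past k :
  @smeasurable R m n d t _ (past k) (S k).
Proof.
apply: (@smeasurable_ec_quartz R m n d t pb gamma) => //.
  by move=> j i tau jk; apply: sub_sigma_algebra; exact: past_events_idx.
move=> j tau jk _ B mB; rewrite setTI; apply: sub_sigma_algebra.
exact: past_events_xi.
Qed.

Let smeasurableT k : @smeasurable R m n d t _ Omega (S k).
Proof.
apply: (@smeasurable_ec_quartz R m n d t pb gamma) => //.
  by move=> j i tau _; exact: (idx_measurable Hs).
by move=> j tau _; exact: (xi_measurable Hs).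
Qed.

Let mgap_past I k :
  measurable_fun [set: past k] (gap I k).
Proof.
apply: (@measurable_gap R m n d t pb gamma phi_smooth reg_pcc reg_sc _
  (past k) (fun w => step_x pb theta (S k w))
  (fun i tau w => step_alpha pb theta I (S k w) i tau)).
  exact: (vmeasurable_step_x theta reg_pcc reg_sc (smeasurable_past k)).
move=> i tau.
apply: (@vmeasurable_step_alpha R m n d t pb gamma theta phi_smooth reg_pcc
  reg_sc _ (past k) (S k) (smeasurable_past k) (fun=> I)) => sg.
exact: measurable_cst.
Qed.

Let mV_past I k tau :
  @vmeasurable R _ (past k) d (V I k tau).
Proof.
apply: vmeasurableD; last by have [_ _ _] := smeasurable_past k; exact.
apply: (@vmeasurable_step_q R m n d t pb gamma theta phi_smooth reg_pcc
  reg_sc _ (past k) (S k) (smeasurable_past k) (fun=> I)) => i sg.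
exact: measurable_cst.
Qed.

Let past_measurable dY (Y : measurableType dY) k (f : Omega -> Y) :
  measurable_fun [set: past k] f ->
  measurable_fun [set: Omega] f.
Proof.
move=> mf; apply: (@measurableT_comp _ _ _ _ _ _ (f : past k -> Y) setT
  (fun w : Omega => w : past k)) => //; exact: (measurable_past_id Hs).
Qed.

(** The contribution of one node involves one seed only; by linearity [past_fubini] is applied node
    by node. *)
Let err I k tau w z : \bar R :=
  (kappa * enorm (V I k tau w - Q z (V I k tau w)) ^+ 2)%:E.

Let merr I k tau : measurable_fun
  [set: past k * Z] (fun p => err I k tau p.1 p.2).
Proof.
apply/measurable_EFinP; apply: measurable_funM; first exact: measurable_cst.
have mV : vmeasurable (fun p : past k * Z => V I k tau p.1).
  by move=> i; apply: (measurableT_comp (mV_past I tau i)); exact: measurable_fst.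
apply: vmeasurable_enorm_sqr; apply: vmeasurableD => //; apply: vmeasurableN.
by apply: vmeasurable_randomized_map => //; exact: measurable_snd.
Qed.

Let err_le I k tau w : (\int[mu]_z err I k tau w z <=
  (kappa * ((1 - delta) * enorm (V I k tau w) ^+ 2))%:E)%E.
Proof.
rewrite /err; under eq_integral do rewrite EFinM.
rewrite ge0_integralZl_EFin//; last 2 first.
- by move=> z _; rewrite lee_fin sqr_ge0.
- apply/measurable_EFinP; apply: vmeasurable_enorm_sqr.
  apply: vmeasurableD; first exact: vmeasurable_cst.
  apply: vmeasurableN; apply: (@vmeasurable_randomized_map _ _ _ _ Q mQ _ Z id).
    exact: measurable_id.
  exact: vmeasurable_cst.
rewrite [X in (_ <= X)%E]EFinM; apply: lee_wpmul2l; first by rewrite lee_fin.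
exact: Qc.2.
Qed.

Let stepPsi k w (I : 'I_n -> 'I_m) : (forall tau, idx k tau w = I tau) ->
  (Psi k.+1 w = gap I k w + \sum_tau err I k tau w (xi k tau w))%E.
Proof.
move=> /funext eI.
have -> : Psi k.+1 w = Psi1 pb delta theta (ec_step pb Q theta
    (fun tau => idx k tau w) (fun tau => xi k tau w) (S k w)) by [].
rewrite eI Psi1E ec_stepE /= -/theta -/kappa -/(gap I k w).
suff -> : (\sum_tau err I k tau w (xi k tau w))%E =
  (kappa * \sum_(tau < n) enorm (st_e (S k w) tau + step_q pb theta (S k w) (I tau) tau -
    Q (xi k tau w) (step_q pb theta (S k w) (I tau) tau + st_e (S k w) tau)) ^+ 2)%:E by [].
rewrite mulr_sumr -sumEFin; apply: eq_bigr => tau _; rewrite /err /V.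
by rewrite [st_e _ _ + _]addrC.
Qed.

Let cellE k w (I : {ffun 'I_n -> 'I_m}) : cell (idx := idx) k I w ->
  I = [ffun tau => idx k tau w].
Proof. by move=> wI; apply/ffunP => tau; rewrite ffunE -(wI tau). Qed.

Let kV_ge0 (v : 'I_n -> 'cV[R]_d) :
  0 <= kappa * ((1 - delta) * \sum_tau enorm (v tau) ^+ 2).
Proof.
by rewrite mulr_ge0// mulr_ge0 ?subr_ge0 ?(ltW delta_lt1)// sumr_ge0// => tau _; exact: sqr_ge0.
Qed.

Let kV1_ge0 (v : 'cV[R]_d) : 0 <= kappa * ((1 - delta) * enorm v ^+ 2).
Proof. by rewrite mulr_ge0// mulr_ge0 ?subr_ge0 ?(ltW delta_lt1)// sqr_ge0. Qed.

Let cell_integral k (I : {ffun 'I_n -> 'I_m}) :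
  (\int[Pr]_(w in cell (idx := idx) k I) Psi k.+1 w <=
   \int[Pr]_w (c%:E * (gap I k w + (kappa * ((1 - delta) * \sum_tau
     enorm (V I k tau w) ^+ 2))%:E)))%E.
Proof.
have c0 : 0 <= c by rewrite exprn_ge0// invr_ge0.
have mcell := cell_measurable Hs k I.
have err0 tau w z : (0 <= err I k tau w z)%E by rewrite lee_fin mulr_ge0// sqr_ge0.
have merrT tau : measurable_fun setT (fun w => err I k tau w (xi k tau w)).
  apply: (@measurableT_comp _ _ _ _ _ _ (fun p : past k * Z =>
    err I k tau p.1 p.2) setT (fun w : Omega => (w : past k, xi k tau w))).
    exact: merr.
  apply: measurable_fun_pair; last exact: (xi_measurable Hs).
  exact: (measurable_past_id Hs).
have mgapT : measurable_fun setT (gap I k) by apply: past_measurable; exact: mgap_past.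
have mVT tau : measurable_fun setT (fun w => enorm (V I k tau w) ^+ 2).
  by apply: past_measurable; apply: vmeasurable_enorm_sqr; exact: mV_past.
rewrite (eq_integral (fun w => gap I k w + \sum_tau err I k tau w (xi k tau w)))%E; last first.
  by move=> w; rewrite inE => Iw; apply: stepPsi => tau; exact: Iw.
rewrite ge0_integralD//; last 3 first.
- exact: measurable_funTS.
- by move=> w _; apply: sume_ge0.
- by apply: measurable_funTS; apply: emeasurable_sum.
rewrite ge0_integral_sum//; last by move=> tau; exact: measurable_funTS.
(* The gap involves no current seed; any node's seed serves as a dummy variable for
   [past_fubini]. *)
pose tau0 := Ordinal n_gt0.
have -> : (\int[Pr]_(w in cell (idx := idx) k I) gap I k w = c%:E * \int[Pr]_w gap I k w)%E.
  rewrite (past_fubini m_gt0 Hs I tau0 (F := fun w _ => gap I k w))//; last first.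
    apply: (@measurableT_comp _ _ _ _ _ _ (gap I k : past k -> \bar R) setT
      (fun p : past k * Z => p.1)); [exact: mgap_past|exact: measurable_fst].
  congr (_ * _)%E; apply: eq_integral => w _.
  have := integral_cst mu (@measurableT _ Z) (gap I k w).
  by move=> ->; rewrite -[RHS]mule1; congr (_ * _)%E; exact: probability_setT.
rewrite ge0_integralZl_EFin//; last 2 first.
- by move=> w _; rewrite adde_ge0// lee_fin kV_ge0.
- apply: emeasurable_funD => //; apply/measurable_EFinP.
  by do 2 (apply: measurable_funM; first exact: measurable_cst); apply: measurable_sum.
rewrite [X in (_ <= _ * X)%E]ge0_integralD//; last 2 first.
- by move=> w _; rewrite lee_fin kV_ge0.
- apply/measurable_EFinP.
  by do 2 (apply: measurable_funM; first exact: measurable_cst); apply: measurable_sum.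
rewrite [X in (_ <= X)%E]ge0_muleDr; last 2 first.
- exact: integral_ge0.
- by apply: integral_ge0 => w _; rewrite lee_fin kV_ge0.
apply: leeD => //.
under [X in (_ <= _ * X)%E]eq_integral do rewrite !mulr_sumr -sumEFin.
rewrite ge0_integral_sum//; last 2 first.
- move=> tau; apply/measurable_EFinP.
  by do 2 (apply: measurable_funM; first exact: measurable_cst).
- by move=> tau w _; rewrite lee_fin kV1_ge0.
rewrite ge0_sume_distrr; last first.
  move=> tau _; apply: integral_ge0 => w _.
  by rewrite lee_fin kV1_ge0.
apply: lee_sum => tau _.
rewrite (past_fubini m_gt0 Hs I tau (F := err I k tau))//.
apply: lee_wpmul2l; first by rewrite lee_fin.
apply: ge0_le_integral => //.
- by move=> w _; exact: integral_ge0.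
- apply: (@past_measurable _ _ k).
  exact: (@measurable_fun_fubini_tonelli_F _ _ _ _ _ mu _ (merr I tau)).
- by apply/measurable_EFinP; do 2 (apply: measurable_funM; first exact: measurable_cst).
Qed.

Let Sinv k w : ec_inv pb (S k w).
Proof. by elim: k => [|k ih]; [exact: ec_inv_init|exact: ec_inv_step]. Qed.

Lemma expected_Psi1_step k : (\int[Pr]_w Psi k.+1 w <=
  (1 - Num.min theta (delta / 4))%:E * \int[Pr]_w Psi k w)%E.
Proof.
have c0 : 0 <= c by rewrite exprn_ge0// invr_ge0.
have Psi0 l w : (0 <= Psi l w)%E by exact: (Psi1_ge0 m_gt0 n_gt0 d_gt0 gamma_gt0).
have mPsi l : measurable_fun setT (Psi l).
  exact: (measurable_Psi1 theta phi_smooth reg_pcc reg_sc (smeasurableT l)).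
have [c1_gt0 c1_lt1] := contraction_factor_bounds m_gt0 n_gt0 d_gt0 gamma_gt0
  delta_gt0 delta_lt1 lam_gt0 lam_le.
pose Cell (I : {ffun 'I_n -> 'I_m}) := cell (idx := idx) k I.
have cover : \big[setU/set0]_(I <- index_enum {ffun 'I_n -> 'I_m}) Cell I = setT.
  apply/seteqP; split => // w _; rewrite -bigcup_seq.
  exists [ffun tau => idx k tau w]; first by rewrite /= mem_index_enum.
  by move=> tau _; rewrite /= ffunE.
have -> : (\int[Pr]_w Psi k.+1 w = \sum_(I : {ffun 'I_n -> 'I_m})
    \int[Pr]_(w in Cell I) Psi k.+1 w)%E.
  rewrite -[in LHS]cover ge0_integral_bigsetU//.
  - by move=> I; exact: (cell_measurable Hs).
  - exact: index_enum_uniq.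
  - by apply/trivIsetP => I I' _ _ II'; apply/seteqP; split => // w [/cellE e /cellE e'];
      move/eqP: II'; rewrite e e'.
  - exact: measurable_funTS.
pose h I w := (c%:E * (gap I k w + (kappa * ((1 - delta) * \sum_tau
     enorm (V I k tau w) ^+ 2))%:E))%E.
have h0 I w : (0 <= h I w)%E.
  by rewrite mule_ge0// ?lee_fin// adde_ge0// lee_fin kV_ge0.
have mh I : measurable_fun setT (h I).
  apply: measurable_funeM; apply: emeasurable_funD.
    by apply: past_measurable; exact: mgap_past.
  apply/measurable_EFinP.
  do 2 (apply: measurable_funM; first exact: measurable_cst).
  apply: measurable_sum => tau; apply: (@past_measurable _ _ k).
  by apply: vmeasurable_enorm_sqr; exact: mV_past.
apply: (@le_trans _ _ (\sum_(I : {ffun 'I_n -> 'I_m}) \int[Pr]_w h I w)%E).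
  by apply: lee_sum => I _; exact: cell_integral.
rewrite -ge0_integral_sum// -ge0_integralZl_EFin ?subr_ge0 ?(ltW c1_lt1)//.
apply: ge0_le_integral => //.
- by move=> w _; apply: sume_ge0.
- exact: emeasurable_sum.
- exact: measurable_funeM.
- move=> w _.
  exact: (one_step_le m_gt0 n_gt0 d_gt0 gamma_gt0 phi_cvx phi_smooth reg_pcc reg_sc
    delta_gt0 delta_lt1 lam_gt0 lam_le (Sinv k w)).
Qed.

Lemma expected_Psi1_le k : (\int[Pr]_w Psi k w <=
  ((1 - Num.min theta (delta / 4)) ^+ k)%:E * Psi1 pb delta theta (ec_init pb x0 alpha0))%E.
Proof.
have [_ c1_lt1] := contraction_factor_bounds m_gt0 n_gt0 d_gt0 gamma_gt0
  delta_gt0 delta_lt1 lam_gt0 lam_le.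
elim: k => [|k ih].
  rewrite expr0 mul1e -[leRHS]mule1.
  have -> : (\int[Pr]_w Psi 0 w = Psi1 pb delta theta (ec_init pb x0 alpha0) * 1)%E.
    apply: (etrans (integral_cst Pr (@measurableT _ Omega)
      (Psi1 pb delta theta (ec_init pb x0 alpha0)))).
    by congr (_ * _)%E; exact: probability_setT.
  by [].
apply: (le_trans (expected_Psi1_step k)); rewrite exprS EFinM -muleA.
by apply: lee_wpmul2l => //; rewrite lee_fin subr_ge0 ltW.
Qed.

End Expectation.

(** The constant 48 = 2 * 24 buys (1 - c)^k <= eps^2 instead of eps; the spare factor eps absorbs B
    because eps (1 + |B|) <= 1. *)
Lemma geometric_le_eps (R : realType) (c K B eps : R) k :
  0 < c < 1 -> c^-1 <= 24 * K -> 0 < eps -> eps <= (1 + `|B|)^-1 ->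
  48 * (K * ln (1 / eps)) <= k%:R -> (1 - c) ^+ k * B <= eps.
Proof.
move=> /andP[c0 c1] cK eps0 epsB kK.
have B1 : 0 < 1 + `|B| by rewrite ltr_wpDr.
have eps1 : eps <= 1.
  by apply: (le_trans epsB); rewrite invf_le1// lerDl.
have epsB1 : eps * `|B| <= 1.
  have : eps * (1 + `|B|) <= 1 by rewrite -ler_pdivlMr// div1r.
  by apply: le_trans; apply: ler_wpM2l; [exact: ltW|rewrite lerDr].
set L := ln (1 / eps) in kK.
have LE : L = - ln eps by rewrite /L div1r lnV ?posrE.
have L0 : 0 <= L by rewrite LE oppr_ge0 -ln1 ler_ln ?posrE.
have kc : 2 * L <= c * k%:R.
  rewrite mulrC -ler_pdivrMl//; apply: le_trans kK.
  rewrite (_ : 48 * (K * L) = 24 * K * (2 * L)); last by ring.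
  by rewrite [L * 2]mulrC ler_wpM2r ?mulr_ge0.
have h1 : (1 - c) ^+ k <= eps ^+ 2.
  apply: (@le_trans _ _ (expR (- c) ^+ k)).
    apply: lerXn2r; rewrite ?nnegrE ?expR_ge0 ?expR_ge1Dx//.
    by rewrite subr_ge0 ltW.
  rewrite -expRM_natl -[eps]lnK ?posrE// -expRM_natl ler_expR; nra.
apply: (@le_trans _ _ ((1 - c) ^+ k * `|B|)).
  by rewrite ler_wpM2l ?ler_norm// exprn_ge0// subr_ge0 ltW.
apply: (@le_trans _ _ (eps ^+ 2 * `|B|)); first by rewrite ler_wpM2r.
by rewrite expr2 -mulrA -[leRHS]mulr1; apply: ler_wpM2l; first exact: ltW.
Qed.

(* The O(.) is read as usual, for eps -> 0: the constant C is universal, and the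
   bound holds for all eps below a threshold that depends only on (an upper
   bound B of) the initial value of Psi1. *)
Theorem theorem3p3 (R : realType) :
  exists (C : R) (eps0 : R -> R),
    0 < C /\ (forall B, 0 < eps0 B) /\
    forall (m n d t : nat) (pb : problem R m n d t) (gamma delta : R)
      (dZ : measure_display) (Z : measurableType dZ) (mu : probability Z R)
      (Q : Z -> 'cV[R]_d -> 'cV[R]_d)
      (dO : measure_display) (Omega : measurableType dO)
      (Pr : probability Omega R)
      (idx : nat -> 'I_n -> Omega -> 'I_m) (xi : nat -> 'I_n -> Omega -> Z)
      (x0 : 'cV[R]_d) (alpha0 : 'I_m -> 'I_n -> 'cV[R]_t),
    (0 < m)%N -> (0 < n)%N -> (0 < d)%N -> (0 < t)%N ->
    0 < gamma ->
    (forall i tau, convex_function [set: 'cV[R]_t] (phi pb i tau)) ->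
    (forall i tau, smooth gamma^-1 (phi pb i tau)) ->
    proper_closed_convex (reg pb) ->
    strongly_convex1 (reg pb) ->
    0 < lam pb -> lam pb <= Rtot pb ^+ 2 / gamma ->
    randomized_map Q ->
    contraction_compressor mu delta Q ->
    delta < 1 ->
    ec_sampling mu Pr idx xi ->
    let theta := theta_choice pb gamma delta in
    let Psi k w :=
      Psi1 pb delta theta (ec_quartz pb Q theta x0 alpha0 idx xi k w) in
    let Psi_0 := Psi1 pb delta theta (ec_init pb x0 alpha0) in
    (forall k : nat,
      (\int[Pr]_w Psi k w
         <= ((1 - Num.min theta (delta / 4)) ^+ k)%:E * Psi_0)%E) /\
    (forall B eps : R, (Psi_0 <= B%:E)%E -> 0 < eps -> eps <= eps0 B ->
      forall k : nat, C * (complexity pb gamma delta * ln (1 / eps)) <= k%:R ->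
      (\int[Pr]_w Psi k w <= eps%:E)%E).
Proof.
exists 48, (fun B => (1 + `|B|)^-1); split => //; split.
  by move=> B; rewrite invr_gt0 ltr_wpDr.
move=> m n d t pb gamma delta dZ Z mu Q dO Omega Pr idx xi x0 alpha0.
move=> m_gt0 n_gt0 d_gt0 _ gamma_gt0 phi_cvx phi_smooth reg_pcc reg_sc.
move=> lam_gt0 lam_le mQ Qc delta_lt1 Hs theta Psi Psi_0.
have [/andP[delta_gt0 _] _] := Qc.
have rate := expected_Psi1_le x0 alpha0 m_gt0 n_gt0 d_gt0 gamma_gt0 phi_cvx
  phi_smooth reg_pcc reg_sc lam_gt0 lam_le mQ Qc delta_lt1 Hs.
split=> [k|B eps PsiB eps_gt0 eps_le k k_ge]; first exact: rate.
apply: (le_trans (rate k)).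
have c01 := contraction_factor_bounds m_gt0 n_gt0 d_gt0 gamma_gt0 delta_gt0
  delta_lt1 lam_gt0 lam_le.
have cK := inv_contraction_factor_le m_gt0 n_gt0 d_gt0 gamma_gt0 delta_gt0
  delta_lt1 lam_gt0 lam_le.
apply: (@le_trans _ _ (((1 - Num.min theta (delta / 4)) ^+ k)%:E * B%:E)%E).
  by apply: lee_wpmul2l => //; rewrite lee_fin exprn_ge0// subr_ge0 ltW// (c01.2).
rewrite -EFinM lee_fin.
by apply: (geometric_le_eps _ cK eps_gt0 eps_le k_ge); apply/andP.
Qed.
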